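(* Let $p,q,r\in[0,1]$ with $p+q+r=1$ and $0<r<1$, let $s\in[0,1]$, and let $(S_n)$ be the elephant random walk with stops (ERWS) with parameters $p,q,r,s$, with number of ones $\Sigma_n=\sum_{k=1}^nX_k^2$. Assume the critical regime $\frac{p}{1-r}=\frac34$. Then, as $n\to\infty$, one has the convergence in distribution $$\frac{S_n}{\sqrt{\Sigma_n\log\Sigma_n}}\xrightarrow{\ \mathcal{L}\ }\mathcal{N}(0,1).$$ Moreover, $$\frac{S_n}{\sqrt{n^{1-r}\log n}}\xrightarrow{\ \mathcal{L}\ }\sqrt{(1-r)\Sigma'}\,\mathcal{N}(0,1),$$ where $\Sigma'$ is independent of the Gaussian $\mathcal{N}(0,1)$ random variable and $\Sigma'$ has a Mittag-Leffler distribution with parameter $1-r$.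
   Context: The elephant random walk with stops (ERWS) is defined as follows. The parameters are $p,q,r\in[0,1]$ with $p+q+r=1$, where $0<r<1$ is assumed throughout, and $s\in[0,1]$. The first step $X_1$ equals $+1$ with probability $s$ and $-1$ with probability $1-s$. For each $n\ge 1$, given $X_1,\dots,X_n$, an integer $k$ is chosen uniformly at random in $\{1,\dots,n\}$ and, independently of this choice and of the past, $X_{n+1}=X_k$ with probability $p$, $X_{n+1}=-X_k$ with probability $q$, and $X_{n+1}=0$ with probability $r$. The position of the ERWS is $S_0=0$ and $S_n=\sum_{k=1}^n X_k$ for $n\ge1$. The number of ones up to time $n$ is $\Sigma_n=\sum_{k=1}^n X_k^2$; it tends to infinity almost surely (the ratio $S_n/\sqrt{\Sigma_n\log\Sigma_n}$ is understood on the event $\Sigma_n\ge2$, whose probability tends to one, and may be given any value elsewhere). A random variable $X$ has a Mittag-Leffler distribution with parameter $\alpha\in(0,1]$ if $\mathbb{E}[\exp(tX)]=\sum_{n=0}^\infty \frac{t^n}{\Gamma(1+n\alpha)}$ for all $t\in\mathbb{R}$; equivalently $\mathbb{E}[X^m]=\frac{m!}{\Gamma(1+m\alpha)}$ for all integers $m\ge1$ (these moments characterize the distribution). $\xrightarrow{\mathcal{L}}$ denotes convergence in distribution and $\mathcal{N}(0,v)$ the centered Gaussian law with variance $v$. *)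

(* Defs.v *)
From HB Require Import structures.
From mathcomp Require Import all_boot all_order all_algebra.
From mathcomp Require Import all_classical all_reals all_analysis.
From mathcomp Require Import measurable_realfun.
Import Order.TTheory GRing.Theory Num.Theory.
Import numFieldNormedType.Exports.
Set Implicit Arguments.
Unset Strict Implicit.
Unset Printing Implicit Defensive.
Local Open Scope classical_set_scope.
Local Open Scope ring_scope.

Lemma measurable_sqrt (R : realType) : measurable_fun setT (@Num.sqrt R).
Proof. by apply: continuous_measurable_fun; exact: sqrt_continuous. Qed.

Lemma measurable_inv (R : realType) : measurable_fun setT (@GRing.inv R).
Proof.
rewrite (_ : setT = [set 0] `|` ~` [set 0]); last by rewrite setUv.
apply/measurable_funU => //; first exact: measurableC.
split; first exact: measurable_fun_set1.
apply: open_continuous_measurable_fun.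
  by rewrite openC; exact: closed_eq.
by move=> x /set_mem /eqP x0; exact: inv_continuous.
Qed.

Section ERWS.
Context d (T : measurableType d) (R : realType) (P : probability T R).
Implicit Types (X : nat -> {RV P >-> R}).

(* The sigma-algebra generated by X_1, ..., X_n. *)
Definition past X (n : nat) : set_system T :=
  <<s \bigcup_(i in [set i | (0 < i <= n)%N])
        preimage_set_system setT (X i) measurable >>.

(* Only the X i with 0 < i are steps of the walk; X 0 plays no role.
   At time n, K n is the uniformly chosen instant and e n tells what is done
   with the remembered step: repeat it (1), reverse it (-1) or stop (0). The
   last three clauses state together that, conditionally on any event A of the
   past, K n is uniform on {1, ..., n} and that e n is independent of K n and
   of the past, with law (p, q, r). *)
Definition is_ERWS (p q r s : R) X : Prop :=
  [/\ P (X 1%N @^-1` [set 1]) = s%:E,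
      P (X 1%N @^-1` [set -1]) = (1 - s)%:E
    & exists (K : nat -> {RV P >-> nat}) (e : nat -> {RV P >-> R}),
      forall n : nat, (0 < n)%N ->
        (forall w, X n.+1 w = e n w * X (K n w) w) /\
        forall A k, past X n A -> (0 < k <= n)%N ->
        [/\ P (A `&` K n @^-1` [set k] `&` e n @^-1` [set 1])
              = (P A * (n%:R^-1 * p)%:E)%E,
            P (A `&` K n @^-1` [set k] `&` e n @^-1` [set -1])
              = (P A * (n%:R^-1 * q)%:E)%E
          & P (A `&` K n @^-1` [set k] `&` e n @^-1` [set 0])
              = (P A * (n%:R^-1 * r)%:E)%E]].

Definition position X (n : nat) (w : T) : R :=
  \sum_(1 <= k < n.+1) X k w.

Definition number_of_ones X (n : nat) (w : T) : R :=
  \sum_(1 <= k < n.+1) X k w ^+ 2.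

(* The denominator vanishes when number_of_ones X n w is 0 or 1; the quotient
   is then 0, since x / 0 = 0. *)
Definition self_normalized_position X (n : nat) (w : T) : R :=
  position X n w
  / Num.sqrt (number_of_ones X n w * ln (number_of_ones X n w)).

Definition normalized_position (r : R) X (n : nat) (w : T) : R :=
  position X n w / Num.sqrt (n%:R `^ (1 - r) * ln n%:R).

Lemma measurable_position X n : measurable_fun setT (position X n).
Proof. by apply: measurable_sum => k. Qed.

Lemma measurable_number_of_ones X n : measurable_fun setT (number_of_ones X n).
Proof. by apply: measurable_sum => k; exact: measurable_funX. Qed.

Lemma measurable_self_normalized_position X n :
  measurable_fun setT (self_normalized_position X n).
Proof.
apply: measurable_funM; first exact: measurable_position.
apply: measurableT_comp; first exact: measurable_inv.
apply: measurableT_comp; first exact: measurable_sqrt.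
apply: measurable_funM; first exact: measurable_number_of_ones.
by apply: measurableT_comp => //; exact: measurable_number_of_ones.
Qed.

Lemma measurable_normalized_position r X n :
  measurable_fun setT (normalized_position r X n).
Proof. by apply: measurable_funM => //; exact: measurable_position. Qed.

HB.instance Definition _ X n := isMeasurableFun.Build _ _ _ _
  (self_normalized_position X n) (measurable_self_normalized_position X n).

HB.instance Definition _ r X n := isMeasurableFun.Build _ _ _ _
  (normalized_position r X n) (measurable_normalized_position r X n).

Definition cvg_in_distribution (Y : nat -> {RV P >-> R})
    (mu : set R -> \bar R) : Prop :=
  forall f : R -> R, continuous f -> bounded_fun (f : R -> R^o) ->
    ('E_P[f \o Y n])%E @[n --> \oo] --> (\int[mu]_x (f x)%:E)%E.

Definition has_distribution (Y : {RV P >-> R})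
    (mu : set R -> \bar R) : Prop :=
  forall B, measurable B -> distribution P Y B = mu B.

Definition independent_RV2 (Y Z : {RV P >-> R}) : Prop :=
  forall A B, measurable A -> measurable B ->
    P (Y @^-1` A `&` Z @^-1` B) = (P (Y @^-1` A) * P (Z @^-1` B))%E.

(* Euler's integral; it is only meaningful for x > 0. *)
Definition Gamma (x : R) : R :=
  (\int[lebesgue_measure]_(t in `]0, +oo[) (t `^ (x - 1) * expR (- t)))%R.

Definition is_Mittag_Leffler (alpha : R) (Y : {RV P >-> R}) : Prop :=
  0 < alpha <= 1 /\
  forall t : R,
    (\sum_(0 <= n < N) t ^+ n / Gamma (1 + n%:R * alpha))%:E
      @[N --> \oo] --> ('M_P Y t)%E.

Definition Gaussian_mixture (c : R) (V N : {RV P >-> R}) (w : T) : R :=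
  Num.sqrt (c * V w) * N w.

Lemma measurable_Gaussian_mixture c V N :
  measurable_fun setT (Gaussian_mixture c V N).
Proof.
apply: measurable_funM => //.
apply: measurableT_comp; first exact: measurable_sqrt.
exact: measurable_funM.
Qed.

HB.instance Definition _ c V N := isMeasurableFun.Build _ _ _ _
  (Gaussian_mixture c V N) (measurable_Gaussian_mixture c V N).

End ERWS.

Arguments is_ERWS {d T R} P p q r s X.
Arguments cvg_in_distribution {d T R} P Y mu.
Arguments has_distribution {d T R} P Y mu.
Arguments independent_RV2 {d T R} P Y Z.
Arguments is_Mittag_Leffler {d T R} P alpha Y.

(* Main.v *)
Require Import Defs.
From HB Require Import structures.
From mathcomp Require Import all_boot all_order all_algebra.
From mathcomp Require Import all_classical all_reals all_analysis.
From mathcomp Require Import measurable_realfun ring lra.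
Import Order.TTheory GRing.Theory Num.Theory.
Import numFieldNormedType.Exports.
Local Open Scope classical_set_scope.
Local Open Scope ring_scope.
Set Implicit Arguments.
Unset Strict Implicit.
Unset Printing Implicit Defensive.

(** Put [a = 1 - r]; the critical regime is [p = 3 * a / 4], [q = a / 4]. When [m]
    of the first [n] steps are nonzero and their sum is [x], the next step is
    nonzero with probability [a * m / n], whatever [x] is, and given that it is
    nonzero it equals [1] with probability [1 / 2 + x / (4 * m)]. The number of ones
    is therefore a Markov chain by itself, and the position is an elephant random
    walk without stops and with memory parameter [3 / 4], observed at the clock
    given by the number of ones ([walk_law]).

    For the walk without stops, the position divided by [sqrt m] is almost a
    martingale whose increment at time [m] has variance close to [1 / (m + 1)].
    Replacing the increments one by one by Gaussian ones inside a smooth test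
    function ([erw_step_gauss], [erw_lindeberg]) shows that it is close to a
    Gaussian variable of variance [ln m], whence a central limit theorem with
    normalization [sqrt (m * ln m)] ([erw_critical_clt]). Smooth test functions
    determine weak convergence ([test_function_weak_cvg]).

    The mean of the rising factorial of order [k] of the number of ones is
    multiplied by [1 + k * a / n] at time [n] ([mean_rising_fact]). For [k = 1] this
    makes the number of ones divided by a product of order [n `^ a] a martingale
    bounded in mean square, so that the number of ones divided by [n `^ a]
    converges almost surely ([ones_scaled_cvg_ae]). For general [k], Gauss's
    product formula for the Gamma function ([rising_prod_cvg]) identifies the
    moments of the limit as [k! / Gamma (1 + k * a)] ([moment_ones_limit]), which
    are those of the Mittag-Leffler law ([moments_Mittag_Leffler]).

    As the number of ones tends to infinity almost surely, conditioning on it and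
    applying the central limit theorem inside the mean gives the first
    convergence. The second normalization differs from the first by a factor that
    depends on the number of ones only and converges almost surely to the square
    root of [a] times its scaled limit ([scale_ratio_cvg]); hence the limit law is
    a Gaussian mixture ([mixture_cvg]), realized on the product of the original
    probability space with the Gaussian line, where the two factors are
    independent. *)

(** * Limits of sequences and of integrals *)

Section SequenceLimits.
Context {R : realType}.
Implicit Types (u : nat -> R) (k l : R).

Lemma cvg_mulrl k u l : u n @[n --> \oo] --> l ->
  k * u n @[n --> \oo] --> k * l.
Proof. by move=> ul; apply: cvgM => //; exact: cvg_cst. Qed.

Lemma cvg_mulrr k u l : u n @[n --> \oo] --> l ->
  u n * k @[n --> \oo] --> l * k.
Proof. by move=> ul; apply: cvgM => //; exact: cvg_cst. Qed.

Lemma cvg_addr u v k l : u n @[n --> \oo] --> k -> v n @[n --> \oo] --> l ->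
  u n + v n @[n --> \oo] --> k + l.
Proof. by move=> uk vl; exact: cvgD. Qed.

Lemma cvg_subr u v k l : u n @[n --> \oo] --> k -> v n @[n --> \oo] --> l ->
  u n - v n @[n --> \oo] --> k - l.
Proof. by move=> uk vl; exact: cvgB. Qed.

Lemma cvg_succ u l : u n.+1 @[n --> \oo] --> l -> u n @[n --> \oo] --> l.
Proof. by rewrite -(cvg_shiftS u). Qed.

Lemma cvg_eqfun u v l : u =1 v -> u n @[n --> \oo] --> l ->
  v n @[n --> \oo] --> l.
Proof. by move=> /funext ->. Qed.

End SequenceLimits.
Arguments cvg_mulrl {R} k {u l}.
Arguments cvg_mulrr {R} k {u l}.

Section Toolkit.
Context d (T : measurableType d) (R : realType).

Lemma Rintegral_dominated_cvg (mu : {measure set T -> \bar R}) (D : set T)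
    (f_ : nat -> T -> R) (f g : T -> R) :
  measurable D -> (forall n, measurable_fun D (f_ n)) -> measurable_fun D f ->
  {ae mu, forall x, D x -> f_ ^~ x @ \oo --> f x} ->
  mu.-integrable D (EFin \o g) ->
  (forall n x, D x -> `|f_ n x| <= g x) ->
  (\int[mu]_(x in D) f_ n x)%R @[n --> \oo] --> (\int[mu]_(x in D) f x)%R.
Proof.
move=> mD mf_ mf f_f ig f_g.
have [|||||intf _ cvgf] := @dominated_convergence _ _ _ mu D mD
  (fun n => EFin \o f_ n) (EFin \o f) (EFin \o g).
- by move=> n; apply/measurable_EFinP.
- exact/measurable_EFinP.
- by apply: filterS f_f => x h Dx; apply/cvg_EFin; [exact: nearW|exact: h].
- exact: ig.
- by apply: aeW => x n Dx /=; rewrite lee_fin f_g.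
have fin : (\int[mu]_(x in D) (f x)%:E)%E \is a fin_num by exact: integrable_fin_num.
by move: cvgf; rewrite -(fineK fin) => /fine_cvg.
Qed.

Lemma RintegrableZ (mu : {measure set T -> \bar R}) (D : set T) (k : R)
    (f : T -> R) : measurable D -> mu.-integrable D (EFin \o f) ->
  mu.-integrable D (EFin \o (fun x => k * f x)).
Proof. by move=> mD; exact: integrableZl. Qed.

Lemma RintegrableD (mu : {measure set T -> \bar R}) (D : set T)
    (f g : T -> R) : measurable D -> mu.-integrable D (EFin \o f) ->
  mu.-integrable D (EFin \o g) ->
  mu.-integrable D (EFin \o (fun x => f x + g x)).
Proof. by move=> mD; exact: integrableD. Qed.

Lemma RintegrableB (mu : {measure set T -> \bar R}) (D : set T)
    (f g : T -> R) : measurable D -> mu.-integrable D (EFin \o f) ->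
  mu.-integrable D (EFin \o g) ->
  mu.-integrable D (EFin \o (fun x => f x - g x)).
Proof. by move=> mD; exact: integrableB. Qed.

Lemma Rintegral_subset (mu : {measure set T -> \bar R}) (A B : set T)
    (f : T -> R) : measurable A -> measurable B -> A `<=` B ->
  mu.-integrable B (EFin \o f) -> (forall x, B x -> 0 <= f x) ->
  (\int[mu]_(x in A) f x <= \int[mu]_(x in B) f x)%R.
Proof.
move=> mA mB AB intf f0; apply: fine_le.
- by apply: integrable_fin_num => //; exact: integrableS intf.
- exact: integrable_fin_num.
- by apply: ge0_subset_integral => //; case/integrableP: intf.
Qed.

Lemma ae_eq_Rintegral (mu : {measure set T -> \bar R}) (f g : T -> R) :
  measurable_fun setT f -> measurable_fun setT g ->
  {ae mu, forall x, f x = g x} ->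
  (\int[mu]_x f x)%R = (\int[mu]_x g x)%R.
Proof.
move=> mf mg fg; congr fine; apply: ae_eq_integral => //;
  try exact/measurable_EFinP.
by apply: filterS fg => x -> _.
Qed.

Context (P : probability T R).

Lemma integrable_bounded (f : T -> R) (C : R) :
  measurable_fun setT f -> (forall x, `|f x| <= C) ->
  P.-integrable setT (EFin \o f).
Proof.
move=> mf fC; apply: measurable_bounded_integrable => //.
  by rewrite [X in (X < _)%E]probability_setT ltry.
by exists C; split; [exact: num_real|move=> M CM x _; exact: le_trans (fC x) (ltW CM)].
Qed.

Lemma bounded_cvg (f_ : nat -> T -> R) (f : T -> R) (C : R) :
  (forall n, measurable_fun setT (f_ n)) -> measurable_fun setT f ->
  {ae P, forall x, f_ ^~ x @ \oo --> f x} -> (forall n x, `|f_ n x| <= C) ->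
  (\int[P]_x f_ n x)%R @[n --> \oo] --> (\int[P]_x f x)%R.
Proof.
move=> mf_ mf f_f fC; apply: (@Rintegral_dominated_cvg P setT f_ f (cst C)) => //.
- by apply: filterS f_f => x h _.
- by apply: (@integrable_bounded _ `|C|).
Qed.

Lemma Rintegral_dist_le (f g h : T -> R) : P.-integrable setT (EFin \o f) ->
  P.-integrable setT (EFin \o g) -> P.-integrable setT (EFin \o h) ->
  (forall x, `|f x - g x| <= h x) ->
  `|\int[P]_x f x - \int[P]_x g x|%R <= (\int[P]_x h x)%R.
Proof.
move=> iF ig ih fgh; rewrite -RintegralB//.
apply: le_trans (le_normr_Rintegral _ _) _ => //; first exact: RintegrableB.
apply: le_Rintegral => //.
by have /integrable_norm := RintegrableB measurableT iF ig.
Qed.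

Lemma Rintegral_prob_cst (c : R) : (\int[P]_x c)%R = c.
Proof. by rewrite Rintegral_cst// [X in fine X]probability_setT mulr1. Qed.

(** Almost sure convergence together with a uniform bound on second moments
    gives convergence of the means: Fatou's lemma bounds the mean of the limit
    from above, and for the other bound [z <= min z K + z ^ 2 / K] truncates
    every [Z_ n] at the same level [K] up to an error [C / K]. *)
Lemma Rintegral_cvg_bounded_square (Z_ : nat -> T -> R) (Z : T -> R) (C l : R) :
  (forall n, measurable_fun setT (Z_ n)) -> measurable_fun setT Z ->
  (forall n x, 0 <= Z_ n x) -> (forall x, 0 <= Z x) ->
  (forall n, P.-integrable setT (EFin \o Z_ n)) ->
  (forall n, P.-integrable setT (fun x => (Z_ n x ^+ 2)%:E)) ->
  {ae P, forall x, Z_ ^~ x @ \oo --> Z x} ->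
  (forall n, (\int[P]_x (Z_ n x ^+ 2))%R <= C) ->
  (\int[P]_x Z_ n x)%R @[n --> \oo] --> l ->
  P.-integrable setT (EFin \o Z) /\ (\int[P]_x Z x)%R = l.
Proof.
move=> mZ_ mZ Z_0 Z0 iZ iZ2 cZ ZC Zl.
have EF n : (\int[P]_x Z_ n x)%R%:E = (\int[P]_x (Z_ n x)%:E)%E.
  by rewrite /Rintegral fineK//; apply: integrable_fin_num => //; exact: iZ.
have fat : (\int[P]_x (Z x)%:E <= l%:E)%E.
  have /= fat := @fatou _ _ _ P setT measurableT (fun n => EFin \o Z_ n).
  have -> : (\int[P]_x (Z x)%:E = \int[P]_x limn_einf (fun n => (Z_ n x)%:E))%E.
    apply: ae_eq_integral => //.
    - exact/measurable_EFinP.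
    - under eq_fun do rewrite -[limn_einf _]oppeK -limn_esupN.
      apply: measurableT_comp => //; apply: measurable_fun_limn_esup => n.
      by apply: measurableT_comp => //; exact/measurable_EFinP.
    - apply: filterS cZ => x cx _; apply/esym.
      have h : (fun n => (Z_ n x)%:E) @ \oo --> (Z x)%:E.
        by apply/cvg_EFin => //; exact: nearW.
      rewrite is_cvg_limn_einfE; first exact/cvg_lim.
      by apply/cvg_ex; eexists; exact: h.
  apply: le_trans (fat _ _) _ => //.
  - by move=> n; apply/measurable_EFinP.
  - by move=> n x _; rewrite lee_fin.
  - under eq_fun do rewrite -EF.
    have h : (fun n => (\int[P]_x Z_ n x)%R%:E) @ \oo --> l%:E.
      by apply/cvg_EFin => //; exact: nearW.
    rewrite is_cvg_limn_einfE; first by rewrite (cvg_lim _ h).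
    by apply/cvg_ex; eexists; exact: h.
have iZ' : P.-integrable setT (EFin \o Z).
  apply/integrableP; split; first exact/measurable_EFinP.
  under eq_integral do rewrite /= ger0_norm//.
  exact: le_lt_trans fat (ltry _).
split => //; apply/eqP; rewrite eq_le; apply/andP; split.
  by rewrite -lee_fin /Rintegral fineK//; exact: (integrable_fin_num _ iZ').
apply/ler_addgt0Pr => e e0.
have C0 : 0 <= C.
  by apply: le_trans (ZC 0); apply: Rintegral_ge0 => x _; exact: sqr_ge0.
(* [C + 1] rather than [C], as the bound [C] may vanish. *)
pose K := (C + 1) / e.
have K0 : 0 < K by rewrite divr_gt0// ltr_wpDl.
pose tr z := Num.min z K.
have mtr (f : T -> R) : measurable_fun setT f ->
    measurable_fun setT (fun x => tr (f x)).
  by move=> mf; apply: measurable_minr.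
have trK z : 0 <= z -> `|tr z| <= K.
  by move=> z0; rewrite ger0_norm /tr ?ge_min ?lexx ?orbT// le_min z0 ltW.
have itr (f : T -> R) : measurable_fun setT f -> (forall x, 0 <= f x) ->
    P.-integrable setT (EFin \o (fun x => tr (f x))).
  by move=> mf f0; apply: (@integrable_bounded _ K); [exact: mtr|move=> x; exact: trK].
have ctr : (\int[P]_x tr (Z_ n x))%R @[n --> \oo] --> (\int[P]_x tr (Z x))%R.
  apply: (@bounded_cvg _ _ K); [by move=> n; exact: mtr|exact: mtr| |].
    have trc : continuous (tr : R -> R).
      by move=> z; exact: (@continuous_min _ _ id (cst K) z cvg_id (cvg_cst _)).
    by apply: filterS cZ => x cx; exact: (cvg_comp _ _ cx (trc (Z x))).
  by move=> n x; exact: trK.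
have h1 : (\int[P]_x tr (Z x))%R <= (\int[P]_x Z x)%R.
  by apply: le_Rintegral => //; [exact: itr|move=> x _; rewrite /tr ge_min lexx].
have h2 n : (\int[P]_x Z_ n x)%R <= (\int[P]_x tr (Z_ n x))%R + e.
  have : (\int[P]_x Z_ n x)%R <= (\int[P]_x (tr (Z_ n x) + K^-1 * Z_ n x ^+ 2))%R.
    apply: le_Rintegral => //.
      by apply: RintegrableD; [|exact: itr|apply: RintegrableZ => //; exact: iZ2].
    move=> x _; rewrite /tr; case: (leP (Z_ n x) K) => zK.
      by rewrite lerDl mulr_ge0 ?sqr_ge0// invr_ge0 ltW.
    apply: ler_wpDl; first exact: ltW.
    rewrite -(ler_pM2l K0) mulrA divff ?gt_eqF// mul1r expr2.
    by rewrite ler_wpM2r// ltW.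
  rewrite RintegralD//; last 2 first.
  - exact: itr.
  - by apply: RintegrableZ => //; exact: iZ2.
  rewrite RintegralZl//; last exact: iZ2.
  move => /le_trans; apply; rewrite lerD2l.
  rewrite /K invf_div mulrAC ler_pdivrMr; last by rewrite ltr_wpDl.
  by rewrite ler_pM2l// (le_trans (ZC n))// lerDl.
apply: (@le_trans _ _ ((\int[P]_x tr (Z x))%R + e)); last by rewrite lerD2r.
apply: (ler_cvg_to Zl (cvgD ctr (cvg_cst _))).
exact: nearW.
Qed.

End Toolkit.

(** Shifting [h] by its bound makes it nonnegative, which is the case covered
    by Tonelli's theorem. *)
Lemma measurable_Rintegral_snd d1 d2 (T1 : measurableType d1)
    (T2 : measurableType d2) (R : realType) (Q : probability T2 R)
    (h : T1 * T2 -> R) (C : R) :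
  measurable_fun setT h -> (forall z, `|h z| <= C) ->
  measurable_fun setT (fun x => \int[Q]_y h (x, y))%R.
Proof.
move=> mh hC.
have hx x : Q.-integrable setT (EFin \o (fun y => h (x, y))).
  by apply: (@integrable_bounded _ _ _ _ _ C) => //; exact: measurableT_comp.
have iC : Q.-integrable setT (EFin \o (fun=> C)).
  by apply: (@integrable_bounded _ _ _ _ _ `|C|).
rewrite (_ : (fun _ => _) =
    (fun x => fine (\int[Q]_y (h (x, y) + C)%:E) - C)); last first.
  apply/funext => x; rewrite -/(Rintegral Q setT (fun y => h (x, y) + C)).
  by rewrite RintegralD// Rintegral_prob_cst addrK.
apply: measurable_funB => //; apply: measurableT_comp => //.
apply: (@measurable_fun_fubini_tonelli_F _ _ _ _ _ Q (fun z => (h z + C)%:E)) => //.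
- by apply/measurable_EFinP; exact: measurable_funD.
- by move=> z; rewrite lee_fin -lerBlDr sub0r; have := hC z; rewrite ler_norml => /andP[].
Qed.

(** * The Gamma function and Gauss's product *)

Section ImproperFTC.
Context {R : realType}.
Local Notation mu := (@lebesgue_measure R).

Lemma is_derive_continuous (F : R -> R) (x l : R) :
  is_derive x 1 F l -> {for x, continuous F}.
Proof.
by move=> [dF _]; apply: differentiable_continuous; exact/derivable1_diffP.
Qed.

(** The fundamental theorem of calculus on an exhaustion of [D] by segments,
    dominated convergence with dominating function [`|f|] doing the rest. *)
Lemma Rintegral_exhaustion (D : set R) (f F : R -> R) (a_ b_ : nat -> R) (l : R) :
  measurable D -> mu.-integrable D (EFin \o f) ->
  (forall n, a_ n < b_ n) -> (forall n, `[a_ n, b_ n] `<=` D) ->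
  (forall x, D x -> \forall n \near \oo, a_ n <= x <= b_ n) ->
  (forall x, D x -> is_derive x 1 F (f x)) ->
  (forall x, D x -> {for x, continuous f}) ->
  F (b_ n) - F (a_ n) @[n --> \oo] --> l ->
  (\int[mu]_(x in D) f x)%R = l.
Proof.
move=> mD intf ab abD exh dF cf Fl.
have mf : measurable_fun D f by case/integrableP: intf => /measurable_EFinP.
have FTC n : (\int[mu]_(x in `[a_ n, b_ n]) f x)%R = F (b_ n) - F (a_ n).
  rewrite /Rintegral (@continuous_FTC2 _ f F) //.
  - apply: continuous_in_subspaceT => x /[!inE] xab.
    exact: (cf _ (abD n _ xab)).
  - split.
    + move=> x xab; have [] // := dF x _; apply: abD.
      exact: subset_itv_oo_cc xab.
    + apply: cvg_at_right_filter; apply: is_derive_continuous (dF _ _).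
      by apply: (abD n); rewrite /= in_itv/= lexx ?andbT ltW.
    + apply: cvg_at_left_filter; apply: is_derive_continuous (dF _ _).
      by apply: (abD n); rewrite /= in_itv/= lexx ?andbT ltW.
  - move=> x xab; rewrite derive1E; have /dF[_ -> //] : D x.
    by apply: (abD n); exact: subset_itv_oo_cc xab.
apply: (cvg_unique (@Rhausdorff R)) Fl => /=.
under eq_fun => n do rewrite -FTC -(setIidr (abD n)) Rintegral_mkcondr.
apply: (@Rintegral_dominated_cvg _ _ _ mu D _ f (fun x => `|f x|)) => //.
- move=> n; apply/measurable_restrict => //.
  by apply: measurable_funS mf => // x [].
- apply: aeW => x Dx; apply: cvg_near_cst.
  apply: filterS (exh x Dx) => n nx; rewrite patchE ifT//.
  by rewrite inE/= in_itv.
- by move: intf => /integrable_norm.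
- move=> n x Dx; rewrite patchE; case: ifP => // _.
  by rewrite normr0.
Qed.

End ImproperFTC.

Section EulerGamma.
Context {R : realType}.
Local Notation mu := (@lebesgue_measure R).

Definition gamma_integrand (y t : R) : R := t `^ y * expR (- t).

Lemma gamma_integrand_ge0 y t : 0 <= gamma_integrand y t.
Proof. by rewrite mulr_ge0 ?powR_ge0 ?expR_ge0. Qed.

Lemma measurable_gamma_integrand D y : measurable_fun D (gamma_integrand y).
Proof.
apply: measurable_funTS; apply: measurable_funM.
  exact: measurable_powR.
by apply: measurableT_comp => //; exact: measurableT_comp.
Qed.

Lemma gamma_integrand_continuous y t : 0 < t ->
  {for t, continuous (gamma_integrand y)}.
Proof.
move=> t0; apply: cvgM; first exact: is_derive_continuous (is_derive1_powR y t0).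
apply: (cvg_comp (fun t => - t) expR); last exact: continuous_expR.
exact: (@cvgN _ R^o).
Qed.

Lemma gamma_integrand_derive (y t : R) : 0 < t ->
  is_derive t 1 (gamma_integrand (y + 1))
    ((y + 1) * gamma_integrand y t - gamma_integrand (y + 1) t).
Proof.
move=> t0; have d1 := is_derive1_powR (y + 1) t0.
have d2 : is_derive t 1 (fun t : R => expR (- t)) (- expR (- t)).
  apply: (is_derive_eq (is_derive1_comp _ _)).
  by rewrite mulrN1.
apply: (is_derive_eq (is_deriveM _ _)).
rewrite /gamma_integrand addrK /GRing.scale/=; ring.
Qed.

Lemma powR_le_expR (y t : R) : 0 <= y -> 0 < t ->
  t `^ y <= expR (y * ln (2 * y)) * expR (t / 2).
Proof.
rewrite le_eqVlt => /predU1P[<- t0|y0 t0].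
  by rewrite powRr0 mul0r expR0 mul1r -expR0 ler_expR divr_ge0// ltW.
rewrite /powR gt_eqF// -expRD ler_expR.
have y2 : 0 < 2 * y by rewrite mulr_gt0.
have -> : t = (2 * y) * (t / (2 * y)) by field; rewrite gt_eqF.
set u := t / (2 * y).
have u0 : 0 < u by rewrite divr_gt0.
rewrite lnM ?posrE// mulrDr lerD2l.
have -> : 2 * y * u / 2 = y * u by field.
rewrite ler_pM2l//; exact/ltW/ln_sublinear.
Qed.

Lemma integrable_gamma_integrand (y : R) : 0 <= y ->
  mu.-integrable `]0, +oo[ (EFin \o gamma_integrand y).
Proof.
move=> y0.
have half : 0 < 2^-1 :> R by rewrite invr_gt0.
have i1 : mu.-integrable `]0, +oo[ (EFin \o exponential_pdf (2^-1 : R)).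
  exact: integrableS (integrable_exponential_pdf half).
apply: le_integrable (RintegrableZ (2 * expR (y * ln (2 * y))) _ i1) => //.
  by apply/measurable_EFinP; exact: measurable_gamma_integrand.
move=> t /=; rewrite in_itv/= andbT => t0.
rewrite lee_fin ger0_norm ?gamma_integrand_ge0// ger0_norm; last first.
  by rewrite !mulr_ge0 ?expR_ge0// exponential_pdf_ge0// ltW.
rewrite exponential_pdfE ?(ltW t0)//.
apply: (@le_trans _ _ (expR (y * ln (2 * y)) * expR (t / 2) * expR (- t))).
  by rewrite ler_wpM2r ?expR_ge0// powR_le_expR.
rewrite -!mulrA -expRD [_ * (2^-1 * _)]mulrCA !mulrA divff// mul1r.
by rewrite ler_wpM2l ?expR_ge0// ler_expR; lra.
Qed.

(** Euler's integral shifted by one: [gammaI y] is [Gamma (1 + y)], so that the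
    integrand has no singularity at the origin for [0 <= y]. *)
Definition gammaI (y : R) : R := (\int[mu]_(t in `]0, +oo[) gamma_integrand y t)%R.

Lemma Gamma_gammaI (y : R) : Gamma (1 + y) = gammaI y.
Proof. by rewrite /Gamma addrAC subrr add0r. Qed.

Lemma cvg_expR_Nn (c : R) : 0 < c -> expR (- (c * n%:R)) @[n --> \oo] --> (0 : R).
Proof.
move=> c0; have : geometric 1 (expR (- c)) n @[n --> \oo] --> (0 : R).
  by apply: cvg_geometric; rewrite ger0_norm ?expR_ge0// -expR0 ltr_expR oppr_lt0.
apply: cvg_trans; apply: near_eq_cvg; apply: nearW => n.
by rewrite /geometric/= mul1r -expRM_natl mulrN mulrC.
Qed.

(** Used with [r = 0] for [gammaI 0], and as the minorant in [gammaI_ge]. *)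
Lemma gammaI_exp_tail (r : R) : 0 <= r ->
  (\int[mu]_(t in `]r, +oo[) expR (- t))%R = expR (- r).
Proof.
move=> r0.
apply: (@Rintegral_exhaustion R _ _ (fun t => - expR (- t))
  (fun n => r + n.+1%:R^-1) (fun n => r + n.+2%:R)) => //.
- apply: (@integrableS _ _ _ mu `]0, +oo[) => //.
    by apply: subset_itvr; rewrite bnd_simp.
  rewrite [X in mu.-integrable _ X](_ : _ = EFin \o gamma_integrand 0).
    exact: integrable_gamma_integrand.
  by apply/funext => t; rewrite /= /gamma_integrand powRr0 mul1r.
- move=> n; rewrite ltrD2l; apply: (@le_lt_trans _ _ 1); last by rewrite ltr1n.
  by rewrite invf_le1 ?ler1n.
- move=> n x /=; rewrite !in_itv/= andbT => /andP[+ _]; apply: lt_le_trans.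
  by rewrite ltrDl invr_gt0.
- move=> x /=; rewrite in_itv/= andbT => rx.
  have xr : 0 < x - r by rewrite subr_gt0.
  near=> n; apply/andP; split.
    rewrite -lerBrDl -[leRHS]invrK lef_pV2 ?posrE ?invr_gt0//.
    apply: (@le_trans _ _ n%:R); last by rewrite ler_nat.
    near: n; exact: nbhs_infty_ger.
  rewrite -lerBlDl; apply: (@le_trans _ _ n%:R); last by rewrite ler_nat ltnW.
  near: n; exact: nbhs_infty_ger.
- move=> x _; apply: (is_derive_eq (is_deriveN (is_derive1_comp _ _))).
  by rewrite mulrN1 opprK.
- move=> x _; apply: (cvg_comp (fun t => - t) expR); last exact: continuous_expR.
  exact: (@cvgN _ R^o).
- have h1 : expR (- (r + n.+1%:R^-1)) @[n --> \oo] --> expR (- (r + 0)).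
    apply: (cvg_comp (fun n => - (r + n.+1%:R^-1)) expR); last exact: continuous_expR.
    by apply: cvgN; apply: cvgD; [exact: cvg_cst|exact: cvg_harmonic].
  have h2 : expR (- (r + n.+2%:R)) @[n --> \oo] --> (0 : R).
    have := cvg_mulrl (expR (- (r + 2))) (cvg_expR_Nn ltr01); rewrite mulr0.
    apply: cvg_trans; apply: near_eq_cvg; apply: nearW => n /=.
    by rewrite -expRD; congr expR; rewrite -addn2 natrD; ring.
  have := cvg_subr h1 h2; rewrite subr0 addr0.
  by apply: cvg_eqfun => n; rewrite opprK addrC.
Unshelve. all: by end_near. Qed.

Lemma gammaI0 : gammaI 0 = 1.
Proof.
rewrite -[RHS]expR0 -[in RHS]oppr0 -gammaI_exp_tail//; apply: eq_Rintegral => t _.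
by rewrite /gamma_integrand powRr0 mul1r.
Qed.

(** On the half-line beyond [c] the integrand is at least [c `^ y * expR (- t)]. *)
Lemma gammaI_ge (y c : R) : 0 <= y -> 0 <= c -> c `^ y * expR (- c) <= gammaI y.
Proof.
move=> y0 c0; rewrite -gammaI_exp_tail// -RintegralZl//; last first.
  apply: (@integrableS _ _ _ mu `]0, +oo[) => //.
    by apply: subset_itvr; rewrite bnd_simp.
  rewrite [X in mu.-integrable _ X](_ : _ = EFin \o gamma_integrand 0).
    exact: integrable_gamma_integrand.
  by apply/funext => t; rewrite /= /gamma_integrand powRr0 mul1r.
apply: (@le_trans _ _ (\int[mu]_(x in `]c, +oo[) gamma_integrand y x)%R).
  apply: le_Rintegral => //; last first.
    move=> t /=; rewrite in_itv/= andbT => ct; rewrite ler_wpM2r ?expR_ge0//.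
    by rewrite ge0_ler_powR// ?nnegrE ?(ltW ct)// (le_trans c0 (ltW ct)).
  apply: (@integrableS _ _ _ mu `]0, +oo[) => //; last exact: integrable_gamma_integrand.
    by apply: subset_itvr; rewrite bnd_simp.
  apply: RintegrableZ => //.
  apply: (@integrableS _ _ _ mu `]0, +oo[) => //.
    by apply: subset_itvr; rewrite bnd_simp.
  rewrite [X in mu.-integrable _ X](_ : _ = EFin \o gamma_integrand 0).
    exact: integrable_gamma_integrand.
  by apply/funext => t; rewrite /= /gamma_integrand powRr0 mul1r.
apply: Rintegral_subset => //.
- by apply: subset_itvr; rewrite bnd_simp.
- exact: integrable_gamma_integrand.
- by move=> t _; exact: gamma_integrand_ge0.
Qed.

Lemma gammaI_gt0 (y : R) : 0 <= y -> 0 < gammaI y.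
Proof.
move=> y0; apply: lt_le_trans (gammaI_ge y0 ler01).
by rewrite powR1 mul1r expR_gt0.
Qed.

(** Integration by parts: [(y + 1) * gamma_integrand y - gamma_integrand (y + 1)]
    is the derivative of [gamma_integrand (y + 1)], which vanishes at both ends. *)
Lemma gammaIS (y : R) : 0 <= y -> gammaI (y + 1) = (y + 1) * gammaI y.
Proof.
move=> y0; have y10 : 0 <= y + 1 by rewrite addr_ge0.
have i0 := integrable_gamma_integrand y0.
have i1 := integrable_gamma_integrand y10.
apply/eqP; rewrite eq_sym -subr_eq0; apply/eqP.
rewrite /gammaI -RintegralZl// -RintegralB//; last exact: RintegrableZ.
apply: (@Rintegral_exhaustion R _ _ (gamma_integrand (y + 1))
  (fun n => n.+1%:R^-1) (fun n => n.+2%:R)) => //.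
- by apply: RintegrableB => //; exact: RintegrableZ.
- move=> n; apply: (@le_lt_trans _ _ 1); last by rewrite ltr1n.
  by rewrite invf_le1 ?ler1n.
- move=> n x /=; rewrite !in_itv/= andbT => /andP[+ _]; apply: lt_le_trans.
  by rewrite invr_gt0.
- move=> x /=; rewrite in_itv/= andbT => x0.
  near=> n; apply/andP; split.
    rewrite -[leRHS]invrK lef_pV2 ?posrE ?invr_gt0//.
    apply: (@le_trans _ _ n%:R); last by rewrite ler_nat.
    near: n; exact: nbhs_infty_ger.
  apply: (@le_trans _ _ n%:R); last by rewrite ler_nat ltnW.
  near: n; exact: nbhs_infty_ger.
- by move=> x /=; rewrite in_itv/= andbT => x0; exact: gamma_integrand_derive.
- move=> x /=; rewrite in_itv/= andbT => x0.
  apply: cvgB; last exact: gamma_integrand_continuous.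
  by apply: cvgM; [exact: cvg_cst|exact: gamma_integrand_continuous].
- have h1 : gamma_integrand (y + 1) n.+1%:R^-1 @[n --> \oo] --> (0 : R).
    apply: (squeeze_cvgr _ (cvg_cst 0) cvg_harmonic); apply: nearW => n.
    rewrite gamma_integrand_ge0/=; have n1 : n.+1%:R^-1 <= 1 :> R by rewrite invf_le1 ?ler1n.
    rewrite -[leRHS]mulr1; apply: ler_pM; rewrite ?powR_ge0 ?expR_ge0//.
      by apply: ge1r_powR; rewrite ?n1 ?invr_gt0 ?ltr0n// lerDr.
  have h2 : gamma_integrand (y + 1) n.+2%:R @[n --> \oo] --> (0 : R).
    have half : 0 < 2^-1 :> R by rewrite invr_gt0.
    have := cvg_mulrl (expR ((y + 1) * ln (2 * (y + 1)))) (cvg_expR_Nn half); rewrite mulr0.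
    apply: (squeeze_cvgr _ (cvg_cst 0)); apply: nearW => n.
    rewrite gamma_integrand_ge0/= /gamma_integrand.
    apply: (@le_trans _ _ (expR ((y + 1) * ln (2 * (y + 1))) * expR (n.+2%:R / 2) * expR (- n.+2%:R))).
      by rewrite ler_wpM2r ?expR_ge0// powR_le_expR.
    rewrite -mulrA ler_wpM2l ?expR_ge0// -expRD ler_expR -addn2 natrD.
    have : 0 <= n%:R :> R by [].
    lra.
  by have := cvg_subr h2 h1; rewrite subr0.
Unshelve. all: by end_near. Qed.

(** The function [t `^ (- x)] is convex, hence lies above its tangent line at
    [t = c]. *)
Lemma powR_tangent_neg (c t x : R) : 0 < c -> 0 < t -> 0 <= x ->
  c `^ (- x) * (1 + x - x / c * t) <= t `^ (- x).
Proof.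
move=> c0 t0 x0; rewrite -[t in leRHS](@divfK _ c) ?gt_eqF// mulrC.
rewrite (powRM _ (divr_ge0 (ltW t0) (ltW c0)) (ltW c0)) mulrC [leRHS]mulrC.
rewrite ler_wpM2l ?powR_ge0// /powR gt_eqF ?divr_gt0//.
apply: le_trans (expR_ge1Dx _).
have := @le_ln1Dx R (t / c - 1).
rewrite addrCA subrr addr0 ltrBrDr addNr divr_gt0// => /(_ isT) h.
have := ler_wpM2l x0 h; rewrite mulrBr mulr1 mulNr mulrAC -mulrA; lra.
Qed.

(** The previous inequality in the variable [t^-1]. *)
Lemma powR_tangent_pos (c t x : R) : 0 < c -> 0 < t -> 0 <= x ->
  c `^ x * (1 + x - x * c / t) <= t `^ x.
Proof.
move=> c0 t0 x0.
have ct : 0 < t^-1 by rewrite invr_gt0.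
have c1 : 0 < c^-1 by rewrite invr_gt0.
have := powR_tangent_neg c1 ct x0.
have powRV (u : R) : 0 < u -> u^-1 `^ (- x) = u `^ x.
  by move=> u0; rewrite -powR_inv1 ?ltW// -powRrM mulN1r opprK.
by rewrite !powRV// invrK.
Qed.

(** Half of Gautschi's inequality. Integrating the tangent inequality for
    [t `^ (- x)] against [t `^ (y + x) * expR (- t)] turns [gammaI y] into a
    combination of [gammaI (y + x)] and [gammaI (y + x + 1)]; the tangency point
    [c = y + x + 1] is the one for which [gammaIS] collapses this combination. *)
Lemma gammaI_upper (y x : R) : 0 <= y -> 0 <= x ->
  gammaI (y + x) <= (y + x + 1) `^ x * gammaI y.
Proof.
move=> y0 x0; have yx0 : 0 <= y + x by rewrite addr_ge0.
have yx1 : 0 <= y + x + 1 by rewrite addr_ge0.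
have c0 : 0 < y + x + 1 by rewrite ltr_wpDl.
set c := y + x + 1 in c0 *.
have iy := integrable_gamma_integrand y0.
have iyx := integrable_gamma_integrand yx0.
have iyx1 := integrable_gamma_integrand yx1.
suff : c `^ (- x) * ((1 + x) * gammaI (y + x) - x / c * gammaI (y + x + 1)) <= gammaI y.
  rewrite gammaIS// -/c powRN [x / c * _]mulrA divfK ?gt_eqF//.
  rewrite mulrDl mul1r addrK => h.
  by rewrite -ler_pdivrMl ?powR_gt0.
rewrite /gammaI -!RintegralZl// -RintegralB//; try exact: RintegrableZ.
rewrite -RintegralZl//; last by apply: RintegrableB => //; exact: RintegrableZ.
apply: le_Rintegral => //.
  by apply: RintegrableZ => //; apply: RintegrableB => //; exact: RintegrableZ.
move=> t /=; rewrite in_itv/= andbT => t0.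
have := powR_tangent_neg c0 t0 x0.
rewrite -(ler_pM2r (powR_gt0 (y + x) t0)) -powRD ?(gt_eqF t0) ?implybT//.
rewrite addrCA addNr addr0 => h.
have := ler_wpM2r (expR_ge0 (- t)) h; rewrite /gamma_integrand; apply: le_trans.
have -> : t `^ (y + x + 1) = t `^ (y + x) * t.
  by rewrite powRD ?(gt_eqF t0) ?implybT// powRr1 ?ltW.
by rewrite le_eqVlt; apply/orP; left; apply/eqP; ring.
Qed.

(** The other half, from the tangent inequality for [t `^ x] with tangency
    point [c = y + 1]. *)
Lemma gammaI_lower (y x : R) : 0 <= y -> 0 <= x ->
  (y + 1) `^ x * gammaI (y + 1) <= gammaI (y + 1 + x).
Proof.
move=> y0 x0; have y1 : 0 <= y + 1 by rewrite addr_ge0.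
have c0 : 0 < y + 1 by rewrite ltr_wpDl.
have y1x : 0 <= y + 1 + x by rewrite addr_ge0.
have iy := integrable_gamma_integrand y0.
have iy1 := integrable_gamma_integrand y1.
have iy1x := integrable_gamma_integrand y1x.
set c := y + 1 in c0 *.
have -> : gammaI c = (1 + x) * gammaI c - x * c * gammaI y.
  by rewrite {1 2}/c gammaIS// -/c; ring.
rewrite /gammaI -!RintegralZl// -RintegralB//; try exact: RintegrableZ.
rewrite -RintegralZl//; last by apply: RintegrableB => //; exact: RintegrableZ.
apply: le_Rintegral => //.
  by apply: RintegrableZ => //; apply: RintegrableB => //; exact: RintegrableZ.
move=> t /=; rewrite in_itv/= andbT => t0.
have := powR_tangent_pos c0 t0 x0.
rewrite -(ler_pM2r (powR_gt0 c t0)) -powRD ?(gt_eqF t0) ?implybT//.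
rewrite [x + c]addrC => h.
have := ler_wpM2r (expR_ge0 (- t)) h; rewrite /gamma_integrand; apply: le_trans.
have -> : t `^ c = t `^ y * t.
  by rewrite /c powRD ?(gt_eqF t0) ?implybT// powRr1 ?ltW.
by rewrite le_eqVlt; apply/orP; left; apply/eqP; field; rewrite gt_eqF.
Qed.

Definition rising_prod (x : R) (n : nat) : R := \prod_(1 <= j < n) (1 + x / j%:R).

Lemma rising_prodS x n : (0 < n)%N ->
  rising_prod x n.+1 = rising_prod x n * (1 + x / n%:R).
Proof. by move=> n0; rewrite /rising_prod big_nat_recr. Qed.

Lemma rising_prod_gammaI (x : R) (n : nat) : 0 <= x ->
  rising_prod x n.+1 = gammaI (n%:R + x) / (gammaI n%:R * gammaI x).
Proof.
move=> x0; have g0 (y : R) : 0 <= y -> gammaI y != 0.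
  by move=> y0; rewrite gt_eqF// gammaI_gt0.
elim: n => [|n IH].
  by rewrite /rising_prod big_geq// add0r gammaI0 mul1r divff ?g0.
rewrite rising_prodS// IH -natr1 -addrA [1 + x]addrC addrA !gammaIS ?addr_ge0//.
by field; rewrite !g0//= andbT natr1.
Qed.

Lemma cvg_shift_ratio (c : R) : (n%:R + c) / n.+1%:R @[n --> \oo] --> (1 : R).
Proof.
have c1 : (fun=> 1) n @[n --> \oo] --> (1 : R) by exact: cvg_cst.
have := cvg_addr c1 (cvg_mulrl (c - 1) (@cvg_harmonic R)).
rewrite mulr0 addr0; apply: cvg_eqfun => n.
by rewrite -natr1; field; rewrite natr1.
Qed.

Lemma cvg_powR_one (u : nat -> R) (x : R) :
  u n @[n --> \oo] --> (1 : R) -> u n `^ x @[n --> \oo] --> (1 : R).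
Proof.
move=> u1; rewrite -[X in _ --> X](congr1 (@^~ x) (@powR1 R)).
exact: (cvg_comp _ _ u1 (is_derive_continuous (is_derive1_powR x ltr01))).
Qed.

(** Gauss's limit formula for the Gamma function. By [rising_prod_gammaI] it says
    that [gammaI (n + x)] is equivalent to [gammaI n * n `^ x], which the two
    halves of Gautschi's inequality squeeze. *)
Lemma rising_prod_cvg (x : R) : 0 <= x ->
  rising_prod x n.+1 / n.+1%:R `^ x @[n --> \oo] --> (Gamma (1 + x))^-1.
Proof.
move=> x0; rewrite Gamma_gammaI; have gx := gammaI_gt0 x0.
have lb := cvg_mulrr (gammaI x)^-1 (@cvg_powR_one _ x (cvg_shift_ratio 0)).
have ub := cvg_mulrr (gammaI x)^-1 (@cvg_powR_one _ x (cvg_shift_ratio (x + 1))).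
rewrite mul1r in lb ub; apply: squeeze_cvgr lb ub; near=> n.
have n0 : (0 < n)%N by near: n; exact: nbhs_infty_gt.
have gn : 0 < gammaI n%:R by exact: gammaI_gt0.
have nx : 0 < n.+1%:R `^ x :> R by exact: powR_gt0.
rewrite !(powRM x) ?invr_ge0 ?addr_ge0// rising_prod_gammaI//.
rewrite -[n.+1%:R^-1]powR_inv1// -!powRrM mulN1r powRN addr0.
apply/andP; split.
- have := @gammaI_lower n.-1%:R x (ler0n _ _) x0.
  rewrite natr1 prednK// => h.
  rewrite mulrAC ler_pM2r ?invr_gt0// invfM mulrA ler_pM2r ?invr_gt0//.
  by rewrite ler_pdivlMr.
- have := gammaI_upper (ler0n R n) x0 => h.
  rewrite [leRHS]mulrAC ler_pM2r ?invr_gt0// invfM mulrA ler_pM2r ?invr_gt0//.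
  by rewrite addrA ler_pdivrMr.
Unshelve. all: by end_near. Qed.

End EulerGamma.

(** * Gaussian integrals *)

Section GaussianIntegral.
Context {R : realType}.
Local Notation mu := (@lebesgue_measure R).

Lemma ge0_integral_normal_prob (m s : R) (f : R -> \bar R) :
  measurable_fun setT f -> (forall x, 0 <= f x)%E ->
  (\int[normal_prob m s]_x f x = \int[mu]_x (f x * (normal_pdf m s x)%:E))%E.
Proof.
move=> mf f0.
have dom := @normal_prob_dominates R m s.
rewrite -(Radon_Nikodym_SigmaFinite.change_of_variables dom)//.
have mrn := measurable_int _ (Radon_Nikodym_SigmaFinite.f_integrable dom).
have mpdf : measurable_fun setT (fun x : R => (normal_pdf m s x)%:E).
  by apply/measurable_EFinP; exact: measurable_normal_pdf.
apply: ae_eq_integral => //.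
- exact: emeasurable_funM.
- exact: emeasurable_funM.
- apply: ae_eqe_mul2l => /=.
  apply: integral_ae_eq => //; first exact: Radon_Nikodym_SigmaFinite.f_integrable.
  by move=> E ET mE; rewrite -Radon_Nikodym_SigmaFinite.f_integral.
Qed.

Local Notation gauss := (@normal_prob R 0 1).

(** The change of measure for functions of arbitrary sign, by splitting into
    positive and negative parts. *)
Lemma Rintegral_normal_prob (f : R -> R) : measurable_fun setT f ->
  mu.-integrable setT (EFin \o (fun x => f x * normal_pdf 0 1 x)) ->
  gauss.-integrable setT (EFin \o f) /\
  (\int[gauss]_x f x)%R = (\int[mu]_x (f x * normal_pdf 0 1 x))%R.
Proof.
move=> mf /integrableP[mfp fp].
have intf : gauss.-integrable setT (EFin \o f).
  apply/integrableP; split; first exact/measurable_EFinP.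
  rewrite ge0_integral_normal_prob//.
    under eq_integral do rewrite /= -EFinM -[normal_pdf 0 1 _]ger0_norm ?normal_pdf_ge0// -normrM.
    exact: fp.
  by apply: measurableT_comp => //; exact/measurable_EFinP.
split => //; rewrite /Rintegral; congr fine.
rewrite integralE [RHS]integralE; congr (_ - _)%E.
- rewrite ge0_integral_normal_prob//; last first.
    by apply: measurable_funepos; exact/measurable_EFinP.
  apply: eq_integral => x _; rewrite !funeposE.
  have p0 := normal_pdf_ge0 0 1 x; have [fx|/ltW fx] := leP 0 (f x).
    by rewrite !max_l ?lee_fin ?mulr_ge0.
  by rewrite !max_r ?mul0e ?lee_fin ?mulr_le0_ge0.
- rewrite ge0_integral_normal_prob//; last first.
    by apply: measurable_funeneg; exact/measurable_EFinP.
  apply: eq_integral => x _; rewrite !funenegE.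
  have p0 := normal_pdf_ge0 0 1 x; have [fx|/ltW fx] := leP 0 (f x).
    by rewrite !max_r ?mul0e ?lee_fin ?oppr_le0 ?mulr_ge0.
  by rewrite !max_l -?EFinN -?EFinM ?mulNr ?lee_fin ?oppr_ge0 ?mulr_le0_ge0.
Qed.

Local Notation phi := (@normal_pdf R 0 1).

Lemma normal_pdf01E (x : R) : phi x = normal_peak 1 * expR (- x ^+ 2 / 2).
Proof.
rewrite normal_pdfE ?oner_eq0// /normal_fun subr0 expr1n; congr (_ * expR (_ / _)).
Qed.

Lemma normal_pdf01_derive (x : R) : is_derive x 1 phi (- x * phi x).
Proof.
rewrite (_ : phi = fun x => normal_peak 1 * expR (- x ^+ 2 / 2)); last first.
  by apply/funext => y; exact: normal_pdf01E.
apply: is_derive_eq => /=.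
by rewrite /GRing.scale/=; field.
Qed.

(** Half of the exponent of the density absorbs a polynomial of degree four,
    since [1 + u ^+ 2 / 2 <= expR u] with [u = x ^+ 2 / 4]; all the moments needed
    below are then integrable by comparison. *)
Lemma phi_poly4_le (x : R) : (1 + x ^+ 4) * phi x <=
  33 * normal_peak 1 * expR (- x ^+ 2 / 4).
Proof.
rewrite normal_pdf01E mulrA [_ * normal_peak 1]mulrC [_ * normal_peak 1]mulrC -!mulrA.
rewrite ler_wpM2l ?normal_peak_ge0//.
have -> : expR (- x ^+ 2 / 2) = expR (- x ^+ 2 / 4) * expR (- x ^+ 2 / 4).
  by rewrite -expRD; congr expR; field.
rewrite mulrA ler_wpM2r ?expR_ge0// mulNr expRN ler_pdivrMr ?expR_gt0//.
set u := x ^+ 2 / 4; have u0 : 0 <= u by rewrite divr_ge0 ?sqr_ge0.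
have -> : x ^+ 4 = 16 * u ^+ 2 by rewrite /u; field.
have h : 1 + u ^+ 2 / 2 <= expR u.
  by have := @expR_ge1Dxn R u 1 u0.
have := sqr_ge0 u; lra.
Qed.

Lemma integrable_expR_sqr4 :
  mu.-integrable setT (EFin \o (fun x : R => expR (- x ^+ 2 / 4))).
Proof.
have s2 : Num.sqrt 2 != 0 :> R by rewrite gt_eqF// sqrtr_gt0.
rewrite (_ : _ \o _ = EFin \o
    (fun x => (normal_peak (Num.sqrt 2))^-1 * normal_pdf 0 (Num.sqrt 2) x)).
  by apply: RintegrableZ => //; exact: integrable_normal_pdf.
apply/funext => x /=; congr EFin; rewrite normal_pdfE// mulrA mulVf ?mul1r.
  by rewrite /normal_fun subr0 sqr_sqrtr//; congr (expR (_ / _)); ring.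
by rewrite gt_eqF// normal_peak_gt0.
Qed.

Lemma integrable_gauss_poly4 (f : R -> R) (C : R) : measurable_fun setT f ->
  (forall x, `|f x| <= C * (1 + x ^+ 4)) ->
  mu.-integrable setT (EFin \o (fun x => f x * phi x)).
Proof.
move=> mf fC.
have C0 : 0 <= C.
  by have := fC 0; rewrite expr0n addr0 mulr1; apply: le_trans.
apply: (le_integrable _ _ _
  (RintegrableZ (C * (33 * normal_peak 1)) _ integrable_expR_sqr4)) => //.
  apply/measurable_EFinP; apply: measurable_funM => //.
  exact: measurable_normal_pdf.
move=> x _; rewrite lee_fin [leRHS]ger0_norm; last first.
  by rewrite !mulr_ge0 ?expR_ge0 ?normal_peak_ge0.
rewrite normrM (ger0_norm (normal_pdf_ge0 _ _ _)) -mulrA.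
apply: (le_trans (ler_wpM2r (normal_pdf_ge0 _ _ _) (fC x))).
by rewrite -mulrA ler_wpM2l// phi_poly4_le.
Qed.

(** The density is a primitive of [- x * phi x]. *)
Lemma gauss_mean0 : (\int[gauss]_x x)%R = 0 /\
  gauss.-integrable setT (EFin \o (fun x : R => x)).
Proof.
have ix : mu.-integrable setT (EFin \o (fun x : R => x * phi x)).
  apply: (@integrable_gauss_poly4 _ 1) => // x; rewrite mul1r.
  have := sqr_ge0 (x ^+ 2 - 2^-1); rewrite ler_norml => ?.
  by apply/andP; split; nra.
have mid : measurable_fun setT (fun x : R => x) by exact: measurable_id.
have [intx ->] := Rintegral_normal_prob mid ix.
split => //.
apply: (@Rintegral_exhaustion R setT _ (fun x => - phi x)
  (fun n => - n.+1%:R) (fun n => n.+1%:R)) => //.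
- by move=> n; rewrite -subr_gt0 opprK addr_gt0.
- move=> x _; near=> n; rewrite -ler_norml; apply: (@le_trans _ _ n%:R).
    by near: n; exact: nbhs_infty_ger.
  by rewrite ler_nat.
- move=> x _; have := normal_pdf01_derive x => h.
  by apply: (is_derive_eq (is_deriveN h)); rewrite mulNr opprK.
- move=> x _; apply: cvgM; first exact: cvg_id.
  by apply: continuous_normal_pdf; exact: oner_neq0.
- apply: (@cvg_eqfun _ (fun=> 0)); last exact: cvg_cst.
  by move=> n; rewrite !normal_pdf01E sqrrN; ring.
Unshelve. all: by end_near. Qed.

Lemma integrable_gauss_poly (f : R -> R) (C : R) : measurable_fun setT f ->
  (forall x, `|f x| <= C * (1 + x ^+ 4)) ->
  gauss.-integrable setT (EFin \o f).
Proof.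
move=> mf fC.
by have [] := Rintegral_normal_prob mf (integrable_gauss_poly4 mf fC).
Qed.

(** The function [- x * phi x] is a primitive of [(x ^+ 2 - 1) * phi x] and
    vanishes at both ends. *)
Lemma gauss_variance1 : (\int[gauss]_x x ^+ 2)%R = 1.
Proof.
have mx2 : measurable_fun setT (fun x : R => x ^+ 2) by exact: measurable_funX.
have x2 (x : R) : `|x ^+ 2| <= 1 * (1 + x ^+ 4).
  rewrite mul1r ger0_norm ?sqr_ge0//.
  by have := sqr_ge0 (x ^+ 2 - 2^-1); nra.
have ix := integrable_gauss_poly4 mx2 x2.
have [_ ->] := Rintegral_normal_prob mx2 ix.
have iphi := @integrable_normal_pdf R 0 1.
suff h : (\int[mu]_x (phi x - x ^+ 2 * phi x))%R = 0.
  move: h; rewrite RintegralB// /Rintegral integral_normal_pdf/= => /eqP.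
  by rewrite subr_eq0 => /eqP.
apply: (@Rintegral_exhaustion R setT _ (fun x => x * phi x)
  (fun n => - n.+1%:R) (fun n => n.+1%:R)) => //.
- exact: RintegrableB.
- by move=> n; rewrite -subr_gt0 opprK addr_gt0.
- move=> x _; near=> n; rewrite -ler_norml; apply: (@le_trans _ _ n%:R).
    by near: n; exact: nbhs_infty_ger.
  by rewrite ler_nat.
- move=> x _; have := normal_pdf01_derive x => h.
  apply: (is_derive_eq (is_deriveM (is_derive_id x 1) h)).
  by rewrite /GRing.scale/=; ring.
- have cphi x : {for x, continuous phi}.
    by apply: continuous_normal_pdf; exact: oner_neq0.
  move=> x _; apply: cvgB; first exact: cphi.
  by apply: cvgM; [exact: exprn_continuous|exact: cphi].
- have h := cvg_mulrl (2 * (33 * normal_peak 1)) (@cvg_harmonic R).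
  rewrite mulr0 in h; apply: (squeeze_cvgr _ (cvg_cst 0) h).
  apply: nearW => n; rewrite !normal_pdf01E sqrrN -!normal_pdf01E.
  rewrite mulNr opprK.
  have p0 := normal_pdf_ge0 0 1 (n.+1%:R : R); apply/andP; split.
    by rewrite addr_ge0 ?mulr_ge0.
  rewrite -mulr2n -[leLHS]mulr_natl -mulrA ler_wpM2l//.
  rewrite ler_pdivlMr ?ltr0n//.
  have n1 : 1 <= n.+1%:R :> R by rewrite ler1n.
  set x := n.+1%:R in p0 n1 *.
  apply: (@le_trans _ _ ((1 + x ^+ 4) * phi x)).
    rewrite mulrAC ler_wpM2r//.
    by have := sqr_ge0 (x ^+ 2 - 2^-1); nra.
  apply: le_trans (phi_poly4_le x) _.
  rewrite -[leRHS]mulr1 ler_wpM2l ?mulr_ge0 ?normal_peak_ge0//.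
  by rewrite -expR0 ler_expR mulNr oppr_le0 divr_ge0 ?sqr_ge0.
Unshelve. all: by end_near. Qed.

Lemma normal_peak_gt0E (s : R) : 0 < s -> normal_peak s = normal_peak 1 / s.
Proof.
move=> s0; rewrite /normal_peak expr1n mul1r -mulrnAr sqrtrM ?sqr_ge0//.
by rewrite sqrtr_sqr gtr0_norm// invfM mulrC.
Qed.

Lemma gauss_affine (m s : R) (g : R -> R) : 0 < s -> continuous g ->
  (forall x, 0 <= g x) ->
  (\int[gauss]_y (g (m + s * y))%:E = \int[mu]_z (g z * normal_pdf m s z)%:E)%E.
Proof.
move=> s0 cg g0.
have mg : measurable_fun setT g by exact: continuous_measurable_fun.
have s0' : s != 0 by rewrite gt_eqF.
pose F (y : R) := m + s * y.
have dF (y : R) : is_derive y 1 F s.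
  apply: is_derive_eq; rewrite /GRing.scale/=; ring.
have F'E : F^`()%classic = cst s.
  by apply/funext => y; rewrite derive1E; have [_ ->] := dF y.
have mgF : measurable_fun setT (fun y => (g (m + s * y))%:E).
  apply/measurable_EFinP; apply: (measurableT_comp mg).
  by apply: measurable_funD => //; exact: measurable_funM.
have gF0 y : (0 <= (g (m + s * y))%:E)%E by rewrite lee_fin.
apply: etrans (ge0_integral_normal_prob 0 1 mgF gF0) _.
rewrite (@increasing_ge0_integration_by_substitutionT R F
  (fun z => g z * normal_pdf m s z)); first last.
- by move=> x; rewrite mulr_ge0 ?normal_pdf_ge0.
- by move=> x; apply: cvgM; [exact: cg|exact: continuous_normal_pdf].
- apply/cvgryPge => A; exists (s^-1 * (A - m)); split; first exact: num_real.
  by move=> x /ltW; rewrite ler_pdivrMl// lerBlDl.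
- apply/cvgrNyPle => A; exists (s^-1 * (A - m)); split; first exact: num_real.
  by move=> x /ltW; rewrite ler_pdivlMl// lerBrDl.
- by move=> y; have [] := dF y.
- by rewrite F'E; exact: is_cvg_cst.
- by rewrite F'E; exact: is_cvg_cst.
- by rewrite F'E => ?; exact: cvg_cst.
- by move=> x y xy; rewrite /F ltrD2l ltr_pM2l.
apply: eq_integral => y _; rewrite F'E -EFinM/= !fctE; congr EFin.
rewrite -mulrA; congr (_ * _); rewrite normal_pdf01E normal_pdfE//.
rewrite (normal_peak_gt0E s0) /normal_fun /F addrAC subrr add0r.
rewrite mulrAC divfK//; congr (_ * expR _).
by field.
Qed.

(** Completing the square: if [Y] is standard and [Z] given [Y] is normal with
    mean [t * Y], then [Z] is normal and [Y] given [Z] is normal, with these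
    parameters. *)
Lemma normal_pdf_posterior (s t r z y : R) : 0 < s -> 0 < r ->
  r ^+ 2 = s ^+ 2 + t ^+ 2 ->
  phi y * normal_pdf (t * y) s z =
  normal_pdf 0 r z * normal_pdf (z * t / r ^+ 2) (s / r) y.
Proof.
move=> s0 r0 rE; have sr0 : 0 < s / r by rewrite divr_gt0.
rewrite normal_pdf01E !normal_pdfE ?gt_eqF//.
rewrite (normal_peak_gt0E s0) (normal_peak_gt0E r0) (normal_peak_gt0E sr0).
rewrite mulrACA [RHS]mulrACA; congr (_ * _).
  by field; rewrite !gt_eqF.
rewrite /normal_fun -!expRD; congr expR; rewrite subr0.
have t2 : t ^+ 2 = r ^+ 2 - s ^+ 2 by rewrite rE; ring.
apply/eqP; rewrite -subr_eq0; apply/eqP.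
transitivity ((r ^+ 2 * y ^+ 2 - z ^+ 2) * (r ^+ 2 - s ^+ 2 - t ^+ 2) / (2 * s ^+ 2 * r ^+ 2)).
  by field; rewrite !gt_eqF.
by rewrite t2; field; rewrite !gt_eqF.
Qed.

(** The sum of independent centered Gaussian variables of standard deviations
    [t] and [s] is Gaussian of standard deviation [r]: exchange the two integrals
    and integrate the conditional density of [normal_pdf_posterior] to one. *)
Lemma ge0_gauss_convolution (s t r : R) (g : R -> R) : 0 < s -> 0 < r ->
  r ^+ 2 = s ^+ 2 + t ^+ 2 -> continuous g -> (forall x, 0 <= g x) ->
  (\int[gauss]_y \int[gauss]_x (g (t * y + s * x))%:E =
   \int[gauss]_y (g (r * y))%:E)%E.
Proof.
move=> s0 r0 rE cg g0.
have mg : measurable_fun setT g by exact: continuous_measurable_fun.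
under eq_integral do rewrite gauss_affine//.
have mjoint : measurable_fun setT
    (fun yz : R * R => (g yz.2 * normal_pdf (t * yz.1) s yz.2)%:E).
  apply/measurable_EFinP; apply: measurable_funM.
    by apply: (measurableT_comp mg).
  rewrite (_ : (fun _ => _) = (fun yz : R * R =>
      normal_peak s * expR (- (yz.2 - t * yz.1) ^+ 2 / (s ^+ 2 *+ 2)))); last first.
    by apply/funext => yz; rewrite normal_pdfE ?gt_eqF.
  apply: measurable_funM => //; apply: measurableT_comp => //.
  apply: measurable_funM => //; apply: measurableT_comp => //.
  apply: measurable_funX; apply: measurable_funB => //.
  exact: measurable_funM.
have mphi2 : measurable_fun setT (fun yz : R * R => (phi yz.1)%:E).
  apply/measurable_EFinP; apply: measurableT_comp => //.
  exact: measurable_normal_pdf.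
rewrite [LHS]ge0_integral_normal_prob; last 2 first.
- apply: (@measurable_fun_fubini_tonelli_F _ _ _ _ _ mu (fun yz : R * R =>
    (g yz.2 * normal_pdf (t * yz.1) s yz.2)%:E)) => //.
  by move=> yz; rewrite lee_fin mulr_ge0 ?normal_pdf_ge0.
- by move=> y; apply: integral_ge0 => z _; rewrite lee_fin mulr_ge0 ?normal_pdf_ge0.
transitivity (\int[mu]_y \int[mu]_z
    (g z * normal_pdf (t * y) s z * phi y)%:E)%E.
  apply: eq_integral => y _; rewrite -ge0_integralZr//.
  - by apply/measurable_EFinP; apply: measurable_funM => //; exact: measurable_normal_pdf.
  - by move=> z _; rewrite lee_fin mulr_ge0 ?normal_pdf_ge0.
  - by rewrite lee_fin normal_pdf_ge0.
rewrite (fubini_tonelli (m1 := mu) (m2 := mu) (fun yz : R * R =>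
    (g yz.2 * normal_pdf (t * yz.1) s yz.2 * phi yz.1)%:E)); last 2 first.
- under eq_fun do rewrite EFinM.
  exact: emeasurable_funM.
- by move=> yz; rewrite lee_fin !mulr_ge0 ?normal_pdf_ge0.
transitivity (\int[mu]_z (g z * normal_pdf 0 r z)%:E)%E; last first.
  by rewrite -gauss_affine//; under eq_integral do rewrite add0r.
apply: eq_integral => z _.
under eq_integral => y _ do
  rewrite -mulrA [_ * phi y]mulrC (normal_pdf_posterior z y s0 r0 rE) mulrA EFinM.
rewrite /= ge0_integralZl//.
- by rewrite integral_normal_pdf mule1.
- by apply/measurable_EFinP; exact: measurable_normal_pdf.
- by move=> y _; rewrite lee_fin normal_pdf_ge0.
- by rewrite lee_fin mulr_ge0 ?normal_pdf_ge0.
Qed.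

(** Adding the bound [C] to [f] reduces to the nonnegative case. *)
Lemma gauss_convolution (s t r C : R) (f : R -> R) : 0 < s -> 0 < r ->
  r ^+ 2 = s ^+ 2 + t ^+ 2 -> continuous f -> (forall x, `|f x| <= C) ->
  (\int[gauss]_y (\int[gauss]_x f (t * y + s * x)))%R =
  (\int[gauss]_y f (r * y))%R.
Proof.
move=> s0 r0 rE cf fC.
pose g x := f x + C.
have cg : continuous g by move=> x; apply: cvgD; [exact: cf|exact: cvg_cst].
have mf : measurable_fun setT f by exact: continuous_measurable_fun.
have mg : measurable_fun setT g by exact: continuous_measurable_fun.
have g0 x : 0 <= g x.
  by have := fC x; rewrite ler_norml -lerBlDr sub0r => /andP[].
have iaff (a b : R) : gauss.-integrable setT (EFin \o (fun x => f (a + b * x))).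
  apply: (@integrable_bounded _ _ _ _ _ C) => //.
  by apply: (measurableT_comp mf); apply: measurable_funD => //; exact: measurable_funM.
have ic : gauss.-integrable setT (EFin \o (fun x : R => C)).
  by apply: (@integrable_bounded _ _ _ _ _ `|C|).
have gE (a b : R) : (\int[gauss]_x g (a + b * x))%R = (\int[gauss]_x f (a + b * x))%R + C.
  by rewrite RintegralD// Rintegral_prob_cst.
have fin a b : (\int[gauss]_x (g (a + b * x))%:E)%E \is a fin_num.
  by apply: integrable_fin_num => //; exact: RintegrableD.
have := congr1 fine (ge0_gauss_convolution s0 r0 rE cg g0).
rewrite -/(Rintegral gauss setT (fun y => g (r * y))).
have -> : (\int[gauss]_y g (r * y))%R = (\int[gauss]_y f (r * y))%R + C.
  have := gE 0 r; under eq_Rintegral do rewrite add0r.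
  by move=> ->; congr (_ + _); apply: eq_Rintegral => y _; rewrite add0r.
under eq_integral => y _ do rewrite -(fineK (fin _ _)) -/(Rintegral gauss setT _) gE.
rewrite -/(Rintegral gauss setT _) RintegralD// ?Rintegral_prob_cst; first exact: addIr.
apply: (@integrable_bounded _ _ _ _ _ C).
  apply: (@measurable_Rintegral_snd _ _ _ _ _ gauss (fun yx => f (t * yx.1 + s * yx.2)) C) => //.
  apply: (measurableT_comp mf); apply: measurable_funD;
    by apply: measurable_funM => //; exact: measurable_snd.
move=> y; apply: le_trans (le_normr_Rintegral _ _) _ => //.
apply: le_trans (le_Rintegral _ _ ic _) _ => //.
  by move: (iaff (t * y) s) => /integrable_norm.
by rewrite Rintegral_prob_cst.
Qed.


End GaussianIntegral.

(** * Smooth test functions and weak convergence *)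

Section TestFunctions.
Context {R : realType}.
Local Notation mu := (@lebesgue_measure R).
Implicit Types (f g F : R -> R) (x z h delta C K : R).

Lemma antiderivative f : continuous f ->
  exists F, forall x, is_derive x 1 F (f x).
Proof.
move=> cf; pose I a x := (\int[mu]_(t in `[a, x]) f t)%R.
pose F x := I (- `|x| - 1) x - I (- `|x| - 1) 0.
have intf a b : mu.-integrable `[a, b] (EFin \o f).
  apply: continuous_compact_integrable; first exact: segment_compact.
  exact: continuous_subspaceT.
have IB a b x : a <= b -> b <= x -> I a x - I b x = I a b.
  move=> ab bx; have := @Rintegral_itvB R f (BLeft a) (BRight x) b.
  rewrite !bnd_simp => /(_ (intf _ _) ab bx).
  rewrite Rintegral_itv_obnd_cbnd => [h|].
    by apply/eqP; rewrite subr_eq addrC -subr_eq; apply/eqP.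
  apply: integrableS (intf b x) => //; apply: subset_itvr; by rewrite bnd_simp.
have FE a x : a <= - `|x| - 1 -> F x = I a x - I a 0.
  move=> ax; rewrite /F; set b := - `|x| - 1 in ax *.
  have bx : b <= x.
    by rewrite /b; have := ler_norm (- x); rewrite normrN; lra.
  have b0 : b <= 0 by rewrite /b; have := normr_ge0 x; lra.
  by have := IB _ _ _ ax bx; have := IB _ _ _ ax b0; lra.
exists F => x; pose a := - `|x| - 2.
have ax : a < x by rewrite /a; have := ler_norm (- x); rewrite normrN; lra.
have x1 : x < x + 1 by rewrite ltrDl.
have [dI I'E] := @continuous_FTC1_closed R f a x (x + 1) x1 (intf _ _) ax (cf x).
have dI' : is_derive x 1 (fun y => I a y - I a 0) (f x).
  have h : is_derive x 1 (I a) (f x) by split; [exact: dI|rewrite -derive1E; exact: I'E].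
  by apply: is_derive_eq; rewrite subr0.
have FI : {near x, (fun y => I a y - I a 0) =1 F}.
  near=> y; apply/esym/FE.
  have : `|y - x| <= 1.
    near: y; apply/nbhs_ballP; exists 1 => //= y.
    by rewrite /ball/= distrC => /ltW.
    by have := ler_normD (y - x) x; rewrite subrK /a; lra.
split; first by apply: near_eq_derivable FI _; have [] := dI'.
by rewrite -(near_eq_derive _ FI) ?oner_eq0//; have [] := dI'.
Unshelve. all: by end_near. Qed.

Lemma MVT_increment F f x h : (forall y : R, is_derive y 1 F (f y)) ->
  exists xi, F (x + h) - F x = h * f xi /\
    (Num.min x (x + h) <= xi <= Num.max x (x + h)).
Proof.
move=> dF; have cF : continuous F by move=> y; exact: is_derive_continuous (dF y).
have [h0|/ltW h0] := leP 0 h.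
  have [|xi] := @MVT_segment R F f x (x + h) _ (fun y _ => dF y) (continuous_subspaceT cF).
    by rewrite lerDl.
  rewrite in_itv/= => xxi ->; exists xi; rewrite min_l ?max_r ?lerDl// xxi.
  by split => //; ring.
have [|xi] := @MVT_segment R F f (x + h) x _ (fun y _ => dF y) (continuous_subspaceT cF).
  by rewrite gerDl.
rewrite in_itv/= => xxi E; exists xi; rewrite min_r ?max_l ?gerDl// xxi.
by split => //; rewrite -opprB E; ring.
Qed.

Lemma MVT_norm F f x h C : (forall y : R, is_derive y 1 F (f y)) ->
  (forall y, Num.min x (x + h) <= y <= Num.max x (x + h) -> `|f y| <= C) ->
  `|F (x + h) - F x| <= `|h| * C.
Proof.
move=> dF fC; have [xi [-> xxi]] := MVT_increment x h dF.
by rewrite normrM ler_wpM2l// fC.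
Qed.

Definition increment delta F x := F (x + delta) - F x.

Lemma increment_derive delta F f : (forall x, is_derive x 1 F (f x)) ->
  forall x, is_derive x 1 (increment delta F) (increment delta f x).
Proof.
move=> dF x; apply: is_deriveB.
have h1 := dF (x + delta).
have h2 : is_derive x 1 (fun y : R => y + delta) 1.
  by apply: is_derive_eq; rewrite addr0.
by apply: (is_derive_eq (is_derive1_comp _ _)); rewrite mulr1.
Qed.

(** A bounded function with a second-order Taylor expansion that is uniform in
    the base point; [f1] and [f2] play the role of its first two derivatives, but
    only the expansion is ever used. *)
Definition test_function K f f1 f2 :=
  [/\ continuous f, continuous f1, continuous f2,
      forall x, [/\ `|f x| <= K, `|f1 x| <= K & `|f2 x| <= K] &
      forall z h, `|f (z + h) - f z - h * f1 z - h ^+ 2 / 2 * f2 z|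
        <= K * `|h| ^+ 3].

(** The third antiderivative [F3] of a function bounded by [C] has third
    derivative bounded by [C]; its Taylor remainder is estimated by applying the
    mean value theorem once for each derivative. *)
Lemma taylor_antiderivative (F1 F2 F3 f : R -> R) C :
  (forall x, is_derive x 1 F1 (f x)) -> (forall x, is_derive x 1 F2 (F1 x)) ->
  (forall x, is_derive x 1 F3 (F2 x)) -> (forall x, `|f x| <= C) ->
  forall z h, `|F3 (z + h) - F3 z - h * F2 z - h ^+ 2 / 2 * F1 z| <= C * `|h| ^+ 3.
Proof.
move=> d1 d2 d3 fC z h.
have between k x : Num.min 0 (0 + k) <= x <= Num.max 0 (0 + k) -> `|x| <= `|k|.
  rewrite add0r; have [k0|/ltW k0] := leP 0 k.
    by case/andP=> x0 xk; rewrite !ger0_norm.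
  by case/andP=> kx x0; rewrite !ler0_norm// lerN2.
have C0 : 0 <= C by apply: le_trans (fC 0).
have dshift (F f' : R -> R) : (forall x, is_derive x 1 F (f' x)) ->
    forall k : R, is_derive k 1 (fun k => F (z + k)) (f' (z + k)).
  move=> dF k; have h1 := dF (z + k).
  have h2 : is_derive k 1 (fun y : R => z + y) 1.
    rewrite (_ : (fun y => z + y) = (fun y => y + z)).
      by apply: is_derive_eq; rewrite addr0.
    by apply/funext => y; rewrite addrC.
  by apply: (is_derive_eq (is_derive1_comp _ _)); rewrite mulr1.
have b1 k : `|F1 (z + k) - F1 z| <= `|k| * C by apply: MVT_norm d1 _.
have b2 k : `|F2 (z + k) - F2 z - k * F1 z| <= `|k| * (`|k| * C).
  have := @MVT_norm (fun k => F2 (z + k) - F2 z - k * F1 z)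
    (fun k => F1 (z + k) - F1 z) 0 k (`|k| * C).
  rewrite add0r addr0 subrr mul0r !subr0; apply.
    move=> y; have h2 := dshift _ _ d2 y; apply: is_derive_eq.
    by rewrite /GRing.scale/=; ring.
  move=> y; rewrite -{1 2}[k]add0r => /between yk; apply: le_trans (b1 y) _.
  by rewrite ler_wpM2r.
have := @MVT_norm (fun k => F3 (z + k) - F3 z - k * F2 z - k ^+ 2 / 2 * F1 z)
    (fun k => F2 (z + k) - F2 z - k * F1 z) 0 h (`|h| * (`|h| * C)).
rewrite add0r addr0 subrr mul0r !subr0 expr0n/= !mul0r !subr0.
rewrite (_ : C * `|h| ^+ 3 = `|h| * (`|h| * (`|h| * C))); last by ring.
apply.
  move=> y; have h3 := dshift _ _ d3 y; apply: is_derive_eq.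
  by rewrite /GRing.scale/=; field.
move=> y; rewrite -{1 2}[h]add0r => /between yh; apply: le_trans (b2 y) _.
by apply: ler_pM => //; rewrite ?mulr_ge0// ler_wpM2r.
Qed.

(** Averaging [f] three times over windows of length [delta] produces a
    function three times differentiable that moves the argument of [f] by at most
    [3 * delta]. Such an average is a divided third difference of a third
    antiderivative, so that [antiderivative] is all the integration theory involved. *)
Lemma mollification f C delta : continuous f -> (forall x, `|f x| <= C) ->
  0 < delta -> exists K g g1 g2, test_function K g g1 g2 /\
    forall x, exists xi, `|xi - x| <= 3 * delta /\ g x = f xi.
Proof.
move=> cf fC d0; have C0 : 0 <= C by apply: le_trans (fC 0).
have cd (F f' : R -> R) : (forall x, is_derive x 1 F (f' x)) -> continuous F.
  by move=> dF y; exact: is_derive_continuous (dF y).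
have [F1 d1] := antiderivative cf.
have [F2 d2] := antiderivative (cd _ _ d1).
have [F3 d3] := antiderivative (cd _ _ d2).
pose D := increment delta.
have cD F : continuous F -> continuous (D F).
  move=> cF x; apply: cvgB; last exact: cF.
  apply: (cvg_comp (fun y => y + delta) F); last exact: cF.
  by apply: cvgD; [exact: cvg_id|exact: cvg_cst].
have step F f' x : (forall x, is_derive x 1 F (f' x)) ->
    exists xi, D F x = delta * f' xi /\ x <= xi <= x + delta.
  move=> dF; have [xi [E]] := MVT_increment x delta dF.
  have xd : x <= x + delta by rewrite lerDl ltW.
    by rewrite min_l// max_r// => xxi; exists xi.
have dD F f' : (forall x, is_derive x 1 F (f' x)) ->
  forall x, is_derive x 1 (D F) (D f' x) by move=> *; exact: increment_derive.
have n3 : 0 < delta ^+ 3 by rewrite exprn_gt0.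
pose g x := (delta ^+ 3)^-1 * D (D (D F3)) x.
pose g1 x := (delta ^+ 3)^-1 * D (D (D F2)) x.
pose g2 x := (delta ^+ 3)^-1 * D (D (D F1)) x.
have gxi x : exists xi, `|xi - x| <= 3 * delta /\ g x = f xi.
  have [x1 [E1 /andP[l1 u1]]] := step _ _ x (dD _ _ (dD _ _ d3)).
  have [x2 [E2 /andP[l2 u2]]] := step _ _ x1 (dD _ _ d2).
  have [x3 [E3 /andP[l3 u3]]] := step _ _ x2 d1.
  exists x3; split.
    by rewrite ger0_norm; lra.
  by rewrite /g E1 E2 E3; field; rewrite gt_eqF.
have DF1 x : `|D F1 x| <= delta * C.
  have [x1 [-> _]] := step _ _ x d1; rewrite normrM gtr0_norm//.
  by rewrite ler_wpM2l// ltW.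
have DDF2 x : `|D (D F2) x| <= delta * (delta * C).
  have [x1 [-> _]] := step _ _ x (dD _ _ d2); rewrite normrM gtr0_norm//.
  by rewrite ler_wpM2l// ltW.
pose K := C + (delta ^+ 3)^-1 * (2 * (delta * (delta * C)) + 4 * (delta * C) + 8 * C).
have K3 : 0 <= (delta ^+ 3)^-1 by rewrite invr_ge0 ltW.
have dC : 0 <= delta * C by rewrite mulr_ge0// ltW.
have ddC : 0 <= delta * (delta * C) by rewrite mulr_ge0// ltW.
exists K, g, g1, g2; split => //; split.
- by move=> x; apply: cvgM; [exact: cvg_cst|apply/cD/cD/cD; exact: cd d3].
- by move=> x; apply: cvgM; [exact: cvg_cst|apply/cD/cD/cD; exact: cd d2].
- by move=> x; apply: cvgM; [exact: cvg_cst|apply/cD/cD/cD; exact: cd d1].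
- move=> x; split.
  + have [xi [_ ->]] := gxi x; apply: le_trans (fC xi) _.
    by rewrite lerDl mulr_ge0// !addr_ge0// mulr_ge0.
  + rewrite normrM (ger0_norm K3); apply: ler_wpDl => //; rewrite ler_wpM2l//.
    have := DDF2 (x + delta); have := DDF2 x; rewrite {3}/D/increment.
    by have := ler_normB (D (D F2) (x + delta)) (D (D F2) x); lra.
  + rewrite normrM (ger0_norm K3); apply: ler_wpDl => //; rewrite ler_wpM2l//.
    have := DF1 (x + delta + delta); have := DF1 (x + delta); have := DF1 x.
    rewrite [D (D (D F1)) x](_ : _ = D F1 (x + delta + delta) - D F1 (x + delta)
      - (D F1 (x + delta) - D F1 x))//.
    have := ler_normB (D F1 (x + delta + delta) - D F1 (x + delta)) (D F1 (x + delta) - D F1 x).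
    have := ler_normB (D F1 (x + delta + delta)) (D F1 (x + delta)).
    have := ler_normB (D F1 (x + delta)) (D F1 x).
    lra.
- move=> z h; have T := taylor_antiderivative d1 d2 d3 fC.
  pose r z := F3 (z + h) - F3 z - h * F2 z - h ^+ 2 / 2 * F1 z.
  have -> : g (z + h) - g z - h * g1 z - h ^+ 2 / 2 * g2 z =
     (delta ^+ 3)^-1 * D (D (D r)) z.
    rewrite /g /g1 /g2 /D /increment /r.
    by rewrite !(addrAC z h delta) !(addrAC (z + delta) h delta)
       !(addrAC (z + delta + delta) h delta); ring.
  rewrite normrM (ger0_norm K3) mulrDl; apply: ler_wpDl.
    by rewrite mulr_ge0// exprn_ge0.
  rewrite -mulrA ler_wpM2l// mulrDl; apply: ler_wpDl.
    by rewrite mulr_ge0 ?exprn_ge0// addr_ge0// mulr_ge0.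
  rewrite -mulrA.
  have Tr z' : `|r z'| <= C * `|h| ^+ 3 := T z' h.
  rewrite [D (D (D r)) z](_ : _ = (r (z + delta + delta + delta) - r (z + delta + delta)
      - (r (z + delta + delta) - r (z + delta)))
      - ((r (z + delta + delta) - r (z + delta)) - (r (z + delta) - r z)))//.
  have := Tr z; have := Tr (z + delta); have := Tr (z + delta + delta).
  have := Tr (z + delta + delta + delta).
  rewrite !ler_norml => /andP[? ?] /andP[? ?] /andP[? ?] /andP[? ?].
  by apply/andP; split; lra.
Qed.

Lemma segment_uniform_continuity f B e : continuous f -> 0 < e ->
  exists2 delta, 0 < delta &
    forall x y, `|x| <= B -> `|y - x| <= delta -> `|f y - f x| <= e.
Proof.
move=> cf e0.
pose Q delta x := forall y, `|y - x| <= delta -> `|f y - f x| <= e.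
have : near_covering `[- B, B] by apply/compact_near_coveringP; exact: segment_compact.
move=> /(_ R (0^'+) Q _) [].
  move=> x _.
  have e2 : 0 < e / 2 by rewrite divr_gt0.
  have /cvgrPdist_le /(_ _ e2) := cf x; rewrite /= => /nbhs_ballP[eta/= eta0 H].
  exists ([set x' | `|x' - x| < eta / 2], [set delta | delta < eta / 2]) => /=.
    split.
      apply/nbhs_ballP; exists (eta / 2) => /=; first by rewrite divr_gt0.
      by move=> x'; rewrite /ball/= distrC.
    by apply: nbhs_right_lt; rewrite divr_gt0.
  move=> [x' delta] /= [xx' de] y yx'.
  have h1 : `|f x - f x'| <= e / 2.
    by apply: H; rewrite /ball/= distrC; apply: lt_trans xx' _; lra.
  have h2 : `|f x - f y| <= e / 2.
    apply: H; rewrite /ball/= distrC; have := ler_normD (y - x') (x' - x).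
    by rewrite addrA subrK; lra.
  have := ler_normB (f x - f x') (f x - f y).
  by rewrite (_ : f x - f x' - (f x - f y) = f y - f x'); [lra|ring].
move=> r /= r0 H; exists (r / 2); first by rewrite divr_gt0.
move=> x y xB; apply: (H (r / 2)) => //=.
- by rewrite sub0r normrN gtr0_norm ?divr_gt0//; lra.
- by rewrite divr_gt0.
- by rewrite in_itv/= -ler_norml.
Qed.

Definition tent (B x : R) : R := Num.max 0 (Num.min 1 (B + 1 - `|x|)).

Lemma tent_ge0 B x : 0 <= tent B x. Proof. by rewrite /tent le_max lexx. Qed.

Lemma tent_le1 B x : tent B x <= 1.
Proof. by rewrite /tent ge_max ler01 ge_min lexx. Qed.

Lemma tent_continuous B : continuous (tent B).
Proof.
move=> x; apply: (@continuous_max R R (cst 0) (fun x => Num.min 1 (B + 1 - `|x|))).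
  exact: cvg_cst.
apply: (@continuous_min R R (cst 1) (fun x => B + 1 - `|x|)); first exact: cvg_cst.
by apply: cvgB; [exact: cvg_cst|exact: norm_continuous].
Qed.

Lemma tent_out B x : B + 1 <= `|x| -> tent B x = 0.
Proof. by move=> xB; rewrite /tent max_l// ge_min subr_le0 xB orbT. Qed.

Lemma tent_in B x : `|x| <= B -> tent B x = 1.
Proof.
by move=> xB; rewrite /tent min_l ?max_r// -addrA addrCA lerDl subr_ge0.
Qed.

(** Heine's theorem on a ball slightly larger than the support. *)
Lemma uniform_continuity_outside f B e : continuous f -> 0 < e ->
  (forall x, B <= `|x| -> f x = 0) ->
  exists2 delta, 0 < delta & forall x y, `|y - x| <= delta -> `|f y - f x| <= e.
Proof.
move=> cf e0 fB; have [delta d0 H] := segment_uniform_continuity B cf e0.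
exists delta => // x y xy; have [xB|/ltW xB] := leP `|x| B; first exact: H.
have [yB|/ltW yB] := leP `|y| B.
  by rewrite distrC; apply: H => //; rewrite distrC.
by rewrite !fB// subrr normr0 ltW.
Qed.

Section WeakConvergence.
Context d (T : measurableType d) (P : probability T R).
Context d' (T' : measurableType d') (Q : probability T' R).
Variables (Y : nat -> T -> R) (Z : T' -> R).
Hypotheses (mY : forall n, measurable_fun setT (Y n)).
Hypothesis (mZ : measurable_fun setT Z).
Hypothesis test_cvg : forall K f f1 f2, test_function K f f1 f2 ->
  (\int[P]_w f (Y n w))%R @[n --> \oo] --> (\int[Q]_w f (Z w))%R.

Let intY f C n : continuous f -> (forall x, `|f x| <= C) ->
  P.-integrable setT (EFin \o (fun w => f (Y n w))).
Proof.
move=> cf fC; apply: (@integrable_bounded _ _ _ _ _ C) => //.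
by apply: (measurableT_comp (continuous_measurable_fun cf)).
Qed.

Let intZ f C : continuous f -> (forall x, `|f x| <= C) ->
  Q.-integrable setT (EFin \o (fun w => f (Z w))).
Proof.
move=> cf fC; apply: (@integrable_bounded _ _ _ _ _ C) => //.
by apply: (measurableT_comp (continuous_measurable_fun cf)).
Qed.

(** A continuous function of bounded support is uniformly continuous, hence
    uniformly approximated by test functions. *)
Let cutoff_cvg f B C : continuous f -> (forall x, `|f x| <= C) ->
  (forall x, B <= `|x| -> f x = 0) ->
  (\int[P]_w f (Y n w))%R @[n --> \oo] --> (\int[Q]_w f (Z w))%R.
Proof.
move=> cf fC fB; apply/cvgrPdist_le => e e0.
have e3 : 0 < e / 3 by rewrite divr_gt0.
have [delta d0 fuc] := uniform_continuity_outside cf e3 fB.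
have d3 : 0 < delta / 3 by rewrite divr_gt0.
have [K [g [g1 [g2 [tg gE]]]]] := mollification cf fC d3.
have gf x : `|g x - f x| <= e / 3.
  have [xi [xxi ->]] := gE x; apply: fuc; apply: le_trans xxi _.
  by rewrite mulrCA divff ?mulr1.
have [cg _ _ gK _] := tg.
have gK' x : `|g x| <= K by have [] := gK x.
have ice d1 (T1 : measurableType d1) (mu1 : probability T1 R) :
    mu1.-integrable setT (EFin \o (fun=> e / 3)).
  by apply: (@integrable_bounded _ _ _ _ _ `|e / 3|).
have /cvgrPdist_le /(_ _ e3) := test_cvg tg; apply: filterS => n h1.
have h2 : `|\int[P]_w g (Y n w) - \int[P]_w f (Y n w)|%R <= e / 3.
  rewrite -[leRHS](Rintegral_prob_cst P).
  by apply: Rintegral_dist_le => //; [exact: intY gK'|exact: intY fC].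
have h3 : `|\int[Q]_w g (Z w) - \int[Q]_w f (Z w)|%R <= e / 3.
  rewrite -[leRHS](Rintegral_prob_cst Q).
  by apply: Rintegral_dist_le => //; [exact: intZ gK'|exact: intZ fC].
move: h1 h2 h3; rewrite !ler_norml => /andP[? ?] /andP[? ?] /andP[? ?].
by apply/andP; split; lra.
Qed.

(** Test functions determine weak convergence. The function [f] is replaced by
    [f * tent B], which has bounded support; the error is at most
    [C * (1 - tent B)], whose mean is small for [Z] when [B] is large and
    therefore also for [Y n] when [n] is large, since [tent B] is itself
    continuous with bounded support. *)
Lemma test_function_weak_cvg f C : continuous f -> (forall x, `|f x| <= C) ->
  (\int[P]_w f (Y n w))%R @[n --> \oo] --> (\int[Q]_w f (Z w))%R.
Proof.
move=> cf fC; have C0 : 0 <= C by apply: le_trans (fC 0).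
have tnorm B x : `|tent B x| <= 1 by rewrite ger0_norm ?tent_ge0 ?tent_le1.
have tentZ : (\int[Q]_w tent B%:R (Z w))%R @[B --> \oo] --> (1 : R).
  rewrite -[X in _ --> X](Rintegral_prob_cst Q).
  apply: (@bounded_cvg _ _ _ Q _ _ 1) => //.
    by move=> n; apply: (measurableT_comp (continuous_measurable_fun (@tent_continuous _))).
  apply: aeW => w; apply: cvg_near_cst; near=> n; rewrite tent_in//.
  by near: n; exact: nbhs_infty_ger.
apply/cvgrPdist_le => e e0.
pose e' := e / (4 * (C + 1)).
have C1 : 0 < C + 1 by rewrite ltr_wpDl.
have e'0 : 0 < e' by rewrite divr_gt0// mulr_gt0.
have e'E : (C + 1) * e' = e / 4 by rewrite /e'; field; rewrite gt_eqF.
have /cvgrPdist_le /(_ _ e'0) [B _ /(_ B (leqnn B)) /=] := tentZ.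
set b := B%:R => hB; have ct := @tent_continuous b.
have tB x : b + 1 <= `|x| -> tent b x = 0 by exact: tent_out.
pose g x := f x * tent b x.
have cg : continuous g by move=> x; apply: cvgM; [exact: cf|exact: ct].
have gC x : `|g x| <= C.
  by rewrite /g normrM -[leRHS]mulr1 ler_pM.
have gB x : b + 1 <= `|x| -> g x = 0 by move=> xb; rewrite /g tB// mulr0.
have e4 : 0 < e / 4 by rewrite divr_gt0.
have /cvgrPdist_le /(_ _ e4) c1 := cutoff_cvg cg gC gB.
have /cvgrPdist_le /(_ _ e'0) c2 := cutoff_cvg ct (tnorm b) tB.
near=> n.
have h1 : `|\int[Q]_w g (Z w) - \int[P]_w g (Y n w)|%R <= e / 4 by near: n.
have h2 : `|\int[Q]_w tent b (Z w) - \int[P]_w tent b (Y n w)|%R <= e' by near: n.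
have i1 d1 (T1 : measurableType d1) (mu1 : probability T1 R) (c : R) :
    mu1.-integrable setT (EFin \o (fun=> c)).
  by apply: (@integrable_bounded _ _ _ _ _ `|c|).
have diff x : `|f x - g x| <= C * (1 - tent b x).
  rewrite /g -{1}[f x]mulr1 -mulrBr normrM [X in _ * X]ger0_norm ?subr_ge0 ?tent_le1//.
  by rewrite ler_wpM2r ?subr_ge0 ?tent_le1.
have h3 : `|\int[P]_w f (Y n w) - \int[P]_w g (Y n w)|%R
    <= C * (1 - \int[P]_w tent b (Y n w))%R.
  have it := intY n ct (tnorm b).
  have <- : (\int[P]_w (C * (1 - tent b (Y n w))))%R = C * (1 - \int[P]_w tent b (Y n w))%R.
    have ib := RintegrableB measurableT (i1 _ _ P 1) it.
    by rewrite RintegralZl// (RintegralB measurableT (i1 _ _ P 1) it) Rintegral_prob_cst.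
  apply: Rintegral_dist_le => //; [exact: intY fC|exact: intY gC|].
  exact: (RintegrableZ C measurableT (RintegrableB measurableT (i1 _ _ P 1) it)).
have h4 : `|\int[Q]_w f (Z w) - \int[Q]_w g (Z w)|%R
    <= C * (1 - \int[Q]_w tent b (Z w))%R.
  have it := intZ ct (tnorm b).
  have <- : (\int[Q]_w (C * (1 - tent b (Z w))))%R = C * (1 - \int[Q]_w tent b (Z w))%R.
    have ib := RintegrableB measurableT (i1 _ _ Q 1) it.
    by rewrite RintegralZl// (RintegralB measurableT (i1 _ _ Q 1) it) Rintegral_prob_cst.
  apply: Rintegral_dist_le => //; [exact: intZ fC|exact: intZ gC|].
  exact: (RintegrableZ C measurableT (RintegrableB measurableT (i1 _ _ Q 1) it)).
move: hB h1 h2 h3 h4; rewrite !ler_norml.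
move=> /andP[? ?] /andP[? ?] /andP[? ?] /andP[? ?] /andP[? ?].
by apply/andP; split; nra.
Unshelve. all: by end_near. Qed.

End WeakConvergence.

End TestFunctions.

(** * The critical elephant random walk without stops *)

Section CriticalElephant.
Context {R : realType}.
Local Notation gauss := (@normal_prob R 0 1).
Implicit Types (f g h : R -> R) (x z K kappa tau rho : R) (m j N : nat).

(** The transition operator of the elephant random walk with memory parameter
    [3 / 4]: with [m] steps made and position [x], a uniformly chosen past step is
    [1] with probability [(m + x) / (2 * m)], and the next step is [1] with
    probability [1 / 2 + x / (4 * m)]. *)
Definition erw_step m g x : R :=
  (1 / 2 + x / (4 * m%:R)) * g (x + 1) + (1 / 2 - x / (4 * m%:R)) * g (x - 1).

(** The mean of [g] at the position of the walk after [j.+1] steps, computed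
    backwards from the transition operators, so that no probability space has to
    be built for this walk. *)
Fixpoint erw_mean (s : R) j g : R :=
  if j is j'.+1 then erw_mean s j' (erw_step j'.+1 g)
  else s * g 1 + (1 - s) * g (-1).

(** The two weights are probabilities only for positions that can be reached. *)
Lemma erw_weights m x : (0 < m)%N -> `|x| <= m%:R ->
  0 <= 1 / 2 + x / (4 * m%:R) /\ 0 <= 1 / 2 - x / (4 * m%:R).
Proof.
move=> m0; rewrite ler_norml => /andP[l u].
have m0' : 0 < m%:R :> R by rewrite ltr0n.
have -> : x / (4 * m%:R) = x / m%:R / 4 by field; rewrite gt_eqF.
have : x / m%:R <= 1 by rewrite ler_pdivrMr ?mul1r.
have : -1 <= x / m%:R by rewrite ler_pdivlMr ?mulN1r.
by move=> ? ?; split; lra.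
Qed.

Section Mean.
Variables (s : R) (s01 : 0 <= s <= 1).
Local Notation ew := (erw_mean s).

Lemma ew_le j f g : (forall x, `|x| <= j.+1%:R -> f x <= g x) ->
  ew j f <= ew j g.
Proof.
elim: j f g => [|j IH] f g fg /=.
  have /andP[s0 s1] := s01.
  by apply: lerD; rewrite ler_wpM2l ?subr_ge0// fg// ?normrN normr1.
apply: IH => x xj; have [w1 w2] := erw_weights (ltn0Sn j) xj.
have S : j.+2%:R = j.+1%:R + 1 :> R by rewrite natr1.
apply: lerD; rewrite ler_wpM2l// fg// S.
  by apply: le_trans (ler_normD _ _) _; rewrite normr1 lerD2r.
by apply: le_trans (ler_normB _ _) _; rewrite normr1 lerD2r.
Qed.

Lemma ew_lin j f g (a b : R) :
  ew j (fun x => a * f x + b * g x) = a * ew j f + b * ew j g.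
Proof.
elim: j f g => [|j IH] f g /=; first by ring.
rewrite -IH; congr ew; apply/funext => x; rewrite /erw_step; ring.
Qed.

Lemma ew_cst j (c : R) : ew j (fun=> c) = c.
Proof.
elim: j => [|j IH] /=; first by ring.
rewrite -[RHS]IH; congr ew; apply/funext => x; rewrite /erw_step.
by set w := x / _; field.
Qed.

Lemma ewZ j f (a : R) : ew j (fun x => a * f x) = a * ew j f.
Proof.
have := ew_lin j f f a 0; rewrite mul0r addr0 => <-; congr ew.
by apply/funext => x; rewrite mul0r addr0.
Qed.

Lemma ew_dist j f g h : (forall x, `|x| <= j.+1%:R -> `|f x - g x| <= h x) ->
  `|ew j f - ew j g| <= ew j h.
Proof.
move=> fgh; have fE : ew j f - ew j g = ew j (fun x => 1 * f x + (-1) * g x).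
  by rewrite ew_lin mul1r mulN1r.
have hE : - ew j h = ew j (fun x => -1 * h x) by rewrite ewZ mulN1r.
rewrite fE ler_norml hE; apply/andP; split; apply: ew_le => x xj;
  by have := fgh x xj; rewrite ler_norml => /andP[? ?]; lra.
Qed.

Lemma ew_norm j f (C : R) : (forall x, `|f x| <= C) -> `|ew j f| <= C.
Proof.
move=> fC; have := @ew_dist j f (fun=> 0) (fun=> C).
by rewrite !ew_cst subr0; apply=> x _; rewrite subr0.
Qed.

(** The second moment [v] satisfies [v (m + 1) = (1 + 1 / m) * v m + 1], so that it
    is of order [m * ln m]; the cruder power [m ^ (3 / 2)] keeps the induction
    elementary and is still small enough for the error terms to be summable. *)
Lemma ew_sqr j : ew j (fun x => x ^+ 2) <= 2 * (Num.sqrt j.+1%:R) ^+ 3.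
Proof.
elim: j => [|j IH] /=.
  by rewrite sqrtr1 expr1n; have /andP[? ?] := s01; lra.
set a := Num.sqrt j.+1%:R in IH *; set b := Num.sqrt j.+2%:R.
have a0 : 0 < a by rewrite sqrtr_gt0 ltr0n.
have b0 : 0 < b by rewrite sqrtr_gt0 ltr0n.
have aE : a ^+ 2 = j.+1%:R by rewrite sqr_sqrtr.
have bE : b ^+ 2 = a ^+ 2 + 1 by rewrite sqr_sqrtr// aE natr1.
have ab : a <= b by rewrite ler_sqrt// ler_nat.
rewrite (_ : ew j _ = ew j (fun x => (1 + (a ^+ 2)^-1) * x ^+ 2 + 1 * 1)); last first.
  congr ew; apply/funext => x; rewrite /erw_step -aE; field; exact: lt0r_neq0.
rewrite ew_lin ew_cst.
apply: (@le_trans _ _ ((1 + (a ^+ 2)^-1) * (2 * a ^+ 3) + 1 * 1)).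
  by rewrite lerD2r ler_wpM2l// addr_ge0// invr_ge0 exprn_ge0// ltW.
have -> : (1 + (a ^+ 2)^-1) * (2 * a ^+ 3) = 2 * a * b ^+ 2.
  by rewrite bE; field; exact: lt0r_neq0.
have h : (b - a) * (b + a) = 1 by rewrite -subr_sqr bE; ring.
have : 0 <= b ^+ 2 * (b - a) by rewrite mulr_ge0 ?sqr_ge0// subr_ge0.
suff : 1 <= 2 * b ^+ 2 * (b - a) by nra.
have -> : 2 * b ^+ 2 * (b - a) = 1 + (b - a) * (2 * b ^+ 2 - (b + a)).
  by rewrite -[X in _ = X + _]h; ring.
rewrite lerDl mulr_ge0 ?subr_ge0//.
have b1 : 1 <= b by rewrite -sqrtr1 ler_sqrt// ler1n.
nra.
Qed.

End Mean.

(** The test function after adding an independent centered Gaussian variable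
    of standard deviation [tau] to [z], and rescaling by [kappa]. *)
Definition gauss_avg f kappa tau z : R := (\int[gauss]_y f (kappa * (z + tau * y)))%R.

Lemma gauss_avg_int f C kappa tau z : continuous f -> (forall x, `|f x| <= C) ->
  gauss.-integrable setT (EFin \o (fun y : R => f (kappa * (z + tau * y)))).
Proof.
move=> cf fC; apply: (@integrable_bounded _ _ _ _ _ C) => //.
apply: (measurableT_comp (continuous_measurable_fun cf)).
by apply: measurable_funM => //; apply: measurable_funD.
Qed.

Lemma gauss_avg_norm f C kappa tau z : continuous f -> (forall x, `|f x| <= C) ->
  `|gauss_avg f kappa tau z| <= C.
Proof.
move=> cf fC; apply: le_trans (le_normr_Rintegral _ _) _ => //.
  exact: gauss_avg_int fC.
rewrite -[leRHS](Rintegral_prob_cst gauss); apply: le_Rintegral => //.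
- by have /integrable_norm := gauss_avg_int kappa tau z cf fC.
- by apply: (@integrable_bounded _ _ _ _ _ `|C|).
Qed.

Lemma gauss_avg0 f kappa z : gauss_avg f kappa 0 z = f (kappa * z).
Proof.
rewrite /gauss_avg -[RHS](Rintegral_prob_cst gauss).
by apply: eq_Rintegral => y _; rewrite mul0r addr0.
Qed.

Section Smoothing.
Variables (K : R) (f f1 f2 : R -> R) (tf : test_function K f f1 f2).
Variable (kappa : R).
Hypothesis (kappa0 : 0 <= kappa).

Let K0 : 0 <= K.
Proof. by case: tf => _ _ _ /(_ 0)[+ _ _] _; apply: le_trans. Qed.

(** The Taylor expansion of a test function survives averaging; each
    derivative brings out one factor [kappa]. *)
Lemma gauss_avg_taylor tau z (h : R) :
  `|gauss_avg f kappa tau (z + h) - gauss_avg f kappa tau z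
    - h * (kappa * gauss_avg f1 kappa tau z)
    - h ^+ 2 / 2 * (kappa ^+ 2 * gauss_avg f2 kappa tau z)|
  <= K * kappa ^+ 3 * `|h| ^+ 3.
Proof.
have [cf cf1 cf2 fK T] := tf.
have i0 u : gauss.-integrable setT (EFin \o (fun y => f (kappa * (u + tau * y)))).
  by apply: gauss_avg_int cf _ => x; case: (fK x) => + _ _; exact.
have i1 : gauss.-integrable setT (EFin \o (fun y => f1 (kappa * (z + tau * y)))).
  by apply: gauss_avg_int cf1 _ => x; case: (fK x) => _ + _; exact.
have i2 : gauss.-integrable setT (EFin \o (fun y => f2 (kappa * (z + tau * y)))).
  by apply: gauss_avg_int cf2 _ => x; case: (fK x) => _ _; exact.
have ib1 := RintegrableB measurableT (i0 (z + h)) (i0 z).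
have iz1 := RintegrableZ (h * kappa) measurableT i1.
have iz2 := RintegrableZ (h ^+ 2 / 2 * kappa ^+ 2) measurableT i2.
have ib2 := RintegrableB measurableT ib1 iz1.
have iB := RintegrableB measurableT ib2 iz2.
rewrite [X in `|X|](_ : _ = (\int[gauss]_y (f (kappa * (z + h + tau * y)) -
    f (kappa * (z + tau * y)) - h * kappa * f1 (kappa * (z + tau * y)) -
    h ^+ 2 / 2 * kappa ^+ 2 * f2 (kappa * (z + tau * y))))%R); last first.
  rewrite (RintegralB measurableT ib2 iz2) (RintegralB measurableT ib1 iz1).
  by rewrite (RintegralB measurableT (i0 _) (i0 _)) !RintegralZl// /gauss_avg; ring.
apply: le_trans (le_normr_Rintegral _ iB) _ => //.
rewrite -[leRHS](Rintegral_prob_cst gauss); apply: le_Rintegral => //.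
- by have /integrable_norm := iB.
- by apply: (@integrable_bounded _ _ _ _ _ `|K * kappa ^+ 3 * `|h| ^+ 3|).
- move=> y _; have := T (kappa * (z + tau * y)) (kappa * h).
  have -> : K * `|kappa * h| ^+ 3 = K * kappa ^+ 3 * `|h| ^+ 3.
    by rewrite normrM (ger0_norm kappa0); ring.
  apply: le_trans.
  rewrite le_eqVlt; apply/orP; left; apply/eqP; congr `|_|.
  rewrite (_ : kappa * (z + h + tau * y) = kappa * (z + tau * y) + kappa * h); last ring.
  by rewrite exprMn; ring.
Qed.

Definition gauss_abs3 : R := (\int[gauss]_y `|y| ^+ 3)%R.

Lemma integrable_gauss_abs3 : gauss.-integrable setT (EFin \o (fun y : R => `|y| ^+ 3)).
Proof.
apply: (@integrable_gauss_poly _ _ 1).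
  by apply: measurable_funX; apply: continuous_measurable_fun; exact: norm_continuous.
move=> y; rewrite mul1r ger0_norm ?exprn_ge0//.
have -> : y ^+ 4 = `|y| ^+ 4 by rewrite -normrX ger0_norm// exprn_even_ge0.
have y0 := normr_ge0 y; set u := `|y| in y0 *.
have := sqr_ge0 (u ^+ 2 - u); have := sqr_ge0 (u - 1); have := sqr_ge0 (u ^+ 2 - 1).
nra.
Qed.

Lemma gauss_abs3_ge0 : 0 <= gauss_abs3.
Proof. by apply: Rintegral_ge0 => y _; rewrite exprn_ge0. Qed.

(** Independent Gaussian variances add up. *)
Lemma gauss_avg_gauss tau rho z : 0 <= tau -> 0 < rho ->
  (\int[gauss]_y gauss_avg f kappa tau (z + rho * y))%R =
  gauss_avg f kappa (Num.sqrt (rho ^+ 2 + tau ^+ 2)) z.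
Proof.
have [cf _ _ fK _] := tf.
have fK' x : `|f x| <= K by case: (fK x).
rewrite le_eqVlt => /predU1P[<-|tau0] rho0.
  rewrite expr0n addr0 sqrtr_sqr gtr0_norm//; apply: eq_Rintegral => y _.
  by rewrite gauss_avg0.
have cg : continuous (fun u => f (kappa * (z + u))).
  move=> u; apply: (cvg_comp (fun u => kappa * (z + u)) f); last exact: cf.
  by apply: cvgM; [exact: cvg_cst|apply: cvgD; [exact: cvg_cst|exact: cvg_id]].
have rt0 : 0 < tau ^+ 2 + rho ^+ 2 by rewrite addr_gt0// exprn_gt0.
have := @gauss_convolution R tau rho (Num.sqrt (rho ^+ 2 + tau ^+ 2)) K
  (fun u => f (kappa * (z + u))) tau0.
rewrite [rho ^+ 2 + _]addrC sqrtr_gt0 sqr_sqrtr ?ltW//.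
move=> H; rewrite [RHS]/gauss_avg -(H rt0 erefl cg (fun x => fK' _)).
by apply: eq_Rintegral => y _; apply: eq_Rintegral => x _; rewrite addrA.
Qed.

(** The expansion [gauss_avg_taylor] averaged over a Gaussian increment, whose
    mean is zero and whose variance is [rho ^+ 2]. *)
Lemma gauss_avg_gauss_taylor tau rho z : 0 <= tau -> 0 < rho ->
  `|gauss_avg f kappa (Num.sqrt (rho ^+ 2 + tau ^+ 2)) z - gauss_avg f kappa tau z
    - rho ^+ 2 / 2 * (kappa ^+ 2 * gauss_avg f2 kappa tau z)|
  <= K * kappa ^+ 3 * (rho ^+ 3 * gauss_abs3).
Proof.
move=> tau0 rho0; have [cf _ _ fK _] := tf.
have fK' x : `|f x| <= K by case: (fK x).
rewrite -gauss_avg_gauss//.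
set A := gauss_avg f kappa tau z; set A2 := kappa ^+ 2 * _.
pose A1 := kappa * gauss_avg f1 kappa tau z.
have [m0 i1] := @gauss_mean0 R; have m2 := @gauss_variance1 R.
have i2 : gauss.-integrable setT (EFin \o (fun y : R => y ^+ 2)).
  apply: (@integrable_gauss_poly _ _ 1); first exact: measurable_funX.
  move=> y; rewrite mul1r ger0_norm ?sqr_ge0//.
  by have := sqr_ge0 (y ^+ 2 - 2^-1); nra.
have ic (c : R) : gauss.-integrable setT (EFin \o (fun=> c)).
  by apply: (@integrable_bounded _ _ _ _ _ `|c|).
have iA : gauss.-integrable setT (EFin \o (fun y => gauss_avg f kappa tau (z + rho * y))).
  apply: (@integrable_bounded _ _ _ _ _ K); last by move=> y; exact: gauss_avg_norm fK'.
  apply: (@measurable_Rintegral_snd _ _ _ _ _ gauss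
    (fun yx => f (kappa * (z + rho * yx.1 + tau * yx.2))) K) => //.
  apply: (measurableT_comp (continuous_measurable_fun cf)).
  apply: measurable_funM => //; apply: measurable_funD; first apply: measurable_funD => //;
    by apply: measurable_funM => //; exact: measurable_snd.
pose Q y := A + (rho * A1 * y + rho ^+ 2 / 2 * A2 * y ^+ 2).
have iQ' : gauss.-integrable setT (EFin \o (fun y => rho * A1 * y + rho ^+ 2 / 2 * A2 * y ^+ 2)).
  by apply: RintegrableD => //; exact: RintegrableZ.
have iQ : gauss.-integrable setT (EFin \o Q) by exact: RintegrableD.
have EQ : (\int[gauss]_y Q y)%R = A + rho ^+ 2 / 2 * A2.
  rewrite RintegralD// Rintegral_prob_cst RintegralD//; try exact: RintegrableZ.
  by rewrite !RintegralZl// m0 m2 mulr0 add0r mulr1.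
rewrite -addrA -opprD -EQ.
have E3 : (\int[gauss]_y (K * kappa ^+ 3 * rho ^+ 3 * `|y| ^+ 3))%R =
    K * kappa ^+ 3 * (rho ^+ 3 * gauss_abs3).
  by rewrite RintegralZl//; [rewrite /gauss_abs3; ring|exact: integrable_gauss_abs3].
rewrite -E3; apply: Rintegral_dist_le => //.
  by apply: RintegrableZ => //; exact: integrable_gauss_abs3.
move=> y; have := gauss_avg_taylor tau z (rho * y).
have -> : K * kappa ^+ 3 * `|rho * y| ^+ 3 = K * kappa ^+ 3 * rho ^+ 3 * `|y| ^+ 3.
  by rewrite normrM (gtr0_norm rho0); ring.
apply: le_trans.
rewrite le_eqVlt; apply/orP; left; apply/eqP; congr `|_|.
by rewrite /Q -/A -/A1 -/A2; ring.
Qed.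

(** The comparison of one step of the walk with one Gaussian step. In the
    critical case [x / sqrt m] has a conditional increment of mean
    [O(x / m ^ (5 / 2))] and variance [1 / (m + 1) + O(x ^ 2 / m ^ 3)], so its first
    two moments agree with those of a centered Gaussian variable of variance
    [1 / (m + 1)] up to terms that are summable over [m]. *)
Lemma erw_step_gauss tau m x : 0 <= tau -> (0 < m)%N -> `|x| <= m%:R ->
  `|erw_step m (fun x => gauss_avg f kappa tau (x / Num.sqrt m.+1%:R)) x
    - gauss_avg f kappa (Num.sqrt (m.+1%:R^-1 + tau ^+ 2)) (x / Num.sqrt m%:R)|
  <= K * ((kappa + kappa ^+ 3 * (8 + gauss_abs3)) / (Num.sqrt m%:R * m.+1%:R)
          + kappa ^+ 2 / (4 * m%:R ^+ 2 * m.+1%:R) * x ^+ 2).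
Proof.
move=> tau0 m0 xm; have [cf cf1 cf2 fK _] := tf.
set a := Num.sqrt m%:R; set b := Num.sqrt m.+1%:R.
have a0 : 0 < a by rewrite sqrtr_gt0 ltr0n.
have b0 : 0 < b by rewrite sqrtr_gt0 ltr0n.
have aE : m%:R = a ^+ 2 by rewrite sqr_sqrtr.
have bE' : m.+1%:R = b ^+ 2 by rewrite sqr_sqrtr.
have bE : b ^+ 2 = a ^+ 2 + 1 by rewrite -bE' -aE natr1.
have a1 : 1 <= a by rewrite -sqrtr1 ler_sqrt// ler1n.
have ab : a <= b by rewrite ler_sqrt// ler_nat.
have b2a : b <= 2 * a by rewrite -(@ler_pXn2r _ 2) ?nnegrE ?mulr_ge0 ?ltW// bE; nra.
pose d := b - a; have d0 : 0 <= d by rewrite subr_ge0.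
have dE : d * (a + b) = 1 by rewrite /d -[LHS]/((b - a) * (a + b)); nra.
have d2a : 2 * a * d <= 1 by nra.
have aN0 : a != 0 by rewrite gt_eqF.
have bN0 : b != 0 by rewrite gt_eqF.
have rho0 : 0 < b^-1 by rewrite invr_gt0.
set z := x / a.
pose A1 := kappa * gauss_avg f1 kappa tau z.
pose A2 := kappa ^+ 2 * gauss_avg f2 kappa tau z.
have A1K : `|A1| <= kappa * K.
  rewrite normrM (ger0_norm kappa0) ler_wpM2l// gauss_avg_norm// => y.
  by case: (fK y).
have A2K : `|A2| <= kappa ^+ 2 * K.
  rewrite normrM ger0_norm ?exprn_ge0// ler_wpM2l ?exprn_ge0// gauss_avg_norm// => y.
  by case: (fK y).
have := gauss_avg_gauss_taylor z tau0 rho0.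
rewrite -/A2 exprVn -bE'.
set Phi := gauss_avg f kappa tau.
set G := gauss_avg f kappa (Num.sqrt _) z; set M3 := gauss_abs3 => hG.
(* The two possible increments of [x / sqrt m]; as [`|x| <= m], both are at most
   [2 / b] in absolute value, whence the constant [8]. *)
pose hp := 1 / b - x * d / (a * b); pose hm := - 1 / b - x * d / (a * b).
have zp : (x + 1) / b = z + hp by rewrite /z /hp /d; field; rewrite ?aN0 ?bN0.
have zm : (x - 1) / b = z + hm by rewrite /z /hm /d; field; rewrite ?aN0 ?bN0.
have := gauss_avg_taylor tau z hp; have := gauss_avg_taylor tau z hm.
rewrite -zp -zm -/A1 -/A2 -/Phi => hTm hTp.
rewrite /erw_step -/Phi.
have [wp0 wm0] := erw_weights m0 xm.
pose wp := 1 / 2 + x / (4 * m%:R); pose wm := 1 / 2 - x / (4 * m%:R).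
rewrite -/wp -/wm in wp0 wm0 *.
have wE : wp + wm = 1 by rewrite /wp /wm; set w := x / _; field.
have xa : `|x| <= a ^+ 2 by rewrite -aE.
have dab : `|x * d / (a * b)| <= 1 / b.
  rewrite normrM normrM (ger0_norm d0) [`|_^-1|]gtr0_norm ?invr_gt0 ?mulr_gt0//.
  rewrite ler_pdivrMr ?mulr_gt0// [1 / b * _](_ : _ = a); last by field.
  have : `|x| * d <= a ^+ 2 * d by rewrite ler_wpM2r.
  by move/le_trans; apply; nra.
have two_b : 2 / b = 1 / b + 1 / b by field.
have nb2 : 0 <= 2 / b by rewrite divr_ge0 ?ltW.
have b8 : (2 / b) ^+ 3 = 8 / b ^+ 3 by field.
have hp3 : `|hp| ^+ 3 <= 8 / b ^+ 3.
  rewrite -b8; apply: lerXn2r; rewrite ?nnegrE//.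
  apply: le_trans (ler_normB _ _) _; rewrite two_b lerD//.
  by rewrite gtr0_norm ?divr_gt0.
have hm3 : `|hm| ^+ 3 <= 8 / b ^+ 3.
  rewrite -b8; apply: lerXn2r; rewrite ?nnegrE//.
  apply: le_trans (ler_normB _ _) _; rewrite two_b lerD//.
  by rewrite mulN1r normrN gtr0_norm ?invr_gt0// div1r.
have E1 : wp * hp + wm * hm = x * d ^+ 2 / (2 * a ^+ 2 * b).
  have -> : d ^+ 2 = d * (a + b) - 2 * a * d by rewrite /d; ring.
  rewrite dE.
  by rewrite /wp /wm /hp /hm aE; field; rewrite ?aN0 ?bN0.
have E2 : wp * hp ^+ 2 + wm * hm ^+ 2 = 1 / b ^+ 2 +
    x ^+ 2 * (d * (a * d - 1)) / (a ^+ 3 * b ^+ 2).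
  by rewrite /wp /wm /hp /hm aE; field; rewrite ?aN0 ?bN0.
have E1le : `|wp * hp + wm * hm| <= 1 / (a * b ^+ 2).
  rewrite E1 normrM normrM (ger0_norm (sqr_ge0 _)) [`|_^-1|]gtr0_norm; last first.
    by rewrite invr_gt0 !mulr_gt0.
  rewrite ler_pdivrMr ?mulr_gt0//.
  have -> : 1 / (a * b ^+ 2) * (2 * a ^+ 2 * b) = 2 * a / b by field; rewrite ?aN0 ?bN0.
  rewrite ler_pdivlMr//.
  have h1 : `|x| * d ^+ 2 * b <= a ^+ 2 * d ^+ 2 * b.
    by rewrite ler_pM2r// ler_wpM2r ?sqr_ge0.
  apply: le_trans h1 _.
  have h2 : (a * d) ^+ 2 <= 1 by rewrite exprn_ile1 ?mulr_ge0 ?ltW//; nra.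
  have -> : a ^+ 2 * d ^+ 2 * b = (a * d) ^+ 2 * b by ring.
  by apply: le_trans b2a; rewrite ler_piMl// ltW.
have E2le : `|wp * hp ^+ 2 + wm * hm ^+ 2 - 1 / b ^+ 2| <=
    x ^+ 2 / (2 * a ^+ 4 * b ^+ 2).
  rewrite E2 addrAC subrr add0r normrM normrM (ger0_norm (sqr_ge0 x)).
  rewrite [`|_^-1|]gtr0_norm ?invr_gt0 ?mulr_gt0 ?exprn_gt0//.
  have -> : x ^+ 2 / (2 * a ^+ 4 * b ^+ 2) = x ^+ 2 * ((1 / (2 * a)) / (a ^+ 3 * b ^+ 2)).
    by field; rewrite ?aN0 ?bN0.
  rewrite -[leLHS]mulrA; apply: ler_wpM2l; first exact: sqr_ge0.
  apply: ler_wpM2r; first by rewrite invr_ge0 mulr_ge0// exprn_ge0// ltW.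
  have ad0 : 0 <= a * d by rewrite mulr_ge0// ltW.
  have ad1 : `|a * d - 1| <= 1 by rewrite ler_norml; apply/andP; split; lra.
  rewrite normrM (ger0_norm d0); apply: (@le_trans _ _ d); first by rewrite ler_piMr.
  by rewrite ler_pdivlMr ?mulr_gt0// mulrC.
pose e := K * kappa ^+ 3 * (8 / b ^+ 3).
have Kk : 0 <= K * kappa ^+ 3 by rewrite mulr_ge0 ?exprn_ge0.
have Tp : `|Phi ((x + 1) / b) - Phi z - hp * A1 - hp ^+ 2 / 2 * A2| <= e.
  by apply: le_trans hTp _; rewrite ler_wpM2l.
have Tm : `|Phi ((x - 1) / b) - Phi z - hm * A1 - hm ^+ 2 / 2 * A2| <= e.
  by apply: le_trans hTm _; rewrite ler_wpM2l.
set Rp := (X in `|X| <= e) in Tp; set Rm := (X in `|X| <= e) in Tm.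
set RG := (X in `|X| <= _) in hG.
have key : wp * Phi ((x + 1) / b) + wm * Phi ((x - 1) / b) - G =
   (wp * Rp + wm * Rm) + (wp * hp + wm * hm) * A1
   + (wp * hp ^+ 2 + wm * hm ^+ 2 - 1 / b ^+ 2) / 2 * A2 - RG.
  have wmE : wm = 1 - wp by rewrite -wE; ring.
  rewrite /Rp /Rm /RG bE' wmE; field; rewrite ?aN0 ?bN0 //.
rewrite key.
have n1 : `|wp * Rp + wm * Rm| <= e.
  apply: le_trans (ler_normD _ _) _; rewrite !normrM (ger0_norm wp0) (ger0_norm wm0).
  have eE : e = wp * e + wm * e by rewrite -mulrDl wE mul1r.
  by rewrite [leRHS]eE lerD// ler_wpM2l.
have n2 : `|(wp * hp + wm * hm) * A1| <= 1 / (a * b ^+ 2) * (kappa * K).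
  by rewrite normrM ler_pM.
have n3 : `|(wp * hp ^+ 2 + wm * hm ^+ 2 - 1 / b ^+ 2) / 2 * A2| <=
    x ^+ 2 / (2 * a ^+ 4 * b ^+ 2) / 2 * (kappa ^+ 2 * K).
  by rewrite normrM normrM [`|2^-1|]gtr0_norm ?invr_gt0// ler_pM// ler_wpM2r ?invr_ge0.
apply: le_trans (ler_normB _ _) _.
apply: (@le_trans _ _ (e + 1 / (a * b ^+ 2) * (kappa * K) +
   x ^+ 2 / (2 * a ^+ 4 * b ^+ 2) / 2 * (kappa ^+ 2 * K) +
   K * kappa ^+ 3 * (b^-1 ^+ 3 * M3))).
  apply: lerD; last exact: hG.
  apply: le_trans (ler_normD _ _) _; apply: lerD => //.
  by apply: le_trans (ler_normD _ _) _; apply: lerD.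
have b3 : 1 / b ^+ 3 <= 1 / (a * b ^+ 2).
  rewrite !div1r lef_pV2 ?posrE ?mulr_gt0 ?exprn_gt0//.
  by rewrite exprS ler_wpM2r ?sqr_ge0.
have -> : e + 1 / (a * b ^+ 2) * (kappa * K) +
   x ^+ 2 / (2 * a ^+ 4 * b ^+ 2) / 2 * (kappa ^+ 2 * K) +
   K * kappa ^+ 3 * (b^-1 ^+ 3 * M3) =
   K * kappa ^+ 3 * (8 + M3) * (1 / b ^+ 3) + 1 / (a * b ^+ 2) * (kappa * K) +
   x ^+ 2 / (2 * a ^+ 4 * b ^+ 2) / 2 * (kappa ^+ 2 * K).
  by rewrite /e; field; rewrite ?aN0 ?bN0.
have -> : K * ((kappa + kappa ^+ 3 * (8 + M3)) / (a * m.+1%:R) +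
      kappa ^+ 2 / (4 * m%:R ^+ 2 * m.+1%:R) * x ^+ 2) =
   K * kappa ^+ 3 * (8 + M3) * (1 / (a * b ^+ 2)) + 1 / (a * b ^+ 2) * (kappa * K) +
   x ^+ 2 / (2 * a ^+ 4 * b ^+ 2) / 2 * (kappa ^+ 2 * K).
  by rewrite aE bE'; field; rewrite ?aN0 ?bN0.
rewrite !lerD2r ler_wpM2l// mulr_ge0// addr_ge0//; exact: gauss_abs3_ge0.
Qed.

(** The variance that the Gaussian steps replacing the steps after time
    [j + 1] accumulate up to time [N + 1]. *)
Definition tail_variance j N : R := \sum_(j <= i < N) i.+2%:R^-1.

Lemma tail_variance_ge0 j N : 0 <= tail_variance j N.
Proof. by apply: sumr_ge0 => i _; rewrite invr_ge0. Qed.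

Variables (s : R) (s01 : 0 <= s <= 1).
Local Notation ew := (erw_mean s).

(** Lindeberg's replacement: the steps of the walk are exchanged one by one,
    the last one first, for Gaussian steps. For small [kappa] the total error is
    of order [kappa], uniformly in [N], because the error at step [j] is at most a multiple of
    [1 / sqrt j - 1 / sqrt (j + 1)]. *)
Lemma erw_lindeberg N :
  `|ew N (fun x => f (kappa * (x / Num.sqrt N.+1%:R)))
    - ew 0 (gauss_avg f kappa (Num.sqrt (tail_variance 0 N)))|
  <= 2 * K * (kappa + kappa ^+ 2 + kappa ^+ 3 * (8 + gauss_abs3)).
Proof.
pose G j x := gauss_avg f kappa (Num.sqrt (tail_variance j N)) (x / Num.sqrt j.+1%:R).
set B := kappa + _ + _.
have M3 := gauss_abs3_ge0.
have B0 : 0 <= B by rewrite !addr_ge0 ?mulr_ge0 ?exprn_ge0// addr_ge0.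
have GN : G N = fun x => f (kappa * (x / Num.sqrt N.+1%:R)).
  by apply/funext => x; rewrite /G /tail_variance big_geq// sqrtr0 gauss_avg0.
have G0 : G 0 = gauss_avg f kappa (Num.sqrt (tail_variance 0 N)).
  by apply/funext => x; rewrite /G sqrtr1 divr1.
rewrite -GN -G0.
suff H j : (j <= N)%N -> `|ew j (G j) - ew 0 (G 0)| <=
    2 * K * B * (1 - (Num.sqrt j.+1%:R)^-1).
  apply: le_trans (H N (leqnn N)) _; rewrite -[leRHS]mulr1 ler_wpM2l ?mulr_ge0//.
elim: j => [_|j IH jN]; first by rewrite subrr normr0 sqrtr1 invr1 subrr mulr0.
have := IH (ltnW jN); set a := Num.sqrt j.+1%:R; set b := Num.sqrt j.+2%:R => IHj.
have a0 : 0 < a by rewrite sqrtr_gt0 ltr0n.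
have b0 : 0 < b by rewrite sqrtr_gt0 ltr0n.
have aE : j.+1%:R = a ^+ 2 by rewrite sqr_sqrtr.
have bE' : j.+2%:R = b ^+ 2 by rewrite sqr_sqrtr.
have bE : b ^+ 2 = a ^+ 2 + 1 by rewrite -bE' -aE natr1.
have ab : a <= b by rewrite ler_sqrt// ler_nat.
have aN0 : a != 0 by rewrite gt_eqF.
have bN0 : b != 0 by rewrite gt_eqF.
pose c1 := (kappa + kappa ^+ 3 * (8 + gauss_abs3)) / (a * b ^+ 2).
pose c2 := kappa ^+ 2 / (4 * a ^+ 4 * b ^+ 2).
have step : `|ew j.+1 (G j.+1) - ew j (G j)| <= ew j (fun x => K * c1 * 1 + K * c2 * x ^+ 2).
  rewrite /=; apply: ew_dist => // x xj.
  have tE : tail_variance j N = j.+2%:R^-1 + Num.sqrt (tail_variance j.+1 N) ^+ 2.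
    by rewrite sqr_sqrtr ?tail_variance_ge0// /tail_variance big_ltn.
  rewrite {2}/G tE; apply: le_trans (erw_step_gauss (sqrtr_ge0 _) (ltn0Sn j) xj) _.
  rewrite -/a -/b aE bE' le_eqVlt; apply/orP; left; apply/eqP; rewrite /c1 /c2.
  by field; rewrite ?aN0 ?bN0.
rewrite ew_lin ew_cst in step.
have step2 : `|ew j.+1 (G j.+1) - ew j (G j)| <= K * B / (a * b ^+ 2).
  apply: le_trans step _.
  apply: (@le_trans _ _ (K * c1 * 1 + K * c2 * (2 * a ^+ 3))).
    rewrite lerD2l ler_wpM2l ?ew_sqr// mulr_ge0// divr_ge0 ?exprn_ge0//.
    by rewrite !mulr_ge0 ?exprn_ge0 ?(ltW a0) ?(ltW b0).
  have -> : K * c1 * 1 + K * c2 * (2 * a ^+ 3) = K * (kappa + kappa ^+ 2 / 2 +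
      kappa ^+ 3 * (8 + gauss_abs3)) / (a * b ^+ 2).
    by rewrite /c1 /c2; field; rewrite ?aN0 ?bN0.
  apply: ler_wpM2r; first by rewrite invr_ge0 mulr_ge0 ?exprn_ge0// ltW.
  rewrite ler_wpM2l// /B !lerD2r lerD2l.
  by rewrite ler_pdivrMr// ler_peMr ?exprn_ge0// ler1n.
(* [b - a = 1 / (a + b)] makes the error telescope. *)
have tele : (a * b ^+ 2)^-1 <= 2 * (a^-1 - b^-1).
  have -> : 2 * (a^-1 - b^-1) = 2 * ((b - a) * (b + a)) * b / (b + a) * (a * b ^+ 2)^-1.
    by field; rewrite ?aN0 ?bN0 gt_eqF// addr_gt0.
  have -> : (b - a) * (b + a) = 1 by rewrite -subr_sqr bE; ring.
  rewrite ler_peMl ?invr_ge0 ?mulr_ge0 ?exprn_ge0 ?(ltW a0) ?(ltW b0)//.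
  by rewrite ler_pdivlMr ?addr_gt0//; lra.
have := ler_wpM2l (mulr_ge0 K0 B0) tele.
have := ler_normD (ew j.+1 (G j.+1) - ew j (G j)) (ew j (G j) - ew 0 (G 0)).
rewrite addrA subrK => h1 h2.
apply: le_trans h1 _; apply: le_trans (lerD step2 IHj) _.
apply: le_trans (lerD h2 (lexx _)) _.
by rewrite le_eqVlt; apply/orP; left; apply/eqP; ring.
Qed.

End Smoothing.

(** Comparison of the harmonic sum with the logarithm. *)
Lemma tail_variance_ln N : ln N.+1%:R - 1 <= tail_variance 0 N <= ln N.+1%:R.
Proof.
have lnr (x y : R) : 0 < x -> 0 < y -> 1 - x / y <= ln (y / x).
  move=> x0 y0; have := @le_ln1Dx R (x / y - 1).
  rewrite addrCA subrr addr0 ltrBrDr addNr divr_gt0// => /(_ isT).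
  rewrite ln_div ?posrE// ln_div ?posrE//; lra.
have pos n : 0 < n.+1%:R :> R by [].
apply/andP; split.
  suff : ln N.+2%:R - ln 2 <= tail_variance 0 N.
    have : ln N.+1%:R <= ln N.+2%:R :> R by rewrite ler_ln ?posrE// ler_nat.
    have : ln 2 <= 1 :> R by have := @le_ln1Dx R 1; rewrite -natr1; apply; lra.
    lra.
  elim: N => [|N IH]; first by rewrite subrr /tail_variance big_geq.
  rewrite /tail_variance big_nat_recr//= -/(tail_variance 0 N).
  have := @le_ln1Dx R N.+2%:R^-1; rewrite (lt_trans (ltrN10 R)) ?invr_gt0// => /(_ isT).
  have -> : 1 + N.+2%:R^-1 = N.+3%:R / N.+2%:R :> R.
    by rewrite -[N.+3%:R]natr1; field; rewrite gt_eqF.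
  rewrite ln_div ?posrE// => h.
  move: IH h; set x1 := ln _; set x2 := ln _; set x3 := ln _; set x4 := tail_variance _ _; set x5 := _^-1. lra.
elim: N => [|N IH]; first by rewrite ln1 /tail_variance big_geq.
rewrite /tail_variance big_nat_recr//= -/(tail_variance 0 N).
have := lnr N.+1%:R N.+2%:R (pos _) (pos _).
have -> : 1 - N.+1%:R / N.+2%:R = N.+2%:R^-1 :> R.
  have := pos N; rewrite -[N.+2%:R]natr1; move: (N.+1%:R) => u u0.
  by field; rewrite gt_eqF// addr_gt0.
rewrite ln_div ?posrE// => h; move: IH h.
set x1 := ln _; set x2 := ln _; set x4 := tail_variance _ _; set x5 := _^-1; lra.
Qed.

Lemma cvg_ln_nat : (ln n.+1%:R : R) @[n --> \oo] --> +oo.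
Proof.
apply/cvgryPge => A; near=> n.
rewrite -[A]expRK ler_ln ?posrE ?expR_gt0//.
apply: (@le_trans _ _ n%:R); last by rewrite ler_nat.
by near: n; exact: nbhs_infty_ger.
Unshelve. all: by end_near. Qed.

(** The central limit theorem in the critical case, where the variance grows
    like [m * ln m]. In [erw_lindeberg] the scale [kappa] is [c / sqrt (ln m)]: it
    tends to zero, and the accumulated variance [kappa ^ 2 * tail_variance] tends
    to [c ^ 2]. The scale [c_ n] is allowed to vary because the second part of the
    final theorem needs a scale that depends on the number of ones. *)
Lemma erw_critical_clt (s K : R) f f1 f2 (N_ : nat -> nat) (c_ : nat -> R) (c : R) :
  0 <= s <= 1 -> test_function K f f1 f2 ->
  N_ n @[n --> \oo] --> \oo -> (forall n, 0 <= c_ n) ->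
  c_ n @[n --> \oo] --> c ->
  erw_mean s (N_ n)
    (fun x => f (c_ n * (x / Num.sqrt ((N_ n).+1%:R * ln (N_ n).+1%:R))))
    @[n --> \oo] --> (\int[gauss]_y f (c * y))%R.
Proof.
move=> s01 tf NN c0 cc; have [cf _ _ fK _] := tf.
have fK' x : `|f x| <= K by case: (fK x).
pose L n : R := ln (N_ n).+1%:R.
have Loo : L n @[n --> \oo] --> +oo by exact: (cvg_comp _ _ NN cvg_ln_nat).
have L0 n : 0 <= L n by rewrite ln_ge0// ler1n.
have Linv : (L n)^-1 @[n --> \oo] --> (0 : R).
  apply/gtr0_cvgV0; last exact: Loo.
  by move/cvgryPgt : Loo => /(_ 0).
pose kappa n := c_ n / Num.sqrt (L n).
have kappa0 n : 0 <= kappa n by rewrite divr_ge0.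
have kcvg : kappa n @[n --> \oo] --> (0 : R).
  rewrite -(mulr0 c); apply: cvgM => //.
  have : Num.sqrt (L n)^-1 @[n --> \oo] --> (Num.sqrt 0 : R).
    exact: (cvg_comp _ _ Linv (@sqrt_continuous R 0)).
  by rewrite sqrtr0; apply: cvg_eqfun => n; rewrite sqrtrV.
pose t n := tail_variance 0 (N_ n).
have tL : t n / L n @[n --> \oo] --> (1 : R).
  have h1 : 1 - (L n)^-1 @[n --> \oo] --> (1 - 0 : R).
    by apply: cvg_subr => //; exact: cvg_cst.
  have h2 : (fun=> 1) n @[n --> \oo] --> (1 : R) by exact: cvg_cst.
  rewrite subr0 in h1; apply: (squeeze_cvgr _ h1 h2).
  move/cvgryPgt : Loo => /(_ 0); apply: filterS => n Ln.
  have /andP[l u] := tail_variance_ln (N_ n).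
  rewrite ler_pdivlMr// mulrBl mul1r mulVf ?gt_eqF// l/=.
  by rewrite ler_pdivrMr// mul1r.
pose G n := gauss_avg f (kappa n) (Num.sqrt (t n)).
have GG (x : R) : G n x @[n --> \oo] --> (\int[gauss]_y f (c * y))%R.
  apply: (@bounded_cvg _ _ _ gauss _ _ K) => //.
  - move=> n; apply: (measurableT_comp (continuous_measurable_fun cf)).
    by apply: measurable_funM => //; exact: measurable_funD.
  - apply: (measurableT_comp (continuous_measurable_fun cf)).
    exact: measurable_funM.
  - apply: aeW => y.
    have : kappa n * (x + Num.sqrt (t n) * y) @[n --> \oo] --> c * y.
      have h : kappa n * x + c_ n * Num.sqrt (t n / L n) * y @[n --> \oo]
          --> 0 * x + c * Num.sqrt 1 * y.
        apply: cvg_addr; first exact: cvg_mulrr.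
        apply: cvg_mulrr; apply: cvgM => //.
        exact: (cvg_comp _ _ tL (@sqrt_continuous R 1)).
      rewrite mul0r add0r sqrtr1 mulr1 in h; apply: cvg_eqfun h => n.
      by rewrite sqrtrM ?tail_variance_ge0// sqrtrV// /kappa; ring.
    by move=> h; exact: (cvg_comp _ _ h (cf _)).
pose B n := 2 * K * (kappa n + kappa n ^+ 2 + kappa n ^+ 3 * (8 + gauss_abs3)).
have Bcvg : B n @[n --> \oo] --> (0 : R).
  rewrite -(mulr0 (2 * K)); apply: cvg_mulrl.
  have h : kappa n + kappa n ^+ 2 + kappa n ^+ 3 * (8 + gauss_abs3) @[n --> \oo]
      --> (0 + 0 ^+ 2 + 0 ^+ 3 * (8 + gauss_abs3) : R).
    apply: cvg_addr; first apply: cvg_addr => //; last apply: cvg_mulrr.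
    - exact: (cvg_comp _ _ kcvg (@exprn_continuous R 2 0)).
    - exact: (cvg_comp _ _ kcvg (@exprn_continuous R 3 0)).
  by rewrite !expr0n/= mul0r !addr0 in h.
have E0 : erw_mean s 0 (G n) @[n --> \oo] --> (\int[gauss]_y f (c * y))%R.
  rewrite [X in _ --> X](_ : _ = s * (\int[gauss]_y f (c * y))%R +
     (1 - s) * (\int[gauss]_y f (c * y))%R); last by ring.
  by apply: cvg_addr; apply: cvg_mulrl; exact: GG.
have low := cvg_subr E0 Bcvg; have up := cvg_addr E0 Bcvg.
rewrite subr0 in low; rewrite addr0 in up.
apply: (squeeze_cvgr _ low up); apply: nearW => n.
have := erw_lindeberg tf (kappa0 n) s01 (N_ n).
rewrite -/(G n) -/(B n).
have -> : (fun x => f (kappa n * (x / Num.sqrt (N_ n).+1%:R))) =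
  (fun x => f (c_ n * (x / Num.sqrt ((N_ n).+1%:R * ln (N_ n).+1%:R)))).
  apply/funext => x; congr f; rewrite sqrtrM// invfM /kappa -/(L n); ring.
by rewrite ler_distl.
Qed.

End CriticalElephant.

(** * Means of bounded random variables *)

Section BoundedExpectation.
Context d (T : measurableType d) (R : realType) (P : probability T R).
Implicit Types (f g : T -> R) (b : T -> bool).

Definition bounded_meas f := measurable_fun setT f /\ exists C, forall w, `|f w| <= C.

Lemma bm_integrable f : bounded_meas f -> P.-integrable setT (EFin \o f).
Proof. by case=> mf [C fC]; exact: integrable_bounded fC. Qed.

Lemma bm_cst (c : R) : bounded_meas (fun=> c).
Proof. by split => //; exists `|c|. Qed.

Lemma bmD f g : bounded_meas f -> bounded_meas g ->
  bounded_meas (fun w => f w + g w).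
Proof.
move=> [mf [C fC]] [mg [D gD]]; split; first exact: measurable_funD.
by exists (C + D) => w; apply: le_trans (ler_normD _ _) _; apply: lerD.
Qed.

Lemma bmM f g : bounded_meas f -> bounded_meas g ->
  bounded_meas (fun w => f w * g w).
Proof.
move=> [mf [C fC]] [mg [D gD]]; split; first exact: measurable_funM.
by exists (C * D) => w; rewrite normrM ler_pM.
Qed.

Lemma bmZ c f : bounded_meas f -> bounded_meas (fun w => c * f w).
Proof. by move=> bf; exact: bmM (bm_cst c) bf. Qed.

Lemma bmB f g : bounded_meas f -> bounded_meas g ->
  bounded_meas (fun w => f w - g w).
Proof.
move=> bf bg; have := bmD bf (bmZ (-1) bg).
by under eq_fun do rewrite mulN1r.
Qed.

Lemma bm_sum I (r : seq I) (F : I -> T -> R) :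
  (forall i, bounded_meas (F i)) -> bounded_meas (fun w => \sum_(i <- r) F i w).
Proof.
move=> bF; elim: r => [|i r IH].
  by under eq_fun do rewrite big_nil; exact: bm_cst.
by under eq_fun do rewrite big_cons; exact: bmD.
Qed.

Lemma bm_bool b : measurable [set w | b w] -> bounded_meas (fun w => (b w)%:R).
Proof.
move=> mb; split; last first.
  by exists 1 => w; case: (b w); rewrite ?normr1// normr0.
rewrite (_ : (fun _ => _) = \1_[set w | b w]); first exact: measurable_indic.
apply/funext => w; rewrite indicE; congr (nat_of_bool _)%:R.
by apply/idP/idP; rewrite ?inE.
Qed.

Lemma ED f g : bounded_meas f -> bounded_meas g ->
  (\int[P]_w (f w + g w))%R = (\int[P]_w f w)%R + (\int[P]_w g w)%R.
Proof. by move=> bf bg; rewrite RintegralD//; exact: bm_integrable. Qed.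

Lemma EB f g : bounded_meas f -> bounded_meas g ->
  (\int[P]_w (f w - g w))%R = (\int[P]_w f w)%R - (\int[P]_w g w)%R.
Proof. by move=> bf bg; rewrite RintegralB//; exact: bm_integrable. Qed.

Lemma EZ c f : bounded_meas f ->
  (\int[P]_w (c * f w))%R = c * (\int[P]_w f w)%R.
Proof. by move=> bf; rewrite RintegralZl//; exact: bm_integrable. Qed.

Lemma Esum I (r : seq I) (F : I -> T -> R) : (forall i, bounded_meas (F i)) ->
  (\int[P]_w (\sum_(i <- r) F i w))%R = \sum_(i <- r) (\int[P]_w F i w)%R.
Proof.
move=> bF; elim: r => [|i r IH].
  under eq_Rintegral do rewrite big_nil.
  by rewrite Rintegral_prob_cst big_nil.
under eq_Rintegral do rewrite big_cons.
by rewrite ED// ?IH ?big_cons//; exact: bm_sum.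
Qed.

Lemma E_le f g : bounded_meas f -> bounded_meas g -> (forall w, f w <= g w) ->
  (\int[P]_w f w)%R <= (\int[P]_w g w)%R.
Proof. by move=> bf bg fg; apply: le_Rintegral => //; exact: bm_integrable. Qed.

Lemma E_ae f g : bounded_meas f -> bounded_meas g ->
  {ae P, forall w, f w = g w} -> (\int[P]_w f w)%R = (\int[P]_w g w)%R.
Proof. by move=> [mf _] [mg _]; exact: ae_eq_Rintegral. Qed.

Lemma E_bool b : measurable [set w | b w] ->
  ((\int[P]_w (b w)%:R)%R)%:E = P [set w | b w].
Proof.
move=> mb; rewrite /Rintegral fineK; last first.
  by apply: integrable_fin_num => //; apply: bm_integrable; exact: bm_bool.
rewrite -[X in P X]setIT -integral_indic//; apply: eq_integral => w _; congr EFin.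
rewrite indicE; congr (nat_of_bool _)%:R.
by apply/idP/idP; rewrite ?inE.
Qed.

Lemma E_eq0_ae f : bounded_meas f -> (forall w, 0 <= f w) ->
  (\int[P]_w f w)%R = 0 -> {ae P, forall w, f w = 0}.
Proof.
move=> bf f0 Ef; have intf := bm_integrable bf.
have : (\int[P]_w `|(f w)%:E| = 0)%E.
  under eq_integral do rewrite /= ger0_norm//.
  by rewrite -(fineK (integrable_fin_num measurableT intf)) -/(Rintegral P setT f) Ef.
move/integrableP : intf => [mf _]; move/(ae_eq_integral_abs P measurableT mf).
by apply: filterS => w /(_ Logic.I) [].
Qed.

End BoundedExpectation.
Arguments bm_cst {d T R} c.

(** * The conditional law of a step given the past *)

Section Steps.
Context d (T : measurableType d) (R : realType) (P : probability T R).
Variables (p q r s : R).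
Hypothesis (pqr : p + q + r = 1).
Variable (X : nat -> {RV P >-> R}).
Hypothesis (hX : is_ERWS P p q r s X).
Local Notation EE := (Rintegral P setT).
Implicit Types (n k : nat) (b : T -> bool) (G : T -> R).

Lemma measurable_eq (Y : {RV P >-> R}) (y : R) : measurable [set w | Y w == y].
Proof.
rewrite (_ : [set _ | _] = Y @^-1` [set y]).
  by rewrite -[_ @^-1` _]setTI; exact: measurable_funP.
by apply/seteqP; split => w /= /eqP.
Qed.

Lemma measurable_eqn (Y : {RV P >-> nat}) k : measurable [set w | Y w == k].
Proof.
rewrite (_ : [set _ | _] = Y @^-1` [set k]).
  by rewrite -[_ @^-1` _]setTI; exact: measurable_funP.
by apply/seteqP; split => w /= /eqP.
Qed.

Lemma measurable_andb b1 b2 : measurable [set w | b1 w] -> measurable [set w | b2 w] ->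
  measurable [set w | b1 w && b2 w].
Proof.
move=> m1 m2; rewrite (_ : [set _ | _] = [set w | b1 w] `&` [set w | b2 w]).
  exact: measurableI.
by apply/seteqP; split => w /=; [move/andP|case=> -> ->].
Qed.

(** Events of the past are handled as boolean functions, so that they can be
    counted and combined by boolean connectives. *)
Definition past_event n b := past X n [set w | b w].

Lemma past_event_measurable n b : past_event n b -> measurable [set w | b w].
Proof.
apply: smallest_sub; first exact: sigma_algebra_measurable.
by move=> A [i _ [B mB <-]]; exact: measurable_funP.
Qed.

Lemma past_eventX n k (y : R) : (0 < k <= n)%N -> past_event n (fun w => X k w == y).
Proof.
move=> kn; apply: sub_sigma_algebra; exists k => //; exists [set y] => //.
by rewrite setTI; apply/seteqP; split => w /= /eqP.
Qed.

Lemma past_event_and n b1 b2 : past_event n b1 -> past_event n b2 ->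
  past_event n (fun w => b1 w && b2 w).
Proof.
move=> h1 h2; rewrite /past_event.
rewrite (_ : [set _ | _] = [set w | b1 w] `&` [set w | b2 w]).
  exact: (@measurableI _ (g_sigma_algebraType _) _ _ h1 h2).
by apply/seteqP; split => w /=; [move/andP|case=> -> ->].
Qed.

Lemma past_event_neg n b : past_event n b -> past_event n (fun w => ~~ b w).
Proof.
move=> h; rewrite /past_event (_ : [set _ | _] = ~` [set w | b w]).
  exact: (@measurableC _ (g_sigma_algebraType _) _ h).
by apply/seteqP; split => w /= /negP.
Qed.

Lemma past_event_or n b1 b2 : past_event n b1 -> past_event n b2 ->
  past_event n (fun w => b1 w || b2 w).
Proof.
move=> h1 h2; have := past_event_neg (past_event_and (past_event_neg h1) (past_event_neg h2)).
by rewrite /past_event; under eq_set do rewrite negb_and !negbK.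
Qed.

Lemma past_event_cst n c : past_event n (fun=> c).
Proof.
rewrite /past_event; case: c.
  rewrite (_ : [set _ | _] = setT); last by apply/seteqP; split.
  exact: (@measurableT _ (g_sigma_algebraType _)).
rewrite (_ : [set _ | _] = set0); last by apply/seteqP; split.
exact: (@measurable0 _ (g_sigma_algebraType _)).
Qed.

Definition visits (y : R) n w : nat := (\sum_(1 <= k < n.+1) (X k w == y)%R)%N.

Lemma visitsS y n w : visits y n.+1 w = (visits y n w + (X n.+1 w == y)%R)%N.
Proof. by rewrite /visits big_nat_recr. Qed.

Lemma visits_le y n w : (visits y n w <= n)%N.
Proof.
elim: n => [|n IH]; first by rewrite /visits big_geq.
by rewrite visitsS -addn1 leq_add// leq_b1.
Qed.

Lemma past_visits y N n i : (n <= N)%N -> past_event N (fun w => visits y n w == i).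
Proof.
elim: n i => [|n IH] i nN.
  rewrite /past_event; under eq_set do rewrite /visits big_geq//.
  exact: past_event_cst.
have xN : past_event N (fun w => X n.+1 w == y) by apply: past_eventX; rewrite ltn0Sn.
case: i => [|i].
  have := past_event_and (IH 0 (ltnW nN)) (past_event_neg xN).
  rewrite /past_event; congr past; apply/funext => w /=; congr is_true.
  by rewrite visitsS addn_eq0 eqb0.
have := past_event_or (past_event_and (IH i (ltnW nN)) xN)
  (past_event_and (IH i.+1 (ltnW nN)) (past_event_neg xN)).
rewrite /past_event; congr past; apply/funext => w /=; congr is_true.
rewrite visitsS; case: (X n.+1 w == y) => /=.
  by rewrite andbT andbF orbF addn1 eqSS.
by rewrite andbF andbT addn0.
Qed.

Definition observable (h : nat -> nat -> R) n w : R := h (visits 1 n w) (visits (-1) n w).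

(** The pair of counts takes finitely many values, so every function of it is
    a linear combination of indicators of events of the past. *)
Lemma observableE h n w : observable h n w = \sum_(i < n.+1) \sum_(j < n.+1)
  h i j * ((visits 1 n w == i) && (visits (-1) n w == j))%:R.
Proof.
have ui : (visits 1 n w < n.+1)%N by rewrite ltnS visits_le.
have vj : (visits (-1) n w < n.+1)%N by rewrite ltnS visits_le.
rewrite (bigD1 (Ordinal ui))//= (bigD1 (Ordinal vj))//= !eqxx mulr1.
rewrite big1 ?addr0 ?big1 ?addr0//.
- move=> i ni; rewrite big1// => j _; rewrite [_ == _ :> nat](_ : _ = false) ?mulr0//.
  by apply/negbTE; apply: contra ni => /eqP E; apply/eqP/val_inj.
- move=> j nj; rewrite andbC [_ == _ :> nat](_ : _ = false) ?mulr0//.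
  by apply/negbTE; apply: contra nj => /eqP E; apply/eqP/val_inj.
Qed.

Lemma past_state n i j : past_event n (fun w => (visits 1 n w == i) && (visits (-1) n w == j)).
Proof. by apply: past_event_and; [exact: past_visits|exact: past_visits]. Qed.

Lemma observable_bm h n : bounded_meas (observable h n).
Proof.
rewrite (_ : observable h n = fun w => \sum_(i < n.+1) \sum_(j < n.+1)
  h i j * ((visits 1 n w == i) && (visits (-1) n w == j))%:R); last first.
  by apply/funext => w; exact: observableE.
apply: bm_sum => i; apply: bm_sum => j; apply: bmZ; apply: bm_bool.
by apply: (@past_event_measurable n); exact: past_state.
Qed.

Lemma oppr1_neq1 : (-1 == 1 :> R) = false.
Proof. by rewrite lt_eqF// (lt_trans (ltrN10 _)). Qed.

Lemma oner_neqN1 : (1 == -1 :> R) = false.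
Proof. by rewrite eq_sym oppr1_neq1. Qed.

(** The weight [G] does not distinguish the step [n.+1] from its conditional
    law given the past: a uniformly chosen past step is repeated with probability
    [p] and reversed with probability [q]. Indicators of events of the
    past and their linear combinations are such weights; this stands in for a
    conditional expectation. *)
Definition past_weight n G := bounded_meas G /\
  EE (fun w => G w * (X n.+1 w == 1)%:R) =
    EE (fun w => G w * ((p * (visits 1 n w)%:R + q * (visits (-1) n w)%:R) / n%:R)) /\
  EE (fun w => G w * (X n.+1 w == -1)%:R) =
    EE (fun w => G w * ((p * (visits (-1) n w)%:R + q * (visits 1 n w)%:R) / n%:R)).

Section Choice.
Variables (K : nat -> {RV P >-> nat}) (e : nat -> {RV P >-> R}).
Hypothesis hKe : forall n : nat, (0 < n)%N ->
        (forall w, X n.+1 w = e n w * X (K n w) w) /\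
        forall A k, past X n A -> (0 < k <= n)%N ->
        [/\ P (A `&` K n @^-1` [set k] `&` e n @^-1` [set 1])
              = (P A * (n%:R^-1 * p)%:E)%E,
            P (A `&` K n @^-1` [set k] `&` e n @^-1` [set -1])
              = (P A * (n%:R^-1 * q)%:E)%E
          & P (A `&` K n @^-1` [set k] `&` e n @^-1` [set 0])
              = (P A * (n%:R^-1 * r)%:E)%E].

Let law (y : R) : R := if y == 1 then p else if y == -1 then q else r.

Lemma choice_law n b k (y : R) : (0 < n)%N -> past_event n b -> (0 < k <= n)%N ->
  y \in [:: 1; -1; 0] ->
  EE (fun w => (b w && (K n w == k) && (e n w == y))%:R) = EE (fun w => (b w)%:R) * (law y / n%:R).
Proof.
move=> n0 pb kn yin; have mb := past_event_measurable pb.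
have [_ /(_ _ _ pb kn) [h1 hm h0]] := hKe n0.
apply: EFin_inj; rewrite E_bool; last first.
  by apply: measurable_andb; [apply: measurable_andb => //; exact: measurable_eqn|exact: measurable_eq].
rewrite EFinM E_bool//.
have -> : [set w | b w && (K n w == k) && (e n w == y)] =
    [set w | b w] `&` K n @^-1` [set k] `&` e n @^-1` [set y].
  apply/seteqP; split => w /=; first by move=> /andP[/andP[? /eqP ?] /eqP ?].
  by move=> [[-> ->] ->]; rewrite !eqxx.
have n10 := oppr1_neq1.
have n01 : 0 == 1 :> R = false by rewrite eq_sym oner_eq0.
have n0m : 0 == -1 :> R = false by rewrite eq_sym oppr_eq0 oner_eq0.
by move: yin; rewrite !inE => /or3P[] /eqP ->;
  rewrite /law ?eqxx ?n10 ?n01 ?n0m ?h1 ?hm ?h0 mulrC.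
Qed.

Lemma choice_bm n b k (y : R) : measurable [set w | b w] ->
  bounded_meas (fun w => (b w && (K n w == k) && (e n w == y))%:R : R).
Proof.
move=> mb; apply: bm_bool; apply: measurable_andb; last exact: measurable_eq.
by apply: measurable_andb => //; exact: measurable_eqn.
Qed.

(** The probabilities of the admissible values of the choice sum up to one. *)
Lemma choice_ae n : (0 < n)%N ->
  {ae P, forall w, (0 < K n w <= n)%N /\ e n w \in [:: 1; -1; 0]}.
Proof.
move=> n0.
pose F (w : T) : R := \sum_(1 <= k < n.+1) \sum_(y <- [:: 1; -1; 0] : seq R)
  (true && (K n w == k) && (e n w == y))%:R.
have bc k y : bounded_meas (fun w => (true && (K n w == k) && (e n w == y))%:R : R).
  apply: (@choice_bm n (fun=> true)).
  by rewrite (_ : [set _ | true] = setT)//; apply/seteqP; split.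
have bF : bounded_meas F by apply: bm_sum => k; exact: bm_sum.
have EF : EE F = 1.
  rewrite /F Esum; last by move=> k; exact: bm_sum.
  rewrite (eq_big_nat _ _ (F2 := fun=> n%:R^-1)) => [|k kn].
    rewrite sumr_const_nat subSS subn0 -[RHS](@mulVf _ n%:R) ?mulr_natr//.
    by rewrite pnatr_eq0 -lt0n.
  rewrite Esum//.
  rewrite (eq_big_seq (fun y => law y / n%:R)) => [|y yin].
    rewrite !big_cons big_nil addr0 /law !eqxx.
    rewrite oppr1_neq1.
    have -> : 0 == 1 :> R = false by rewrite eq_sym oner_eq0.
    have -> : 0 == -1 :> R = false by rewrite eq_sym oppr_eq0 oner_eq0.
    by rewrite -!mulrDl addrA pqr mul1r.
  rewrite (choice_law n0 (@past_event_cst n true)) ?Rintegral_prob_cst ?mul1r//.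
have yuniq : uniq [:: 1; -1; 0 : R].
  by rewrite /= !inE !negb_or oppr_eq0 oner_eq0 !andbT eq_sym oppr1_neq1.
have F01 w : F w = ((0 < K n w <= n)%N && (e n w \in [:: 1; -1; 0]))%:R.
  have E1 k : \sum_(y <- [:: 1; -1; 0] : seq R) (true && (K n w == k) && (e n w == y))%:R
      = (K n w == k)%:R * (e n w \in [:: 1; -1; 0])%:R :> R.
    rewrite /= !big_cons big_nil addr0 !inE.
    case: (K n w == k); rewrite /= ?mul0r ?addr0// mul1r.
    move: yuniq; rewrite /= !inE negb_or andbT => /andP[/andP[a1 a2] a3].
    case: eqP => [->|_]; first by rewrite (negbTE a1) (negbTE a2) !addr0.
    case: eqP => [->|_]; first by rewrite (negbTE a3) addr0 add0r.
    by rewrite !add0r.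
  rewrite /F; under eq_bigr do rewrite E1.
  rewrite -mulr_suml -natr_sum -natrM -mulnb; congr (_ * _)%:R.
  case: (posnP (K n w)) => [->|K0].
    by rewrite big_nat big1// => k /andP[k0 _]; rewrite eq_sym gtn_eqF.
  have [Kn|nK] := leqP (K n w) n.
    rewrite (bigD1_seq (K n w)) ?iota_uniq ?mem_index_iota ?K0 ?ltnS//= eqxx big1 ?addn0//.
    by move=> k; rewrite eq_sym => /negbTE ->.
  by rewrite big_nat big1// => k /andP[_ kn]; rewrite gtn_eqF// (leq_trans kn).
have b1F : bounded_meas (fun w => 1 - F w) by apply: bmB => //; exact: bm_cst.
have F1 w : 0 <= 1 - F w by rewrite F01; case: (_ && _); rewrite ?subrr// subr0.
have : EE (fun w => 1 - F w) = 0.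
  by rewrite EB ?Rintegral_prob_cst ?EF ?subrr//; exact: bm_cst.
move=> /(E_eq0_ae b1F F1); apply: filterS => w; rewrite F01.
by case: (boolP (_ && _)) => [/andP[? ?]//|_] /eqP; rewrite subr0 oner_eq0.
Qed.

Hypothesis X1_ae : {ae P, forall w, X 1%N w \in [:: 1; -1]}.

Lemma steps_ae : {ae P, forall w, forall k, (0 < k)%N -> X k w \in [:: 1; -1; 0]}.
Proof.
have hK : {ae P, forall w, forall n, (0 < n)%N ->
    (0 < K n w <= n)%N /\ e n w \in [:: 1; -1; 0]}.
  apply: ae_foralln => n; have [->|n0] := posnP n; first exact: aeW.
  by apply: filterS (choice_ae n0) => w h _.
apply: filterS2 X1_ae hK => w X1 hw k; elim/ltn_ind: k => -[|[|k]] IH// _.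
  by move: X1; rewrite !inE => /orP[] ->; rewrite ?orbT.
have [/andP[K0 Kk] ein] := hw k.+1 (ltn0Sn k).
have [-> _] := hKe (ltn0Sn k); have := IH _ _ K0; rewrite ltnS => /(_ Kk).
move: ein; rewrite !inE => /or3P[] /eqP-> /or3P[] /eqP->;
  by rewrite ?(mulr1, mulrN1, mulr0, mul0r, opprK, oppr0, mulN1r, eqxx, orbT).
Qed.

Lemma visits_natr (y : R) n w : (visits y n w)%:R = \sum_(1 <= k < n.+1) (X k w == y)%:R :> R.
Proof. by rewrite /visits natr_sum. Qed.

(** Conditionally on the past the chosen instant is uniform, so that the
    probability of recalling a step equal to [y] is the proportion of such
    steps. *)
Lemma choice_event_weight n b : (0 < n)%N -> past_event n b ->
  past_weight n (fun w => (b w)%:R).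
Proof.
move=> n0 pb; have mb := past_event_measurable pb; split; first exact: bm_bool.
have n1 := oppr1_neq1.
have n2 : 1 == -1 :> R = false by rewrite eq_sym n1.
have n3 : 0 == 1 :> R = false by rewrite eq_sym oner_eq0.
have n4 : 0 == -1 :> R = false by rewrite eq_sym oppr_eq0 oner_eq0.
have bX k (y : R) : bounded_meas (fun w => (X k w == y)%:R : R).
  by apply: bm_bool; exact: measurable_eq.
pose bx k y w := b w && (X k w == y).
have mbx k y : measurable [set w | bx k y w] by apply: measurable_andb => //; exact: measurable_eq.
have pbx k y : (0 < k <= n)%N -> past_event n (bx k y).
  by move=> kn; apply: past_event_and => //; exact: past_eventX.
have gen (y1 y2 : R) : (y1 == 1) && (y2 == -1) || (y1 == -1) && (y2 == 1) ->
  EE (fun w => (b w)%:R * (X n.+1 w == y1)%:R) =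
  EE (fun w => (b w)%:R * ((p * (visits y1 n w)%:R + q * (visits y2 n w)%:R) / n%:R)).
  move=> y12.
  pose F w : R := \sum_(1 <= k < n.+1) ((bx k y1 w && (K n w == k) && (e n w == 1))%:R
     + (bx k y2 w && (K n w == k) && (e n w == -1))%:R).
  have bF : bounded_meas F.
    by apply: bm_sum => k; apply: bmD; exact: choice_bm.
  transitivity (EE F).
    apply: E_ae => //; first by apply: bmM => //; exact: bm_bool.
    apply: filterS2 steps_ae (choice_ae n0) => w sw [Kn ein].
    have [-> _] := hKe n0; have := sw _ (proj1 (andP Kn)).
    have FK : F w = ((bx (K n w) y1 w && (e n w == 1))%:R + (bx (K n w) y2 w && (e n w == -1))%:R).
      rewrite /F (bigD1_seq (K n w)) ?iota_uniq ?mem_index_iota ?ltnS//= eqxx !andbT big1 ?addr0//.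
      by move=> k; rewrite eq_sym => /negbTE ->; rewrite !andbF addr0.
    rewrite -/(F w) FK /bx; case: (b w); last by rewrite mul0r addr0.
    rewrite mul1r /= => xin.
    case/orP: y12 => /andP[/eqP-> /eqP->]; move: ein xin; rewrite !inE;
      move=> /or3P[] /eqP-> /or3P[] /eqP->;
      by rewrite ?(mulr1, mulrN1, mulr0, mul0r, opprK, oppr0, mulN1r, eqxx, n1, n2, n3, n4, addr0, add0r).
  rewrite Esum => [|k]; last by apply: bmD; exact: choice_bm.
  rewrite (eq_big_nat _ _ (F2 := fun k => EE (fun w => (bx k y1 w)%:R * (p / n%:R) + (bx k y2 w)%:R * (q / n%:R)))) => [|k].
    rewrite -Esum => [|k]; last by apply: bmD; apply: bmM; try exact: bm_cst; exact: bm_bool.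
    apply: eq_Rintegral => w _; rewrite !visits_natr.
    rewrite !mulr_sumr -big_split/= mulr_suml mulr_sumr; apply: eq_bigr => k _.
    by rewrite /bx -!mulnb !natrM; ring.
  move=> kn; rewrite !ED; try exact: choice_bm; last 2 first.
  - by apply: bmM; [exact: bm_bool|exact: bm_cst].
  - by apply: bmM; [exact: bm_bool|exact: bm_cst].
  rewrite (choice_law n0 (pbx _ _ kn) kn) ?(choice_law n0 (pbx _ _ kn) kn) ?inE ?eqxx ?orbT//.
  under [X in _ = X + _]eq_Rintegral do rewrite mulrC.
  under [X in _ = _ + X]eq_Rintegral do rewrite mulrC.
  by rewrite !EZ ?/law ?eqxx ?n1; [rewrite ![_ * EE _]mulrC|exact: bm_bool..].
by split; apply: gen; rewrite !eqxx ?orbT.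
Qed.

End Choice.

Lemma step_bm n (y : R) : bounded_meas (fun w => (X n w == y)%:R : R).
Proof. by apply: bm_bool; exact: measurable_eq. Qed.

Lemma first_step_law : EE (fun w => (X 1%N w == 1)%:R) = s /\
  EE (fun w => (X 1%N w == -1)%:R) = 1 - s.
Proof.
have [h1 hm _] := hX; have m1 y := measurable_eq (X 1%N) y.
have Py (y : R) : X 1%N @^-1` [set y] = [set w | X 1%N w == y].
  by apply/seteqP; split => w /= /eqP.
by split; apply: EFin_inj; rewrite E_bool// -Py.
Qed.

Lemma first_step_ae : {ae P, forall w, X 1%N w \in [:: 1; -1]}.
Proof.
have [E1 Em] := first_step_law; have bx y := step_bm 1 y.
have b0 : bounded_meas (fun w => 1 - ((X 1%N w == 1)%:R + (X 1%N w == -1)%:R) : R).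
  by apply: bmB; [exact: bm_cst|exact: bmD].
have F0 w : 0 <= 1 - ((X 1%N w == 1)%:R + (X 1%N w == -1)%:R) :> R.
  case: eqP => [->|_]; first by rewrite eq_sym oppr1_neq1 addr0 subrr.
  by rewrite add0r subr_ge0; case: eqP.
have : EE (fun w => 1 - ((X 1%N w == 1)%:R + (X 1%N w == -1)%:R)) = 0.
  rewrite EB ?ED ?Rintegral_prob_cst ?E1 ?Em; [ring| by []| by [] |exact: bm_cst|exact: bmD].
move=> /(E_eq0_ae b0 F0); apply: filterS => w; rewrite !inE.
by case: eqP => //= _; case: eqP => //= _ /eqP; rewrite addr0 subr0 oner_eq0.
Qed.

Lemma X_ae : {ae P, forall w, forall k, (0 < k)%N -> X k w \in [:: 1; -1; 0]}.
Proof. by case: hX => _ _ [K [e hKe]]; exact: (steps_ae hKe first_step_ae). Qed.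

Lemma past_event_weight n b : (0 < n)%N -> past_event n b ->
  past_weight n (fun w => (b w)%:R).
Proof. by case: hX => _ _ [K [e hKe]]; exact: (choice_event_weight hKe first_step_ae). Qed.

Lemma visits_bm (y : R) n : bounded_meas (fun w => (visits y n w)%:R : R).
Proof.
under eq_fun do rewrite visits_natr.
by apply: bm_sum => k; apply: bm_bool; exact: measurable_eq.
Qed.

Lemma drift_bm (c c' y y' : R) n :
  bounded_meas (fun w => (c * (visits y n w)%:R + c' * (visits y' n w)%:R) / n%:R : R).
Proof. by apply: bmM; [apply: bmD; apply: bmZ; exact: visits_bm|exact: bm_cst]. Qed.

Lemma past_weight_lin n G G' (c c' : R) : past_weight n G -> past_weight n G' ->
  past_weight n (fun w => c * G w + c' * G' w).
Proof.
move=> [bG [h1 h2]] [bG' [h1' h2']].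
split; first by apply: bmD; exact: bmZ.
have gen (f g : T -> R) : bounded_meas f -> bounded_meas g ->
    EE (fun w => G w * f w) = EE (fun w => G w * g w) ->
    EE (fun w => G' w * f w) = EE (fun w => G' w * g w) ->
    EE (fun w => (c * G w + c' * G' w) * f w) = EE (fun w => (c * G w + c' * G' w) * g w).
  move=> bf bg hG hG'.
  under eq_Rintegral do rewrite mulrDl -!mulrA.
  under [RHS]eq_Rintegral do rewrite mulrDl -!mulrA.
  rewrite !ED; try by apply: bmZ; exact: bmM.
  by rewrite !EZ ?hG ?hG'//; exact: bmM.
by split; apply: gen => //; try exact: step_bm; exact: drift_bm.
Qed.

Lemma past_weight_sum n I (l : seq I) (F : I -> T -> R) : (0 < n)%N ->
  (forall i, past_weight n (F i)) -> past_weight n (fun w => \sum_(i <- l) F i w).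
Proof.
move=> n0 pF; elim: l => [|i l IH].
  under eq_fun do rewrite big_nil.
  have := past_event_weight n0 (@past_event_cst n false); exact.
have := past_weight_lin 1 1 (pF i) IH.
by congr past_weight; apply/funext => w; rewrite big_cons !mul1r.
Qed.

Lemma past_weightZ n G (c : R) : past_weight n G -> past_weight n (fun w => c * G w).
Proof.
move=> pG; have := past_weight_lin c 0 pG pG.
by under eq_fun do rewrite mul0r addr0.
Qed.

Lemma past_weight_observable n h : (0 < n)%N -> past_weight n (observable h n).
Proof.
move=> n0; rewrite (_ : observable h n = fun w => \sum_(i < n.+1) \sum_(j < n.+1)
  h i j * ((visits 1 n w == i) && (visits (-1) n w == j))%:R); last first.
  by apply/funext => w; exact: observableE.
apply: past_weight_sum => // i; apply: past_weight_sum => // j.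
by apply: past_weightZ; apply: past_event_weight => //; exact: past_state.
Qed.

(** The pair of counts is a Markov chain; this is its transition, tested
    against an arbitrary function. *)
Lemma observable_step h n : (0 < n)%N ->
  EE (observable h n.+1) = EE (observable (fun i j =>
    h i j + (p * i%:R + q * j%:R) / n%:R * (h i.+1 j - h i j)
          + (p * j%:R + q * i%:R) / n%:R * (h i j.+1 - h i j)) n).
Proof.
move=> n0.
pose h1 i j := h i.+1 j - h i j; pose h2 i j := h i j.+1 - h i j.
have [bo1 [e1 _]] := past_weight_observable h1 n0.
have [bo2 [_ e2]] := past_weight_observable h2 n0.
transitivity (EE (fun w => observable h n w + observable h1 n w * (X n.+1 w == 1)%:R
   + observable h2 n w * (X n.+1 w == -1)%:R)).
  apply: eq_Rintegral => w _; rewrite /observable !visitsS /h1 /h2.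
  case: eqP => [->|_].
    by rewrite eq_sym oppr1_neq1 /= addn0 addn1 mulr0 mulr1 addr0 addrC subrK.
  case: eqP => _ /=; rewrite ?addn0 ?addn1 ?mulr0 ?mulr1 ?addr0//.
  by rewrite addrC subrK.
have bo0 := observable_bm h n.
have bs1 := bmM bo1 (step_bm n.+1 1); have bs2 := bmM bo2 (step_bm n.+1 (-1)).
have bd1 := bmM bo1 (drift_bm p q 1 (-1) n); have bd2 := bmM bo2 (drift_bm p q (-1) 1 n).
rewrite (ED P (bmD bo0 bs1) bs2) (ED P bo0 bs1) e1 e2 -(ED P bo0 bd1) -(ED P (bmD bo0 bd1) bd2).
by apply: eq_Rintegral => w _; rewrite /observable /h1 /h2; ring.
Qed.

End Steps.

(** * Monotone sequences along powers *)

Section MonotoneInterpolation.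
Context {R : realType}.

Lemma power_bracket M n : (0 < M)%N -> (0 < n)%N ->
  exists k, (k.+1 ^ M <= n < k.+2 ^ M)%N.
Proof.
move=> M0 n0.
have ex : exists k, (n < k.+2 ^ M)%N.
  exists n; apply: (@leq_trans n.+2) => //.
  by rewrite -{1}(expn1 n.+2) leq_exp2l.
case: (ex_minnP ex) => k nk kmin; exists k; rewrite nk andbT.
case: k nk kmin => [|k] nk kmin; first by rewrite exp1n.
by rewrite leqNgt; apply/negP => /kmin; rewrite ltnn.
Qed.

(** A nondecreasing sequence is squeezed between its values at two consecutive
    [M]-th powers, whose ratio tends to one. *)
Lemma cvg_along_powers (sg : nat -> nat) (a l : R) (M : nat) : (0 < M)%N -> 0 <= a ->
  {homo sg : m n / (m <= n)%N} ->
  (sg (k.+1 ^ M)%N)%:R / (k.+1 ^ M)%:R `^ a @[k --> \oo] --> l ->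
  (sg n)%:R / n%:R `^ a @[n --> \oo] --> l.
Proof.
move=> M0 a0 sgm.
set y := fun k => (sg (k.+1 ^ M)%N)%:R / (k.+1 ^ M)%:R `^ a => yl.
have /choice[kap hk] : forall n, exists k, (0 < n)%N -> (k.+1 ^ M <= n < k.+2 ^ M)%N.
  move=> n; have [n0|n0] := ltnP 0 n; last by exists 0%N.
  by have [k hk] := power_bracket M0 n0; exists k.
have kap_oo : kap n @[n --> \oo] --> \oo.
  apply/cvgnyPge => A; near=> n.
  have n0 : (0 < n)%N by near: n; exact: nbhs_infty_gt.
  have nA : (A.+1 ^ M <= n)%N by near: n; exact: nbhs_infty_ge.
  have /andP[_ nk] := hk n n0.
  by have := leq_ltn_trans nA nk; rewrite ltn_exp2r// ltnS.
pose rho k : R := (k.+2%:R / k.+1%:R) `^ (M%:R * a).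
have rho1 : rho k @[k --> \oo] --> (1 : R).
  apply: cvg_powR_one; have := @cvg_shift_ratio R 2.
  by apply: cvg_eqfun => k; rewrite -natrD addn2.
have rho0 k : 0 < rho k by rewrite powR_gt0// divr_gt0.
have rhoE k : (k.+2 ^ M)%:R `^ a = rho k * (k.+1 ^ M)%:R `^ a.
  rewrite !natrX -!powR_mulrn// -!powRrM /rho -powRM ?divr_ge0//.
  by rewrite divfK// pnatr_eq0.
have low : y (kap n) / rho (kap n) @[n --> \oo] --> l.
  rewrite -[l]divr1; apply: cvgM; first exact: (cvg_comp _ _ kap_oo yl).
  apply: cvgV; first exact: oner_neq0.
  exact: (cvg_comp _ _ kap_oo rho1).
have up : y (kap n).+1 * rho (kap n) @[n --> \oo] --> l.
  rewrite -[l]mulr1; apply: cvgM.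
    have kS : (kap n).+1 @[n --> \oo] --> \oo.
      apply/cvgnyPge => A; move/cvgnyPge : kap_oo => /(_ A).
      by apply: filterS => n /leq_trans; apply.
    exact: (cvg_comp _ _ kS yl).
  exact: (cvg_comp _ _ kap_oo rho1).
apply: (squeeze_cvgr _ low up); near=> n.
have n0 : (0 < n)%N by near: n; exact: nbhs_infty_gt.
have /andP[kn nk] := hk n n0; set k := kap n in kn nk *.
have kM0 : 0 < (k.+1 ^ M)%:R :> R by rewrite ltr0n expn_gt0.
have kM2 : 0 < (k.+2 ^ M)%:R :> R by rewrite ltr0n expn_gt0.
have n0' : 0 < n%:R :> R by rewrite ltr0n.
apply/andP; split.
  rewrite /y -mulrA -invfM mulrC [_ * rho k]mulrC -rhoE mulrC.
  apply: ler_pM => //; rewrite ?invr_ge0 ?powR_ge0//.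
    by rewrite ler_nat sgm.
  rewrite lef_pV2 ?posrE ?powR_gt0//.
  by apply: ge0_ler_powR; rewrite ?nnegrE ?ler0n// ler_nat ltnW.
rewrite /y rhoE invfM mulrAC -!mulrA [rho k * _]mulrA divff ?gt_eqF// mul1r.
apply: ler_pM => //; rewrite ?invr_ge0 ?powR_ge0//.
  by rewrite ler_nat sgm// ltnW.
rewrite lef_pV2 ?posrE ?powR_gt0//.
by apply: ge0_ler_powR; rewrite ?nnegrE ?ler0n// ler_nat.
Unshelve. all: by end_near. Qed.

End MonotoneInterpolation.

(** * The number of ones *)

Section RisingBounds.
Context {R : realType}.
Implicit Types (x : R) (n : nat).

Lemma rising_prod_ge1 x n : 0 <= x -> 1 <= rising_prod x n.
Proof.
move=> x0; rewrite /rising_prod; elim/big_ind: _ => //; first by move=> u v; exact: mulr_ege1.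
by move=> j _; rewrite lerDl divr_ge0.
Qed.

(** Young's inequality with exponents [1 / x] and [1 / (1 - x)]; this is
    Bernoulli's inequality for an exponent below one. *)
Lemma powR_le_affine x (t : R) : 0 < x < 1 -> 0 <= t -> t `^ x <= 1 + x * (t - 1).
Proof.
move=> /andP[x0 x1] t0; have ix0 : 0 < x^-1 by rewrite invr_gt0.
have ix1 : 0 < (1 - x)^-1 by rewrite invr_gt0 subr_gt0.
have := @conjugate_powR R (t `^ x) 1 x^-1 (1 - x)^-1 (powR_ge0 _ _) ler01 ix0 ix1.
rewrite !invrK addrCA subrr addr0 => /(_ erefl).
by rewrite mulr1 -powRrM divff ?gt_eqF// powRr1// powR1 mul1r; lra.
Qed.

Lemma powR_le_rising_prod x n : 0 < x < 1 -> (0 < n)%N -> n%:R `^ x <= rising_prod x n.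
Proof.
move=> x01; case: n => // n _; elim: n => [|n IH]; first by rewrite powR1 /rising_prod big_geq.
rewrite rising_prodS//.
have -> : n.+2%:R = n.+1%:R * (1 + n.+1%:R^-1) :> R.
  by rewrite mulrDr mulr1 divff ?natr1// pnatr_eq0.
have t0 : 0 <= 1 + n.+1%:R^-1 :> R by rewrite addr_ge0 ?invr_ge0.
rewrite powRM// ler_pM ?powR_ge0//.
by apply: le_trans (powR_le_affine x01 t0) _; rewrite addrAC subrr add0r.
Qed.

Lemma cvg_powR_nat x : 0 < x -> (n.+1%:R `^ x : R) @[n --> \oo] --> +oo.
Proof.
move=> x0; apply/cvgryPge => A.
have /cvgryPge/(_ (A / x)) := @cvg_ln_nat R.
apply: filterS => n; rewrite ler_pdivrMr// mulrC => h.
rewrite /powR pnatr_eq0; apply: le_trans h _.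
by apply: le_trans (expR_ge1Dx _); rewrite lerDr.
Qed.

End RisingBounds.

Section NumberOfOnes.
Context d (T : measurableType d) (R : realType) (P : probability T R).
Variables (p q r s a : R).
Hypotheses (a01 : 0 < a < 1) (pE : p = 3 / 4 * a) (qE : q = a / 4) (rE : r = 1 - a).
Hypothesis s01 : 0 <= s <= 1.
Variable (X : nat -> {RV P >-> R}).
Hypothesis (hX : is_ERWS P p q r s X).
Local Notation EE := (Rintegral P setT).
Implicit Types (n : nat) (w : T).

Let a0 : 0 < a. Proof. by case/andP: a01. Qed.
Let a1 : a < 1. Proof. by case/andP: a01. Qed.
Let pqr : p + q + r = 1. Proof. by rewrite pE qE rE; field. Qed.

Definition ones n w : nat := (visits X 1 n w + visits X (-1) n w)%N.
(** The position of the walk, up to a null event; unlike the sum of the steps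
    it is a function of two counts everywhere. *)
Definition walk n w : R := (visits X 1 n w)%:R - (visits X (-1) n w)%:R.

Lemma walk_bm (h : nat -> R -> R) n : bounded_meas (fun w => h (ones n w) (walk n w)).
Proof. exact: (observable_bm X (fun i j => h (i + j)%N (i%:R - j%:R)) n). Qed.

Lemma ones_bm (f : nat -> R) n : bounded_meas (fun w => f (ones n w)).
Proof. exact: (walk_bm (fun m _ => f m)). Qed.

(** With [m] ones so far, the next step is nonzero with probability
    [a * m / n], and given that it is nonzero it follows the transition [erw_step]
    of the critical walk without stops. This is where the critical ratio
    [p / (1 - r) = 3 / 4] enters. *)
Lemma walk_step (h : nat -> R -> R) n : (0 < n)%N ->
  EE (fun w => h (ones n.+1 w) (walk n.+1 w)) =
  EE (fun w => h (ones n w) (walk n w) + a * (ones n w)%:R / n%:R *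
    (erw_step (ones n w) (h (ones n w).+1) (walk n w) - h (ones n w) (walk n w))).
Proof.
move=> n0.
have := observable_step pqr hX (fun i j => h (i + j)%N (i%:R - j%:R)) n0.
rewrite /observable -/(ones _ _) -/(walk _ _) => ->.
apply: eq_Rintegral => w _; rewrite /ones /walk; move: (visits _ _ _ _) (visits _ _ _ _) => j i.
rewrite addSn addnS -!natr1 (_ : i%:R + 1 - j%:R = i%:R - j%:R + 1 :> R); last ring.
rewrite (_ : i%:R - (j%:R + 1) = i%:R - j%:R - 1 :> R); last ring.
rewrite /erw_step pE qE natrD.
have [/eqP|ij] := posnP (i + j)%N.
  by rewrite addn_eq0 => /andP[/eqP-> /eqP->]; rewrite !(mulr0, addr0, mul0r).
have nN0 : n%:R != 0 :> R by rewrite pnatr_eq0 -lt0n.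
have mN0 : i%:R + j%:R != 0 :> R by rewrite -natrD pnatr_eq0 -lt0n.
by field; rewrite ?nN0 ?mN0.
Qed.

Lemma ones_step (f : nat -> R) n : (0 < n)%N ->
  EE (fun w => f (ones n.+1 w)) =
  EE (fun w => f (ones n w) + a * (ones n w)%:R / n%:R * (f (ones n w).+1 - f (ones n w))).
Proof.
move=> n0; rewrite (walk_step (fun m _ => f m) n0); apply: eq_Rintegral => w _.
by congr (_ + _ * (_ - _)); rewrite /erw_step; set u := walk n w / _; field.
Qed.

Lemma ones1_ae : {ae P, forall w, ones 1 w = 1%N /\ walk 1 w = X 1%N w}.
Proof.
apply: filterS (first_step_ae hX) => w; rewrite /ones /walk /visits !big_nat1.
by rewrite !inE => /orP[] /eqP ->; rewrite eqxx ?oppr1_neq1 ?oner_neqN1 ?subr0 ?sub0r.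
Qed.

(** Conditionally on the number of ones, the position is distributed as the
    critical elephant random walk without stops after that number of steps: the
    number of ones is a Markov chain by itself, and by [walk_step] the position
    moves by one step of that walk exactly when this chain moves. *)
Lemma walk_law (h : nat -> R -> R) n : (0 < n)%N ->
  EE (fun w => h (ones n w) (walk n w)) =
  EE (fun w => erw_mean s (ones n w).-1 (h (ones n w))).
Proof.
case: n => // n _; elim: n h => [|n IH] h.
  have [E1 Em] := first_step_law hX.
  transitivity (EE (fun w => h 1%N 1 * (X 1%N w == 1)%:R + h 1%N (-1) * (X 1%N w == -1)%:R)).
    apply: E_ae; [exact: walk_bm|by apply: bmD; apply: bmZ; exact: step_bm|].
    apply: filterS2 ones1_ae (first_step_ae hX) => w [-> ->]; rewrite !inE.
    case/orP => /eqP->; rewrite eqxx ?oppr1_neq1 ?oner_neqN1;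
    by rewrite ?mulr0 ?mulr1 ?addr0 ?add0r.
  rewrite ED ?EZ ?E1 ?Em; try exact: step_bm; try by apply: bmZ; exact: step_bm.
  rewrite -[LHS](Rintegral_prob_cst P); apply: E_ae; first exact: bm_cst.
    exact: (ones_bm (fun m => erw_mean s m.-1 (h m))).
  by apply: filterS ones1_ae => w [-> _] /=; ring.
rewrite walk_step//.
rewrite (IH (fun m x => h m x + a * m%:R / n.+1%:R * (erw_step m (h m.+1) x - h m x))).
rewrite (ones_step (fun m => erw_mean s m.-1 (h m)))//.
apply: eq_Rintegral => w _; move: (ones n.+1 w) => m.
have E c f g : erw_mean s m.-1 (fun x => f x + c * (g x - f x)) =
    erw_mean s m.-1 f + c * (erw_mean s m.-1 g - erw_mean s m.-1 f).
  rewrite (_ : (fun x => _) = (fun x => (1 - c) * f x + c * g x)).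
    by rewrite ew_lin; ring.
  by apply/funext => x; ring.
rewrite E; have [->|m0] := posnP m; first by rewrite mulr0 !mul0r.
by case: m m0 E => // m _ _.
Qed.

Definition rising_fact (k m : nat) : R := \prod_(i < k) (m + i)%:R.

Lemma rising_fact_ge0 k m : 0 <= rising_fact k m.
Proof. exact: prodr_ge0. Qed.

Lemma rising_fact_shift k m : m%:R * rising_fact k m.+1 = (m + k)%:R * rising_fact k m.
Proof.
elim: k => [|k IH]; first by rewrite /rising_fact !big_ord0 addn0.
rewrite /rising_fact !big_ord_recr/= -!/(rising_fact _ _) mulrA IH.
by rewrite addSnnS -!mulrA [X in _ * X = _]mulrC; ring.
Qed.

Lemma rising_fact1 k : rising_fact k 1 = k`!%:R.
Proof.
elim: k => [|k IH]; first by rewrite /rising_fact big_ord0.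
by rewrite /rising_fact big_ord_recr/= -/(rising_fact k 1) IH add1n factS natrM mulrC.
Qed.

(** The rising factorials are eigenfunctions of the transition of the number
    of ones: going from [m] to [m.+1] multiplies them by [(m + k) / m], which
    happens with probability [a * m / n], so that the mean is multiplied by
    [1 + k * a / n]. *)
Lemma mean_rising_fact k n : (0 < n)%N ->
  EE (fun w => rising_fact k (ones n w)) = k`!%:R * rising_prod (k%:R * a) n.
Proof.
case: n => // n _; elim: n => [|n IH].
  rewrite /rising_prod big_geq// mulr1 -[RHS](Rintegral_prob_cst P).
  apply: E_ae; [exact: ones_bm|exact: bm_cst|].
  by apply: filterS ones1_ae => w [-> _]; exact: rising_fact1.
rewrite ones_step// rising_prodS// mulrA -IH.
rewrite mulrC -EZ; last exact: ones_bm.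
apply: eq_Rintegral => w _; set m := ones n.+1 w.
have -> : a * m%:R / n.+1%:R * (rising_fact k m.+1 - rising_fact k m) =
    a / n.+1%:R * (m%:R * rising_fact k m.+1 - m%:R * rising_fact k m) by ring.
rewrite rising_fact_shift natrD; ring.
Qed.

Lemma mean_ones n : (0 < n)%N -> EE (fun w => (ones n w)%:R) = rising_prod a n.
Proof.
move=> n0; have := mean_rising_fact 1 n0; rewrite !mul1r => <-.
by apply: eq_Rintegral => w _; rewrite /rising_fact big_ord1 addn0.
Qed.

Lemma mean_ones_sqr n : (0 < n)%N ->
  EE (fun w => (ones n w)%:R ^+ 2) = 2 * rising_prod (2 * a) n - rising_prod a n.
Proof.
move=> n0; have := mean_rising_fact 2 n0; rewrite -(mean_ones n0) => /= <-.
rewrite -EB; [|exact: ones_bm|exact: (ones_bm (fun m => m%:R))].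
apply: eq_Rintegral => w _; rewrite /rising_fact big_ord_recr big_ord1/= addn0 addn1 -natr1.
by ring.
Qed.

Lemma ones_past_weight N n : (0 < N)%N -> (n <= N)%N ->
  past_weight p q X N (fun w => (ones n w)%:R).
Proof.
move=> N0 nN.
have vp (y : R) : past_weight p q X N (fun w => (visits X y n w)%:R).
  rewrite (_ : (fun w => _) =
      (fun w => \sum_(i < n.+1) i%:R * (visits X y n w == i)%:R)); last first.
    apply/funext => w; have vn : (visits X y n w < n.+1)%N by rewrite ltnS visits_le.
    rewrite (bigD1 (Ordinal vn))//= eqxx mulr1 big1 ?addr0// => i ni.
    rewrite [_ == _ :> nat](_ : _ = false) ?mulr0//.
    by apply/negbTE; apply: contra ni => /eqP E; apply/eqP/val_inj.
  apply: (past_weight_sum pqr hX) => // i; apply: past_weightZ.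
  by apply: (past_event_weight pqr hX) => //; exact: past_visits.
have := past_weight_lin 1 1 (vp 1) (vp (-1)).
by congr past_weight; apply/funext => w; rewrite /ones natrD !mul1r.
Qed.

(** The ratio [ones n / rising_prod a n] is a martingale, so that the
    conditional mean of [ones (n + m)] given the past of [n] is proportional to
    [ones n]. *)
Lemma ones_cross n m : (0 < n)%N ->
  EE (fun w => (ones n w)%:R * (ones (n + m) w)%:R) =
  EE (fun w => (ones n w)%:R ^+ 2) * (rising_prod a (n + m) / rising_prod a n).
Proof.
move=> n0; have b0 k : rising_prod a k != 0.
  by rewrite gt_eqF// (lt_le_trans ltr01)// rising_prod_ge1// ltW.
elim: m => [|m IH].
  by rewrite addn0 divff// mulr1; apply: eq_Rintegral => w _; rewrite expr2.
rewrite addnS; set N := (n + m)%N in IH *.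
have N0 : (0 < N)%N by rewrite addn_gt0 n0.
have [bG [e1 e2]] := ones_past_weight N0 (leq_addr m n).
have bN : bounded_meas (fun w => (ones N w)%:R : R) by exact: ones_bm.
have bGX (y : R) : bounded_meas (fun w => (ones n w)%:R * (X N.+1 w == y)%:R : R).
  by apply: bmM => //; exact: step_bm.
have bGd (u v : R) : bounded_meas (fun w => (ones n w)%:R *
   ((p * (visits X u N w)%:R + q * (visits X v N w)%:R) / N%:R)).
  by apply: bmM => //; exact: drift_bm.
transitivity (EE (fun w => (ones n w)%:R * (ones N w)%:R + (ones n w)%:R * (X N.+1 w == 1)%:R
   + (ones n w)%:R * (X N.+1 w == -1)%:R)).
  by apply: eq_Rintegral => w _; rewrite /ones !visitsS !natrD; ring.
have bGN := bmM bG bN.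
rewrite (ED P (bmD bGN (bGX 1)) (bGX (-1))) (ED P bGN (bGX 1)) e1 e2.
rewrite -(ED P bGN (bGd 1 (-1))) -(ED P (bmD bGN (bGd 1 (-1))) (bGd (-1) 1)).
transitivity (EE (fun w => (1 + a / N%:R) * ((ones n w)%:R * (ones N w)%:R))).
  apply: eq_Rintegral => w _; move: ((ones n w)%:R : R) => G.
  by rewrite /ones natrD pE qE; field; rewrite pnatr_eq0 -lt0n.
rewrite EZ// IH rising_prodS//.
by field; rewrite b0 pnatr_eq0 -lt0n N0.
Qed.

(** Increments of a martingale are orthogonal to its past, so the left-hand
    side is a difference of second moments. The second moment of
    [ones n / rising_prod a n] is [2 * g n - 1 / rising_prod a n] with [g] the
    quotient of [rising_prod (2 * a)] by [rising_prod a ^+ 2], which is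
    nonincreasing. *)
Lemma ones_L2_increment n N : (0 < n)%N -> (n <= N)%N ->
  EE (fun w => ((ones N w)%:R / rising_prod a N - (ones n w)%:R / rising_prod a n) ^+ 2)
  <= (rising_prod a n)^-1.
Proof.
move=> n0 nN; have N0 : (0 < N)%N by apply: leq_trans nN.
set bN := rising_prod a N; set bn := rising_prod a n.
have bN0 : 0 < bN by rewrite (lt_le_trans ltr01)// rising_prod_ge1// ltW.
have bn0 : 0 < bn by rewrite (lt_le_trans ltr01)// rising_prod_ge1// ltW.
have b1 k : bounded_meas (fun w => (ones k w)%:R ^+ 2 : R) by exact: (ones_bm (fun m => m%:R ^+ 2)).
have bo k : bounded_meas (fun w => (ones k w)%:R : R) by exact: (ones_bm (fun m => m%:R)).
have bx : bounded_meas (fun w => (ones n w)%:R * (ones N w)%:R : R) by exact: bmM.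
rewrite (_ : EE _ = EE (fun w => (bN ^+ 2)^-1 * (ones N w)%:R ^+ 2 + (bn ^+ 2)^-1 * (ones n w)%:R ^+ 2
   - 2 / (bN * bn) * ((ones n w)%:R * (ones N w)%:R))); last first.
  by apply: eq_Rintegral => w _; field; rewrite !gt_eqF.
rewrite EB ?ED ?EZ; try by []; try exact: bmZ; last by apply: bmD; exact: bmZ.
have := ones_cross (N - n) n0; rewrite subnKC// => ->.
rewrite !mean_ones_sqr// -/bN -/bn.
pose g k := rising_prod (2 * a) k / rising_prod a k ^+ 2.
have gdec : g N <= g n.
  rewrite -(subnKC nN); elim: (N - n)%N => [|m]; first by rewrite addn0.
  apply: le_trans; rewrite addnS /g !rising_prodS ?addn_gt0 ?n0//.
  set k := (n + m)%N; have k0 : 0 < k%:R :> R by rewrite ltr0n addn_gt0 n0.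
  have A0 : 0 < rising_prod a k by rewrite (lt_le_trans ltr01)// rising_prod_ge1// ltW.
  have B0 : 0 <= rising_prod (2 * a) k by rewrite (le_trans ler01)// rising_prod_ge1// mulr_ge0// ltW.
  have c0 : 0 < 1 + a / k%:R by rewrite addr_gt0// divr_gt0.
  rewrite exprMn invfM mulrACA ler_piMr//; first by rewrite divr_ge0// exprn_ge0// ltW.
  rewrite ler_pdivrMr ?exprn_gt0// mul1r sqrrD expr1n mul1r.
  have -> : a / k%:R *+ 2 = 2 * a / k%:R by rewrite -mulr_natl mulrA.
  by rewrite lerDl sqr_ge0.
rewrite [X in X <= _](_ : _ = 2 * g N - bN^-1 - 2 * g n + bn^-1); last first.
  by rewrite /g -/bN -/bn; field; rewrite !gt_eqF.
have : 0 <= bN^-1 by rewrite invr_ge0 ltW.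
lra.
Qed.

(** From [ones_L2_increment] by the inequality [2 * e * `|D| <= e ^+ 2 + D ^+ 2]. *)
Lemma ones_subsequence_L1 n N (e : R) : (0 < n)%N -> (n <= N)%N -> 0 < e ->
  1 <= e ^+ 2 * n%:R `^ a ->
  EE (fun w => `|(ones N w)%:R / rising_prod a N - (ones n w)%:R / rising_prod a n|) <= e.
Proof.
move=> n0 nN e0 en; set D := fun w => (ones N w)%:R / rising_prod a N - (ones n w)%:R / rising_prod a n.
have bD : bounded_meas D.
  by apply: bmB; apply: bmM; try exact: bm_cst; exact: (ones_bm (fun m => m%:R)).
have bD2 : bounded_meas (fun w => D w ^+ 2) by under eq_fun do rewrite expr2; exact: bmM.
have bAD : bounded_meas (fun w => `|D w|).
  split; first by apply: measurableT_comp => //; case: bD.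
  by case: bD => _ [C DC]; exists C => w; rewrite normr_id.
apply: (@le_trans _ _ (EE (fun w => e / 2 + (2 * e)^-1 * D w ^+ 2))).
  apply: E_le => //; first by apply: bmD; [exact: bm_cst|exact: bmZ].
  move=> w; rewrite -(ler_pM2l (x := 2 * e)) ?mulr_gt0//.
  rewrite -/(D w) mulrDr [X in _ <= _ + X]mulrA divff ?gt_eqF ?mulr_gt0// mul1r.
  rewrite (_ : 2 * e * (e / 2) = e ^+ 2); last by field.
  by have := sqr_ge0 (e - `|D w|); rewrite sqrrB real_normK ?num_real//; lra.
rewrite (ED P (bm_cst _) (bmZ _ bD2)) Rintegral_prob_cst EZ//.
have h := ones_L2_increment n0 nN; rewrite -/(D _) in h.
have nb := powR_le_rising_prod a01 n0.
have na0 : 0 < n%:R `^ a :> R by rewrite powR_gt0// ltr0n.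
have h2 : EE (fun w => D w ^+ 2) <= e ^+ 2.
  apply: le_trans h _; apply: (@le_trans _ _ (n%:R `^ a)^-1).
    by rewrite lef_pV2 ?posrE// (lt_le_trans na0).
  by rewrite -[X in X <= _]mul1r ler_pdivrMr.
have e20 : 0 <= (2 * e)^-1 by rewrite invr_ge0 mulr_ge0 ?ltW.
apply: le_trans (lerD (lexx _) (ler_wpM2l e20 h2)) _.
by rewrite le_eqVlt; apply/orP; left; apply/eqP; field; rewrite gt_eqF.
Qed.

Lemma ones_mono w : {homo (fun n => ones n w) : m n / (m <= n)%N}.
Proof.
apply: homo_leq => [//|y x z|n]; first exact: leq_trans.
by rewrite /ones !visitsS leq_add// leq_addr.
Qed.

(** Along the subsequence of [M]-th powers the increments of the martingale
    have summable means, by [ones_subsequence_L1] with [a * M >= 4]; hence they are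
    almost surely summable and the martingale converges along it. Monotonicity of
    the number of ones fills in the missing indices. *)
Lemma ones_scaled_cvg_ae : {ae P, forall w, exists l : R,
  (ones n w)%:R / n%:R `^ a @[n --> \oo] --> l}.
Proof.
(* With [a * M >= 4] the inverse square root of [(k ^ M) `^ a] is summable. *)
pose M := (Num.truncn (4 / a)).+1.
have Ma : 4 <= a * M%:R.
  by rewrite -ler_pdivrMl// mulrC ltW// truncnS_gt.
pose nk k := (k.+1 ^ M)%N.
have nk0 k : (0 < nk k)%N by rewrite expn_gt0.
pose Z k w : R := (ones (nk k) w)%:R / rising_prod a (nk k).
pose D k w : R := Z k.+1 w - Z k w.
have bZ k : bounded_meas (Z k).
  by apply: bmM; [exact: (ones_bm (fun m => m%:R))|exact: bm_cst].
have bD k : bounded_meas (D k) by exact: bmB.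
have mD k : measurable_fun setT (D k) by case: (bD k).
have ED1 k : EE (fun w => `|D k w|) <= (k.+1%:R ^+ 2)^-1.
  apply: ones_subsequence_L1 => //.
  - by rewrite leq_exp2r.
  - have -> : (nk k)%:R `^ a = k.+1%:R `^ (a * M%:R) :> R.
      by rewrite /nk natrX -powR_mulrn// -powRrM mulrC.
    rewrite mulrC exprVn -exprM ler_pdivlMr ?exprn_gt0// mul1r.
    by rewrite -powR_mulrn// ler_powR// ler1n.
have sumD n : \sum_(k < n) (k.+1%:R ^+ 2)^-1 <= 3 - 2 * n.+1%:R^-1 :> R.
  elim: n => [|n IH]; first by rewrite big_ord0 invr1; lra.
  rewrite big_ord_recr/=; apply: le_trans (lerD IH (lexx _)) _.
  have u1 : 1 <= n.+1%:R :> R by rewrite ler1n.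
  rewrite -[n.+2%:R]natr1; move: (n.+1%:R) u1 => u u1.
  have u0 : 0 < u by exact: lt_le_trans u1.
  have v0 : 0 < u + 1 by rewrite addr_gt0.
  rewrite -subr_ge0 (_ : _ - _ = (u - 1) / (u ^+ 2 * (u + 1))); last first.
    by field; rewrite !gt_eqF.
  by rewrite divr_ge0 ?subr_ge0// mulr_ge0 ?exprn_ge0 ?ltW.
have mF k : measurable_fun setT (fun w => `|(D k w)%:E|%E).
  by apply: measurableT_comp => //; exact/measurable_EFinP.
have intF : (\int[P]_w (\sum_(k <oo) `|(D k w)%:E|)%E <= 3%:E)%E.
  rewrite integral_nneseries//.
  apply: lime_le; first by apply: is_cvg_nneseries => k _ _; exact: integral_ge0.
  apply: nearW => n.
  apply: (@le_trans _ _ (\sum_(0 <= k < n) ((k.+1%:R ^+ 2)^-1 : R)%:E)%E).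
    apply: lee_sum => k _; rewrite -(@fineK _ (\int[P]_w _)%E).
      by rewrite lee_fin; exact: ED1.
    have : P.-integrable setT (EFin \o (fun w => `|D k w|)).
      by have /integrable_norm := bm_integrable P (bD k).
    exact: integrable_fin_num.
  rewrite sumEFin lee_fin big_mkord; apply: le_trans (sumD n) _.
  by rewrite gerBl mulr_ge0// invr_ge0.
have iF : P.-integrable setT (fun w => (\sum_(k <oo) `|(D k w)%:E|)%E).
  apply/integrableP; split; first exact: ge0_emeasurable_sum.
  under eq_integral do rewrite gee0_abs ?nneseries_ge0//.
  exact: le_lt_trans intF (ltry _).
have := integrable_ae measurableT iF; apply: filterS => w /(_ Logic.I) finw.
have nD : cvgn (series (fun k => `|D k w|)).
  apply: nondecreasing_is_cvgn.
    by apply/nondecreasing_seqP => n; rewrite /series/= big_nat_recr//= lerDl normr_ge0.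
  exists (fine (\sum_(k <oo) `|(D k w)%:E|)%E) => _ [n _ <-].
  rewrite -lee_fin fineK// /series/= -sumEFin.
  exact: nneseries_lim_ge.
have /cvg_ex[l0 Dl0] : cvgn (series (D ^~ w)) by exact: normed_cvg.
have Zl : Z k w @[k --> \oo] --> l0 + Z 0 w.
  have Z0 : (fun=> Z 0 w) n @[n --> \oo] --> Z 0 w by exact: cvg_cst.
  apply: cvg_eqfun (cvg_addr Dl0 Z0) => k.
  by rewrite /series/= (telescope_sumr (fun i => Z i w)) ?subrK.
exists ((l0 + Z 0 w) * (Gamma (1 + a))^-1).
apply: (@cvg_along_powers R (fun n => ones n w) a _ M) => //; [exact: ltW|exact: ones_mono|].
have nkoo : (nk k).-1 @[k --> \oo] --> \oo.
  apply/cvgnyPge => A; exists A.+1 => // k /= Ak; rewrite -ltnS prednK//.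
  apply: leq_trans Ak _; apply: (@leq_trans k.+1) => //.
  by rewrite /nk expnS leq_pmulr// expn_gt0.
have g : rising_prod a (nk k) / (nk k)%:R `^ a @[k --> \oo] --> (Gamma (1 + a))^-1.
  have h := cvg_comp _ _ nkoo (rising_prod_cvg (ltW a0)).
  by apply: (cvg_eqfun _ h) => k /=; rewrite prednK.
have h : Z k w * (rising_prod a (nk k) / (nk k)%:R `^ a) @[k --> \oo] -->
    (l0 + Z 0 w) * (Gamma (1 + a))^-1 by exact: cvgM.
apply: (cvg_eqfun _ h) => k; rewrite /Z /=; field.
have -> : rising_prod a (nk k) != 0.
  by rewrite gt_eqF// (lt_le_trans ltr01)// rising_prod_ge1// ltW.
by rewrite andbT gt_eqF// powR_gt0// ltr0n.
Qed.

(** The mean of the inverse is multiplied by at most [1 - y] with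
    [y = a / (2 * n)], since [m / (m + 1) >= 1 / 2] bounds the expected decrease,
    and [(1 - y) * (1 + y) <= 1]. *)
Lemma mean_inv_ones n : EE (fun w => (ones n.+1 w)%:R^-1) <= (rising_prod (a / 2) n.+1)^-1.
Proof.
have bi m : bounded_meas (fun w => (ones m w)%:R^-1 : R) by exact: (ones_bm (fun m => m%:R^-1)).
elim: n => [|n IH].
  rewrite /rising_prod big_geq// invr1 -[X in _ <= X](Rintegral_prob_cst P).
  rewrite le_eqVlt; apply/orP; left; apply/eqP; apply: E_ae => //; first exact: bm_cst.
  by apply: filterS ones1_ae => w [-> _]; rewrite invr1.
rewrite (ones_step (fun m => m%:R^-1))// rising_prodS//.
set y := a / 2 / n.+1%:R.
have y0 : 0 <= y by rewrite !divr_ge0// ltW.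
have y1 : y <= 1.
  rewrite ler_pdivrMr// mul1r; apply: (@le_trans _ _ 1); last by rewrite ler1n.
  by rewrite ler_pdivrMr// mul1r (le_trans (ltW a1))// ler1n.
apply: (@le_trans _ _ ((1 - y) * EE (fun w => (ones n.+1 w)%:R^-1))).
  rewrite -EZ//; apply: E_le.
  - exact: (ones_bm (fun m => m%:R^-1 + a * m%:R / n.+1%:R * (m.+1%:R^-1 - m%:R^-1))).
  - exact: bmZ.
  move=> w; case: (ones n.+1 w) => [|m].
    by rewrite mulr0 !mul0r addr0 invr0 mulr0.
  have m0 : 0 < m.+1%:R :> R by [].
  have n0 : 0 < n.+1%:R :> R by [].
  have m1 : 1 <= m.+1%:R :> R by rewrite ler1n.
  rewrite /y -[m.+2%:R]natr1; move: (m.+1%:R) (n.+1%:R) m0 n0 m1 => u v u0 v0 u1.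
  rewrite -subr_ge0 (_ : _ - _ = a * (u - 1) / (2 * v * u * (u + 1))); last first.
    by field; rewrite !gt_eqF// addr_gt0.
  by rewrite divr_ge0 ?mulr_ge0 ?subr_ge0 ?addr_ge0// ?(ltW a0) ?(ltW u0) ?(ltW v0).
have R0 : 0 < rising_prod (a / 2) n.+1.
  by rewrite (lt_le_trans ltr01)// rising_prod_ge1// divr_ge0// ltW.
apply: (@le_trans _ _ ((1 - y) * (rising_prod (a / 2) n.+1)^-1)).
  by rewrite ler_wpM2l// subr_ge0.
rewrite invfM mulrC ler_wpM2l ?invr_ge0 ?(ltW R0)//.
rewrite -[X in _ <= X]mul1r ler_pdivlMr; last by rewrite ltr_wpDr.
by rewrite (_ : _ * _ = 1 - y ^+ 2) ?gerBl ?sqr_ge0//; ring.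
Qed.

Lemma ones_gt0_ae : {ae P, forall w : T, forall n : nat, (0 < ones n.+1 w)%N}.
Proof.
apply: filterS ones1_ae => w [m1 _] n.
by apply: (@leq_trans (ones 1 w)); [rewrite m1|exact: ones_mono].
Qed.

(** If the number of ones were stuck below [m], its inverse would stay above
    [1 / m], while the mean of the inverse tends to zero. *)
Lemma ones_to_infinity_ae : {ae P, forall w, ones n w @[n --> \oo] --> \oo}.
Proof.
have a2 : 0 < a / 2 < 1 by apply/andP; split; rewrite ?divr_gt0// ltr_pdivrMr// mul1r (lt_trans a1)// ltr1n.
have a20 : 0 < a / 2 by case/andP: a2.
have inv0 : (n.+1%:R `^ (a / 2))^-1 @[n --> \oo] --> (0 : R).
  by apply/gtr0_cvgV0; [apply: nearW => n; rewrite powR_gt0|exact: cvg_powR_nat].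
have G0 n : EE (fun w => (ones n.+1 w)%:R^-1) <= (n.+1%:R `^ (a / 2))^-1.
  apply: le_trans (mean_inv_ones n) _; have h := powR_le_rising_prod a2 (ltn0Sn n).
  have p0 : 0 < n.+1%:R `^ (a / 2) :> R by rewrite powR_gt0.
  by rewrite lef_pV2 ?posrE// (lt_le_trans p0).
have bi m : bounded_meas (fun w => (ones m w)%:R^-1 : R) by exact: (ones_bm (fun m => m%:R^-1)).
(* The event that the number of ones never exceeds [m]. *)
pose stuck m w := `[< forall n : nat, (0 < ones n.+1 w <= m)%N >].
have mstuck m : measurable [set w | stuck m w].
  rewrite (_ : [set _ | _] = \bigcap_n [set w | (0 < ones n.+1 w <= m)%N]); last first.
    by apply/seteqP; split => w /=; [move=> /asboolP h n _; exact: h|move=> h; apply/asboolP => n; exact: h].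
  apply: bigcap_measurable => // n _.
  have [mf _] := ones_bm (fun k => (0 < k <= m)%N%:R) n.+1.
  have := mf measurableT [set 1] (measurable_set1 _).
  rewrite setTI; congr measurable; apply/seteqP; split => w /=; case: (_ && _) => //.
  by move=> /esym/eqP; rewrite oner_eq0.
have bs m : bounded_meas (fun w => (stuck m w)%:R : R) by exact: bm_bool.
have stuck0 m : {ae P, forall w, (stuck m w)%:R = 0 :> R}.
  apply: E_eq0_ae => //; apply/eqP; rewrite eq_le; apply/andP; split; last exact: Rintegral_ge0.
  have := cvg_mulrl m%:R inv0; rewrite mulr0 => h.
  apply: (ler_cvg_to (cvg_cst (EE (fun w => (stuck m w)%:R))) h); apply: nearW => n.
  apply: le_trans (ler_wpM2l (ler0n _ m) (G0 n)); rewrite -EZ//.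
  apply: E_le => //; first exact: bmZ.
  move=> w; rewrite /stuck; case: asboolP => [/(_ n)/andP[v0 om]|_]; last by rewrite mulr_ge0// invr_ge0.
  by rewrite ler_pdivlMr ?ltr0n// mul1r ler_nat.
have := ae_foralln stuck0; apply: filterS2 ones_gt0_ae => w o0 sw.
apply/cvgnyPge => m.
have : ~~ stuck m w by apply/negP => h; have := sw m; rewrite h => /eqP; rewrite oner_eq0.
move=> /asboolPn/existsNP[n /negP]; rewrite o0/= -ltnNge => mo.
exists n.+1 => // k /= nk; apply: ltnW; apply: leq_trans mo _; exact: ones_mono.
Qed.

End NumberOfOnes.

(** * Moments and the Mittag-Leffler law *)

Section MomentsMittagLeffler.
Context d (T : measurableType d) (R : realType) (P : probability T R).

Lemma measurable_sum_pow (Y : {RV P >-> R}) (c : nat -> R) N :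
  measurable_fun setT (fun w => \sum_(0 <= k < N) c k * Y w ^+ k).
Proof.
by apply: measurable_sum => k; apply: measurable_funM => //; exact: measurable_funX.
Qed.

(** The exponential series is integrated term by term. Dominated convergence
    applies because [expR (`|t| * Y)] is integrable, that is, because the series
    of [`|t| ^+ k / Gamma (1 + k * al)] converges; by [gammaI_ge] with [c] such that
    [c `^ al = 2 * `|t| + 1] it is dominated by a geometric series of ratio
    [1 / 2]. *)
Lemma moments_Mittag_Leffler (al : R) (Y : {RV P >-> R}) :
  0 < al <= 1 -> (forall w, 0 <= Y w) ->
  (forall k, P.-integrable setT (EFin \o (fun w => Y w ^+ k)) /\
     (\int[P]_w (Y w ^+ k))%R = k`!%:R / Gamma (1 + k%:R * al)) ->
  is_Mittag_Leffler P al Y.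
Proof.
move=> al01 Y0 mom; split => // t; have /andP[al0 _] := al01.
have ial k : 0 <= k%:R * al by rewrite mulr_ge0// ltW.
have G0 k : 0 < Gamma (1 + k%:R * al) by rewrite Gamma_gammaI gammaI_gt0.
have iP k c : P.-integrable setT (EFin \o (fun w => c * Y w ^+ k)).
  by apply: RintegrableZ => //; case: (mom k).
have EP k c : (\int[P]_w (c / k`!%:R * Y w ^+ k))%R = c / Gamma (1 + k%:R * al).
  rewrite RintegralZl//; case: (mom k) => // _ ->.
  by field; rewrite gt_eqF// pnatr_eq0 -lt0n fact_gt0.
pose c := (2 * `|t| + 1) `^ al^-1.
have t0 : 0 < 2 * `|t| + 1 by rewrite ltr_wpDl// mulr_ge0.
have bound k : `|t| ^+ k / Gamma (1 + k%:R * al) <= expR c * 2^-1 ^+ k.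
  have := gammaI_ge (ial k) (powR_ge0 _ _ : 0 <= c).
  rewrite {1}/c -powRrM mulrCA mulVf ?gt_eqF// mulr1 powR_mulrn ?(ltW t0)// -Gamma_gammaI => h.
  rewrite ler_pdivrMr//.
  have e0 : 0 <= expR c * 2^-1 ^+ k by rewrite mulr_ge0// ?expR_ge0// exprn_ge0// invr_ge0.
  apply: le_trans (ler_wpM2l e0 h).
  rewrite expRN [leRHS](_ : _ = 2^-1 ^+ k * (2 * `|t| + 1) ^+ k); last first.
    by field; rewrite gt_eqF ?expR_gt0.
  rewrite -exprMn lerXn2r ?nnegrE// ?mulr_ge0 ?invr_ge0 ?(ltW t0)//.
  by rewrite mulrDr mulrA mulVf// mul1r lerDl mulr1 invr_ge0.
have geom n : \sum_(0 <= k < n) 2^-1 ^+ k <= 2 :> R.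
  suff -> : \sum_(0 <= k < n) 2^-1 ^+ k = 2 - 2 * 2^-1 ^+ n :> R.
    by rewrite gerBl mulr_ge0// exprn_ge0// invr_ge0.
  elim: n => [|n IH]; first by rewrite big_geq// expr0 mulr1 subrr.
  by rewrite big_nat_recr//= IH exprS; field.
pose dom w := expR (`|t| * Y w).
have mdom : measurable_fun setT dom.
  apply: measurableT_comp; first exact: measurable_expR.
  exact: measurable_funM.
have series_exp (u : R) : (\sum_(0 <= k < n) (u ^+ k / k`!%:R)) @[n --> \oo] --> expR u.
  exact: is_cvg_series_exp_coeff.
have idom : P.-integrable setT (EFin \o dom).
  apply/integrableP; split; first exact/measurable_EFinP.
  apply: (@le_lt_trans _ _ (expR c * 2)%:E); last exact: ltry.
  have -> : (\int[P]_w `|(EFin \o dom) w| =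
      \int[P]_w (\sum_(k <oo) (`|t| ^+ k / k`!%:R * Y w ^+ k)%:E))%E.
    apply: eq_integral => w _; rewrite gee0_abs ?lee_fin ?expR_ge0//.
    apply/esym/cvg_lim => //=.
    have h : (\sum_(0 <= k < n) ((`|t| * Y w) ^+ k / k`!%:R))%:E @[n --> \oo] --> (dom w)%:E.
      by apply/cvg_EFin; [exact: nearW|exact: series_exp].
    apply: cvg_trans h; apply: near_eq_cvg; apply: nearW => n.
    by rewrite -sumEFin; apply: eq_bigr => k _; rewrite exprMn mulrAC.
  rewrite integral_nneseries//; last 2 first.
  - by move=> k; apply/measurable_EFinP; apply: measurable_funM => //; exact: measurable_funX.
  - by move=> k w _; rewrite lee_fin mulr_ge0 ?exprn_ge0// divr_ge0// exprn_ge0.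
  have nn k : (0 <= \int[P]_w (`|t| ^+ k / k`!%:R * Y w ^+ k)%:E)%E.
    by apply: integral_ge0 => w _; rewrite lee_fin mulr_ge0 ?exprn_ge0// divr_ge0// exprn_ge0.
  apply: lime_le; first by apply: is_cvg_nneseries => k _ _; exact: nn.
  apply: nearW => n.
  apply: (@le_trans _ _ (\sum_(0 <= k < n) (expR c * 2^-1 ^+ k)%:E)%E).
    apply: lee_sum => k _; rewrite -[X in (X <= _)%E]fineK; last first.
      by apply: integrable_fin_num => //; exact: iP.
    by rewrite lee_fin -/(Rintegral P setT (fun w => `|t| ^+ k / k`!%:R * Y w ^+ k)) EP.
  by rewrite sumEFin lee_fin -mulr_sumr ler_wpM2l ?expR_ge0.
have isum n : P.-integrable setT (EFin \o (fun w => \sum_(0 <= k < n) (t ^+ k / k`!%:R) * Y w ^+ k)).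
  elim: n => [|n IH].
    by under eq_fun do rewrite big_geq//; apply: (@integrable_bounded _ _ _ _ _ 0) => // w; rewrite normr0.
  have := RintegrableD measurableT IH (iP n (t ^+ n / n`!%:R)).
  by congr integrable; apply/funext => w /=; rewrite big_nat_recr.
have Esum' n : (\int[P]_w (\sum_(0 <= k < n) (t ^+ k / k`!%:R) * Y w ^+ k))%R =
    \sum_(0 <= k < n) t ^+ k / Gamma (1 + k%:R * al).
  elim: n => [|n IH].
    by rewrite big_geq//; under eq_Rintegral do rewrite big_geq//; rewrite Rintegral_prob_cst.
  rewrite big_nat_recr//= -IH -(EP n) -RintegralD//.
  by apply: eq_Rintegral => w _; rewrite big_nat_recr.
have cvgE : (\int[P]_w (\sum_(0 <= k < n) (t ^+ k / k`!%:R) * Y w ^+ k))%R @[n --> \oo] -->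
    (\int[P]_w expR (t * Y w))%R.
  apply: (@Rintegral_dominated_cvg _ _ _ P setT _ _ dom) => //.
  - by move=> n; exact: measurable_sum_pow.
  - by apply: measurableT_comp; [exact: measurable_expR|exact: measurable_funM].
  - apply: aeW => w _; apply: cvg_eqfun (series_exp (t * Y w)) => n.
    by apply: eq_bigr => k _; rewrite exprMn mulrAC.
  - move=> n w _; apply: (@le_trans _ _ (\sum_(0 <= k < n) ((`|t| * Y w) ^+ k / k`!%:R))).
      apply: le_trans (ler_norm_sum _ _ _) _; apply: ler_sum => k _.
      by rewrite !normrM normrX normfV !normrX (ger0_norm (Y0 w)) exprMn mulrAC normr_nat.
    have ind : {homo (fun n => \sum_(0 <= k < n) ((`|t| * Y w) ^+ k / k`!%:R)) : n m / (n <= m)%N >-> n <= m}.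
      apply/nondecreasing_seqP => m; rewrite big_nat_recr//= lerDl divr_ge0// exprn_ge0// mulr_ge0//.
    apply: (ler_cvg_to (cvg_cst _) (series_exp (`|t| * Y w))).
    by exists n => // m /= nm; exact: ind.
have ifin : P.-integrable setT (EFin \o (fun w => expR (t * Y w))).
  apply: (le_integrable measurableT _ _ idom) => //.
    apply/measurable_EFinP; apply: measurableT_comp; first exact: measurable_expR.
    exact: measurable_funM.
  by move=> w _; rewrite /= lee_fin !ger0_norm ?expR_ge0// ler_expR ler_wpM2r// ler_norm.
have -> : ('M_P Y t = \int[P]_w (expR (t * Y w))%:E)%E.
  rewrite /mmt_gen_fun expectation.unlock; apply: eq_integral => w _.
  by rewrite /= mulrC.
rewrite -[X in _ --> X]fineK; last first.
  exact: (integrable_fin_num measurableT ifin).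
apply/cvg_EFin; first exact: nearW.
by apply: cvg_eqfun cvgE => n; rewrite Esum'.
Qed.

End MomentsMittagLeffler.

(** * The scaled limit of the number of ones *)

Section OnesLimit.
Context d (T : measurableType d) (R : realType) (P : probability T R).
Variables (p q r s a : R).
Hypotheses (a01 : 0 < a < 1) (pE : p = 3 / 4 * a) (qE : q = a / 4) (rE : r = 1 - a).
Variable (X : nat -> {RV P >-> R}).
Hypothesis (hX : is_ERWS P p q r s X).
Local Notation EE := (Rintegral P setT).
Implicit Types (n : nat) (w : T).

Let a0 : 0 < a. Proof. by case/andP: a01. Qed.

(** The upper limit is measurable without reference to a null event; taking its
    positive part makes the limit nonnegative everywhere. *)
Definition ones_limit w : R :=
  Num.max 0 (fine (limn_esup (fun n => ((ones X n w)%:R / n%:R `^ a)%:E))).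

Lemma ones_limit_ge0 w : 0 <= ones_limit w.
Proof. by rewrite /ones_limit le_max lexx. Qed.

Lemma measurable_ones_limit : measurable_fun setT ones_limit.
Proof.
apply: measurable_maxr => //; apply: measurableT_comp => //.
apply: measurable_fun_limn_esup => // n; apply/measurable_EFinP.
by have [] := ones_bm X (fun m => m%:R / n%:R `^ a) n.
Qed.

Lemma ones_limit_cvg_ae :
  {ae P, forall w, (ones X n w)%:R / n%:R `^ a @[n --> \oo] --> ones_limit w}.
Proof.
apply: filterS (ones_scaled_cvg_ae a01 pE qE rE hX) => w [l ul].
have eul : ((ones X n w)%:R / n%:R `^ a)%:E @[n --> \oo] --> l%:E.
  by apply/cvg_EFin; [exact: nearW|exact: ul].
have l0 : 0 <= l.
  by apply: (ler_cvg_to (cvg_cst 0) ul); apply: nearW => n; rewrite divr_ge0// powR_ge0.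
have [_ E] := cvg_limn_einf_sup eul.
by rewrite /ones_limit E /= max_r.
Qed.

Lemma rising_fact_sqr_le k m : rising_fact R k m ^+ 2 <= rising_fact R (k + k) m.
Proof.
rewrite /rising_fact big_split_ord/= expr2 ler_wpM2l ?prodr_ge0//.
by apply: ler_prod => i _; rewrite ler0n/= ler_nat leq_add2l leq_addl.
Qed.

Lemma rising_fact_scaled_cvg (o : nat -> nat) (l : R) k :
  (o n)%:R / n%:R `^ a @[n --> \oo] --> l ->
  rising_fact R k (o n.+1) / n.+1%:R `^ (k%:R * a) @[n --> \oo] --> l ^+ k.
Proof.
move=> ol; have ol1 : (o n.+1)%:R / n.+1%:R `^ a @[n --> \oo] --> l.
  by move: ol; rewrite -(cvg_shiftS (fun n => (o n)%:R / n%:R `^ a)).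
have inv0 : (n.+1%:R `^ a)^-1 @[n --> \oo] --> (0 : R).
  by apply/gtr0_cvgV0; [apply: nearW => n; rewrite powR_gt0|exact: cvg_powR_nat].
elim: k => [|k IH].
  apply: (cvg_eqfun _ (cvg_cst (1 : R))) => n.
  by rewrite /rising_fact big_ord0 mul0r powRr0 divr1.
have h1 := cvg_addr ol1 (cvg_mulrl k%:R inv0).
rewrite mulr0 addr0 in h1.
have h : rising_fact R k (o n.+1) / n.+1%:R `^ (k%:R * a) *
    ((o n.+1)%:R / n.+1%:R `^ a + k%:R * (n.+1%:R `^ a)^-1) @[n --> \oo] --> l ^+ k * l.
  exact: cvgM.
rewrite exprSr; apply: (cvg_eqfun _ h) => n.
rewrite /rising_fact big_ord_recr/= -/(rising_fact R k (o n.+1)).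
rewrite (_ : k.+1%:R * a = k%:R * a + a); last by rewrite -natr1 mulrDl mul1r.
rewrite natrD powRD ?pnatr_eq0 ?implybT//.
by field; rewrite !gt_eqF ?powR_gt0.
Qed.

(** The rising factorials of order [k], scaled by [n `^ (k * a)], converge almost
    surely to the [k]-th power of the limit. Their means are known exactly and
    converge by Gauss's formula, and their second moments are bounded by the means
    of the rising factorials of order [2 * k]. *)
Lemma moment_ones_limit k :
  P.-integrable setT (EFin \o (fun w => ones_limit w ^+ k)) /\
  EE (fun w => ones_limit w ^+ k) = k`!%:R / Gamma (1 + k%:R * a).
Proof.
pose Z k n w := rising_fact R k (ones X n.+1 w) / n.+1%:R `^ (k%:R * a).
have bZ j n : bounded_meas (Z j n).
  exact: (ones_bm X (fun m => rising_fact R j m / n.+1%:R `^ (j%:R * a)) n.+1).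
have EZc j : EE (Z j n) @[n --> \oo] --> j`!%:R / Gamma (1 + j%:R * a).
  have ja0 : 0 <= j%:R * a by rewrite mulr_ge0// ltW.
  apply: (cvg_eqfun _ (cvg_mulrl j`!%:R (rising_prod_cvg ja0))) => n.
  rewrite mulrA -(mean_rising_fact pE qE rE hX)// mulrC -EZ.
    by apply: eq_Rintegral => w _; rewrite mulrC.
  exact: (ones_bm X (rising_fact R j) n.+1).
have [C ZC] : exists C, forall n, EE (fun w => Z k n w ^+ 2) <= C.
  have /cvg_seq_bounded[C [_ hC]] : cvgn (fun n => EE (Z (k + k)%N n)).
    by apply/cvg_ex; eexists; exact: EZc.
  exists (C + 1) => n.
  have : `|EE (Z (k + k)%N n)| <= C + 1 by apply: hC => //; rewrite ltrDl.
  apply: le_trans; apply: le_trans (ler_norm _).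
  apply: E_le; [by under eq_fun do rewrite expr2; exact: bmM|exact: bZ|move=> w].
  rewrite /Z exprMn exprVn natrD mulrDl powRD ?pnatr_eq0 ?implybT//.
  by rewrite -expr2 ler_wpM2r ?rising_fact_sqr_le// invr_ge0 exprn_ge0// powR_ge0.
apply: (@Rintegral_cvg_bounded_square _ _ _ P (Z k) _ C) => //.
- by move=> n; case: (bZ k n).
- by apply: measurable_funX; exact: measurable_ones_limit.
- by move=> n w; rewrite divr_ge0 ?rising_fact_ge0// powR_ge0.
- by move=> w; rewrite exprn_ge0// ones_limit_ge0.
- by move=> n; exact: bm_integrable.
- by move=> n; apply: bm_integrable; under eq_fun do rewrite expr2; exact: bmM.
- apply: filterS ones_limit_cvg_ae => w h.
  exact: (rising_fact_scaled_cvg h).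
Qed.

End OnesLimit.

(** * Product spaces and convergence in distribution *)

Section ProductProbability.
Context d1 d2 (T1 : measurableType d1) (T2 : measurableType d2) (R : realType).
Context (P : probability T1 R) (Q : probability T2 R).

Lemma Rintegral_prod (h : T1 * T2 -> R) (C : R) :
  measurable_fun setT h -> (forall z, `|h z| <= C) ->
  (\int[(P \x Q)%E]_z h z)%R = (\int[P]_x (\int[Q]_y h (x, y))%R)%R.
Proof.
move=> mh hC; have ih : (P \x Q)%E.-integrable setT (EFin \o h).
  exact: (@integrable_bounded _ _ _ (P \x Q)%E _ C mh hC).
rewrite /Rintegral -integral12_prod_meas1//; congr fine.
apply: eq_integral => x _; rewrite fineK//.
apply: integrable_fin_num => //; apply: (@integrable_bounded _ _ _ Q _ C) => //.
exact: measurableT_comp.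
Qed.

Lemma Rintegral_fst (g : T1 -> R) : (forall x, 0 <= g x) ->
  P.-integrable setT (EFin \o g) ->
  (P \x Q)%E.-integrable setT (EFin \o (fun z => g z.1)) /\
  (\int[(P \x Q)%E]_z g z.1)%R = (\int[P]_x g x)%R.
Proof.
move=> g0 ig; have mg : measurable_fun setT g.
  by apply/measurable_EFinP; case/integrableP: ig.
have mgf : measurable_fun setT (fun z : T1 * T2 => g z.1) by exact: measurableT_comp.
have E : (\int[(P \x Q)%E]_z (g z.1)%:E = \int[P]_x (g x)%:E)%E.
  rewrite (fubini_tonelli1 (fun z : T1 * T2 => (g z.1)%:E)).
  - apply: eq_integral => x _; rewrite /fubini_F -[LHS]/(\int[Q]_y cst (g x)%:E y)%E integral_cst//.
    by rewrite [X in (_ * X)%E]probability_setT mule1.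
  - exact/measurable_EFinP.
  - by move=> z; rewrite lee_fin.
split; last by rewrite /Rintegral E.
apply/integrableP; split; first exact/measurable_EFinP.
under eq_integral do rewrite /= ger0_norm//.
rewrite E; have /integrableP[_] := ig.
by under eq_integral do rewrite /= ger0_norm//.
Qed.

End ProductProbability.

Section ConvergenceInDistribution.
Context d (T : measurableType d) (R : realType) (P : probability T R).
Context d' (T' : measurableType d') (Q : probability T' R).

Lemma test_function_cvg_in_distribution (Y : nat -> {RV P >-> R}) (Z : T' -> R)
    (mu : set R -> \bar R) : measurable_fun setT Z ->
  (forall f C, continuous f -> (forall x, `|f x| <= C) ->
     (\int[mu]_x (f x)%:E)%E = ((\int[Q]_w f (Z w))%R)%:E) ->
  (forall K f f1 f2, test_function K f f1 f2 ->
     (\int[P]_w f (Y n w))%R @[n --> \oo] --> (\int[Q]_w f (Z w))%R) ->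
  cvg_in_distribution P Y mu.
Proof.
move=> mZ muZ test f cf [C [_ fC]].
have fC1 x : `|f x| <= C + 1 by apply: fC => //; rewrite ltrDl.
have mY n : measurable_fun setT (Y n) by exact: measurable_funP.
rewrite (muZ f _ cf fC1).
have E n : ('E_P[f \o Y n])%E = ((\int[P]_w f (Y n w))%R)%:E.
  rewrite expectation.unlock /Rintegral fineK//; apply: integrable_fin_num => //.
  apply: (@integrable_bounded _ _ _ P _ (C + 1)) => //.
  by apply: measurableT_comp => //; exact: continuous_measurable_fun.
under eq_fun do rewrite E.
apply/cvg_EFin; first exact: nearW.
exact: (test_function_weak_cvg mY mZ test cf fC1).
Qed.

End ConvergenceInDistribution.

(** * Convergence to a Gaussian mixture *)

Section Limits.
Context d (T : measurableType d) (R : realType) (P : probability T R).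
Variables (p q r s a : R).
Hypotheses (a01 : 0 < a < 1) (pE : p = 3 / 4 * a) (qE : q = a / 4) (rE : r = 1 - a).
Hypothesis s01 : 0 <= s <= 1.
Variable (X : nat -> {RV P >-> R}).
Hypothesis (hX : is_ERWS P p q r s X).
Local Notation EE := (Rintegral P setT).
Local Notation gauss := (@normal_prob R 0 1).
Local Notation scale m := (Num.sqrt (m%:R * ln m%:R)).
Implicit Types (n m : nat) (w : T).

Lemma position_walk_ae : {ae P, forall w : T, forall n : nat,
  position X n w = walk X n w /\ number_of_ones X n w = (ones X n w)%:R}.
Proof.
have pqr : p + q + r = 1 by rewrite pE qE rE; field.
apply: filterS (X_ae pqr hX) => w Xw n.
rewrite /position /number_of_ones /walk /ones natrD !visits_natr -sumrB -big_split/=.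
split; apply: eq_big_nat => k /andP[k0 _]; have := Xw k k0; rewrite !inE;
  case/or3P => /eqP ->; rewrite ?eqxx ?oppr1_neq1 ?oner_neqN1 ?subr0 ?sub0r ?addr0 ?add0r ?sqrrN ?expr1n//;
  by rewrite eq_sym oner_eq0 eq_sym oppr_eq0 oner_eq0 ?subrr ?addr0 ?expr0n.
Qed.

(** By [walk_law] the mean of a function of the number of ones and of the position
    is the mean, over the number of ones [m], of a mean of the critical walk after
    [m] steps. For almost every outcome [m] tends to infinity and the scale
    [c n m] converges, so [erw_critical_clt] gives the limit of the inner mean and
    bounded convergence that of the outer one. *)
Lemma mixture_cvg (K : R) f f1 f2 (Y : nat -> T -> R) (c : nat -> nat -> R) (C : T -> R) :
  test_function K f f1 f2 -> (forall n, measurable_fun setT (Y n)) ->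
  measurable_fun setT C -> (forall n m, 0 <= c n m) ->
  {ae P, forall w, \forall n \near \oo,
     Y n w = c n (ones X n w) * (walk X n w / scale (ones X n w))} ->
  {ae P, forall w, c n (ones X n w) @[n --> \oo] --> C w} ->
  EE (fun w => f (Y n w)) @[n --> \oo] --> EE (fun w => (\int[gauss]_y f (C w * y))%R).
Proof.
move=> tf mY mC c0 YE cC; have [cf _ _ fK _] := tf.
have fK' x : `|f x| <= K by case: (fK x).
have mf : measurable_fun setT f := continuous_measurable_fun cf.
pose V n w := c n (ones X n w) * (walk X n w / scale (ones X n w)).
have bV n : bounded_meas (fun w => f (V n w)).
  exact: (walk_bm X (fun m x => f (c n m * (x / scale m))) n).
have diff : EE (fun w => f (Y n w) - f (V n w)) @[n --> \oo] --> (0 : R).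
  rewrite -[X in _ --> X](Rintegral_prob_cst P).
  apply: (@bounded_cvg _ _ _ P _ _ (K + K)) => //.
  - by move=> n; apply: measurable_funB; [exact: measurableT_comp|case: (bV n)].
  - apply: filterS YE => w hw; apply: cvg_near_cst.
    by apply: filterS hw => n ->; rewrite -/(V n w) subrr.
  - by move=> n w; apply: le_trans (ler_normB _ _) _; exact: lerD.
have main : EE (fun w => f (V n.+1 w)) @[n --> \oo] -->
    EE (fun w => (\int[gauss]_y f (C w * y))%R).
  pose m n w := (ones X n.+1 w).-1.
  pose h n k := erw_mean s k.-1 (fun x => f (c n.+1 k * (x / scale k))).
  apply: (@cvg_eqfun _ (fun n => EE (fun w => h n (ones X n.+1 w)))).
    move=> n; rewrite /V.
    by rewrite (walk_law pE qE rE hX (fun m x => f (c n.+1 m * (x / scale m)))).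
  apply: (@bounded_cvg _ _ _ P _ _ K).
  - by move=> n; have [] := ones_bm X (h n) n.+1.
  - apply: (@measurable_Rintegral_snd _ _ _ _ _ gauss (fun z : T * _ => f (C z.1 * z.2)) K) => //.
    apply: measurableT_comp => //; apply: measurable_funM; last exact: measurable_snd.
    exact: measurableT_comp.
  - have oinf := ones_to_infinity_ae a01 pE qE rE hX.
    apply: filterS3 (ones_gt0_ae hX) oinf cC => w o0 ooo cw.
    have mE n : (m n w).+1 = ones X n.+1 w by rewrite prednK.
    have moo : m n w @[n --> \oo] --> \oo.
      apply/cvgnyPge => A; move/cvgnyPge: ooo => /(_ A.+1) [N _ hN].
      by exists N => // n /= Nn; rewrite -ltnS mE; apply: hN; exact: leqW.
    have cw1 : c n.+1 (ones X n.+1 w) @[n --> \oo] --> C w.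
      by move: cw; rewrite -(cvg_shiftS (fun n => c n (ones X n w))).
    have := erw_critical_clt s01 tf moo (fun n => c0 n.+1 (ones X n.+1 w)) cw1.
    by apply: cvg_eqfun => n; rewrite /h mE.
  - by move=> n w; exact: ew_norm.
have main' : EE (fun w => f (V n w)) @[n --> \oo] -->
    EE (fun w => (\int[gauss]_y f (C w * y))%R).
  exact: (cvg_succ (u := fun n => EE (fun w => f (V n w)))).
have := cvg_addr diff main'; rewrite add0r; apply: cvg_eqfun => n.
rewrite RintegralB ?subrK//; last exact: bm_integrable.
by apply: (@integrable_bounded _ _ _ P _ K) => //; exact: measurableT_comp.
Qed.

End Limits.

(** With [u = o n / n `^ a], the ratio [o n * ln (o n) / (n `^ a * ln n)] equals
    [a * u + u * ln u / ln n], and [u * ln u] remains bounded, also when [u] tends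
    to zero. *)
Lemma scale_ratio_cvg (R : realType) (a : R) (o : nat -> nat) (l : R) :
  0 < a -> (o n)%:R / n%:R `^ a @[n --> \oo] --> l ->
  Num.sqrt ((o n)%:R * ln (o n)%:R) / Num.sqrt (n%:R `^ a * ln n%:R)
    @[n --> \oo] --> Num.sqrt (a * l).
Proof.
move=> a0 ol; pose u n : R := (o n)%:R / n%:R `^ a.
have ln0 : (ln n%:R)^-1 @[n --> \oo] --> (0 : R).
  rewrite -(cvg_shiftS (fun n => (ln n%:R)^-1)); apply/gtr0_cvgV0; last exact: cvg_ln_nat.
  by have /cvgryPgt/(_ 0) := @cvg_ln_nat R.
have u0 n : 0 <= u n by rewrite divr_ge0// powR_ge0.
have ulnu n : - (1 + u n ^+ 2) <= u n * ln (u n) <= 1 + u n ^+ 2.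
  have := u0 n; rewrite le_eqVlt => /predU1P[<-|un0].
    by rewrite mul0r expr0n/= addr0 oppr_le0 ler01.
  have h1 : ln (u n) <= u n - 1 by rewrite -{1}[u n](subrKC 1) le_ln1Dx// ltrBrDl subrr.
  have h2 : - ln (u n) <= (u n)^-1 - 1.
    rewrite -lnV ?posrE// -{1}[(u n)^-1](subrKC 1) le_ln1Dx// ltrBrDl subrr invr_gt0//.
  have h3 : u n * - ln (u n) <= 1 - u n.
    by apply: le_trans (ler_wpM2l (ltW un0) h2) _; rewrite mulrBr divff ?gt_eqF// mulr1.
  have h4 := ler_wpM2l (ltW un0) h1.
  by apply/andP; split; nra.
have rest : u n * ln (u n) * (ln n%:R)^-1 @[n --> \oo] --> (0 : R).
  have up : (1 + u n ^+ 2) * (ln n%:R)^-1 @[n --> \oo] --> (0 : R).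
    rewrite -[X in _ --> X](mulr0 (1 + l ^+ 2)); apply: cvgM => //.
    have c1 : (fun=> 1) n @[n --> \oo] --> (1 : R) by exact: cvg_cst.
    apply: cvg_addr c1 _; rewrite expr2; under eq_fun do rewrite expr2.
    exact: cvgM.
  have dn := cvg_mulrl (-1) up; rewrite mulr0 in dn.
  apply: (squeeze_cvgr _ dn up); near=> n.
  have l0 : 0 <= (ln n%:R)^-1 :> R.
    by rewrite invr_ge0 ln_ge0// ler1n; near: n; exact: nbhs_infty_gt.
  have /andP[h1 h2] := ulnu n.
  by rewrite mulN1r -mulNr !ler_wpM2r.
have lim : a * u n + u n * ln (u n) * (ln n%:R)^-1 @[n --> \oo] --> a * l.
  by have := cvg_addr (cvg_mulrl a ol) rest; rewrite addr0.
have sq := cvg_comp _ _ lim (@sqrt_continuous R (a * l)).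
apply: cvg_trans sq; apply: near_eq_cvg; near=> n => /=.
have n1 : (1 < n)%N by near: n; exact: nbhs_infty_gt.
have n0 : 0 < n%:R :> R by rewrite ltr0n ltnW.
have L0 : 0 < ln n%:R :> R by rewrite ln_gt0// ltr1n.
have p0 : 0 < n%:R `^ a :> R by rewrite powR_gt0.
rewrite -sqrtrV ?mulr_ge0 ?(ltW p0) ?(ltW L0)//.
rewrite -sqrtrM; last first.
  case: (o n) => [|m]; first by rewrite mul0r.
  by rewrite mulr_ge0// ln_ge0// ler1n.
congr Num.sqrt; rewrite /u; case: (posnP (o n)) => [->|o0].
  by rewrite !mul0r mulr0 addr0.
have oR : 0 < (o n)%:R :> R by rewrite ltr0n.
rewrite ln_div ?posrE// ln_powR.
by field; rewrite !gt_eqF.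
Unshelve. all: by end_near. Qed.

(** * The two limit theorems *)

Definition mfun_of d (T : measurableType d) (R : realType) (f : T -> R)
    (mf : measurable_fun setT f) : {mfun T >-> R} :=
  HB.pack f (isMeasurableFun.Build _ _ _ _ f mf).

Section CriticalRegime.
Context d (T : measurableType d) (R : realType) (P : probability T R).
Variables (p q r s a : R).
Hypotheses (a01 : 0 < a < 1) (pE : p = 3 / 4 * a) (qE : q = a / 4) (rE : r = 1 - a).
Hypothesis s01 : 0 <= s <= 1.
Variable (X : nat -> {RV P >-> R}).
Hypothesis (hX : is_ERWS P p q r s X).
Local Notation EE := (Rintegral P setT).
Local Notation gauss := (@normal_prob R 0 1).

Let a0 : 0 < a. Proof. by case/andP: a01. Qed.

(** The Gaussian law lives on the real line with the sigma-algebra generated by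
    half-open intervals, which has the same measurable sets as the one carried
    by the type of reals; the integrals are identified by transfer along the
    identity. *)
Lemma gauss_integral (f : R -> R) : measurable_fun setT f ->
  gauss.-integrable setT (EFin \o f) ->
  (integral (normal_prob 0 1 : set R -> \bar R) setT (EFin \o f) =
   \int[gauss]_x (f x)%:E)%E.
Proof.
move=> mf intf.
have mid : measurable_fun setT (id : measurableTypeR R -> R).
  by move=> _ B mB; rewrite setTI; exact: mB.
have mf' : measurable_fun setT (EFin \o f) by exact/measurable_EFinP.
exact: (integral_distribution (X := mfun_of mid) mf' intf).
Qed.

(** The case of a constant scale of [mixture_cvg]. *)
Lemma critical_self_normalized :
  cvg_in_distribution P (self_normalized_position X) (normal_prob 0 1).
Proof.
apply: (@test_function_cvg_in_distribution _ _ _ _ _ _ gauss _ id) => //.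
  move=> f C cf fC; have i : gauss.-integrable setT (EFin \o f).
    by apply: (@integrable_bounded _ _ _ gauss _ C) => //; exact: continuous_measurable_fun.
  rewrite gauss_integral//; last exact: continuous_measurable_fun.
  by rewrite /Rintegral fineK//; exact: (integrable_fin_num measurableT i).
move=> K f f1 f2 tf.
have -> : (\int[gauss]_y f y)%R = EE (fun w => (\int[gauss]_y f (1 * y))%R).
  by rewrite Rintegral_prob_cst; apply: eq_Rintegral => y _; rewrite mul1r.
apply: (mixture_cvg a01 pE qE rE s01 hX (c := fun _ _ => 1) (C := fun=> 1) tf) => //.
- apply: filterS (position_walk_ae pE qE rE hX) => w hw; apply: nearW => n.
  rewrite -[LHS]/(position X n w / Num.sqrt (number_of_ones X n w * ln (number_of_ones X n w))).
  by have [-> ->] := hw n; rewrite mul1r.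
- by apply: aeW => w; exact: cvg_cst.
Qed.

(** The ratio of the two normalizations, which depends on the number of ones
    only, is the scale of [mixture_cvg]; Fubini's theorem identifies the limit with
    a mean over the product space. *)
Lemma critical_mixture (V N : {RV (P \x gauss)%E >-> R}) :
  (forall z, V z = ones_limit a X z.1) -> (forall z, N z = z.2) ->
  cvg_in_distribution P (normalized_position r X)
    (distribution (P \x gauss)%E (Gaussian_mixture a V N)).
Proof.
move=> VE NE; have mG : measurable_fun setT (Gaussian_mixture a V N).
  exact: measurable_Gaussian_mixture.
apply: (@test_function_cvg_in_distribution _ _ _ _ _ _ (P \x gauss)%E _ (Gaussian_mixture a V N)) => //.
  move=> f C cf fC; have mf : measurable_fun setT f := continuous_measurable_fun cf.
  have i : (P \x gauss)%E.-integrable setT (EFin \o (fun z => f (Gaussian_mixture a V N z))).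
    by apply: (@integrable_bounded _ _ _ (P \x gauss)%E _ C) => //; exact: measurableT_comp.
  rewrite integral_distribution//; last exact/measurable_EFinP.
  by rewrite /Rintegral fineK//; exact: integrable_fin_num.
move=> K f f1 f2 tf; have [cf _ _ fK _] := tf.
have mf : measurable_fun setT f := continuous_measurable_fun cf.
have fK' x : `|f x| <= K by case: (fK x).
have -> : (\int[(P \x gauss)%E]_z f (Gaussian_mixture a V N z))%R =
    EE (fun w => (\int[gauss]_y f (Num.sqrt (a * ones_limit a X w) * y))%R).
  have mh : measurable_fun setT (fun z => f (Gaussian_mixture a V N z)).
    exact: measurableT_comp.
  apply: etrans (Rintegral_prod P gauss mh (fun z => fK' _)) _.
  apply: eq_Rintegral => w _; apply: eq_Rintegral => y _.
  by rewrite /Gaussian_mixture VE NE.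
apply: (mixture_cvg a01 pE qE rE s01 hX
  (c := fun n m => Num.sqrt (m%:R * ln m%:R) / Num.sqrt (n%:R `^ a * ln n%:R)) tf) => //.
- apply: measurableT_comp; first exact: measurable_sqrt.
  by apply: measurable_funM => //; exact: measurable_ones_limit.
- apply: filterS2 (position_walk_ae pE qE rE hX) (ones_to_infinity_ae a01 pE qE rE hX) => w hw ooo.
  near=> n; have [E _] := hw n.
  have o1 : (1 < ones X n w)%N by near: n; move/cvgnyPge: ooo; exact.
  have o1R : 1 < (ones X n w)%:R :> R by rewrite ltr1n.
  have s0 : Num.sqrt ((ones X n w)%:R * ln (ones X n w)%:R) != 0 :> R.
    by rewrite gt_eqF// sqrtr_gt0 mulr_gt0 ?ln_gt0// (lt_trans ltr01).
  rewrite -[LHS]/(position X n w / Num.sqrt (n%:R `^ (1 - r) * ln n%:R)) E.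
  rewrite rE opprB addrCA subrr addr0.
  by rewrite [RHS]mulrC -mulrA [X in _ = _ * X]mulrA mulVf// mul1r.
- apply: filterS (ones_limit_cvg_ae a01 pE qE rE hX) => w h.
  exact: (scale_ratio_cvg a0 h).
Unshelve. all: by end_near. Qed.

Lemma ones_limit_Mittag_Leffler (V : {RV (P \x gauss)%E >-> R}) :
  (forall z, V z = ones_limit a X z.1) -> is_Mittag_Leffler (P \x gauss)%E a V.
Proof.
move=> VE; apply: moments_Mittag_Leffler; first by rewrite a0/= ltW//; case/andP: a01.
  by move=> z; rewrite VE ones_limit_ge0.
move=> k; have [i E] := moment_ones_limit a01 pE qE rE hX k.
have [||i' E'] := @Rintegral_fst _ _ _ _ _ P gauss (fun w => ones_limit a X w ^+ k).
- by move=> w; rewrite exprn_ge0// ones_limit_ge0.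
- exact: i.
have VkE : (fun z => V z ^+ k) = (fun z => ones_limit a X z.1 ^+ k).
  by apply/funext => z; rewrite VE.
by rewrite VkE E' E.
Qed.

End CriticalRegime.

Unset Implicit Arguments.
Set Strict Implicit.
Set Printing Implicit Defensive.

Theorem theorem3p6 (R : realType) (p q r s : R)
    (hp : 0 <= p <= 1) (hq : 0 <= q <= 1) (hr : 0 < r < 1) (hs : 0 <= s <= 1)
    (hpqr : p + q + r = 1)
    (d : measure_display) (T : measurableType d) (P : probability T R)
    (X : nat -> {RV P >-> R}) (hX : is_ERWS P p q r s X)
    (hcrit : p / (1 - r) = 3 / 4) :
  cvg_in_distribution P (self_normalized_position X) (normal_prob 0 1) /\
  exists (d' : measure_display) (T' : measurableType d')
         (P' : probability T' R) (Sigma' N : {RV P' >-> R}),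
    [/\ is_Mittag_Leffler P' (1 - r) Sigma',
        has_distribution P' N (normal_prob 0 1),
        independent_RV2 P' Sigma' N
      & cvg_in_distribution P (normalized_position r X)
          (distribution P' (Gaussian_mixture (1 - r) Sigma' N))].
Proof.
have [r0 r1] := andP hr; pose a := 1 - r.
have a01 : 0 < a < 1 by rewrite /a subr_gt0 r1 gtrBl.
have a0 : a != 0 by rewrite gt_eqF//; case/andP: a01.
have pE : p = 3 / 4 * a by rewrite -hcrit -/a divfK.
have qE : q = a / 4.
  have -> : q = a - p by rewrite /a -hpqr; ring.
  by rewrite pE; field.
have rE : r = 1 - a by rewrite /a opprB addrCA subrr addr0.
split; first exact: (critical_self_normalized a01 pE qE rE hs hX).
pose P' : probability _ R := (P \x normal_prob 0 1)%E.
have PE A (B : set (measurableTypeR R)) : measurable A -> measurable B ->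
    P' (A `*` B) = (P A * normal_prob 0 1 B)%E.
  by move=> mA mB; exact: (product_measure1E P (normal_prob 0 1) mA mB).
have mV : measurable_fun setT (fun z : T * measurableTypeR R => ones_limit a X z.1).
  by apply: measurableT_comp; [exact: measurable_ones_limit|exact: measurable_fst].
have mN : measurable_fun setT (fun z : T * measurableTypeR R => z.2 : R).
  by move=> _ B mB; exact: (@measurable_snd _ _ T (measurableTypeR R) _ _ mB).
pose V : {RV P' >-> R} := mfun_of mV.
pose N : {RV P' >-> R} := mfun_of mN.
have V1 A : V @^-1` A = (ones_limit a X @^-1` A) `*` setT.
  by apply/seteqP; split => -[w y] //= [].
have N2 B : N @^-1` B = setT `*` B.
  by apply/seteqP; split => -[w y] //= [].
have mlim A : measurable A -> measurable (ones_limit a X @^-1` A).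
  by move=> mA; rewrite -[_ @^-1` _]setTI; exact: measurable_ones_limit.
exists _, _, P', V, N; split.
- exact: (ones_limit_Mittag_Leffler a01 pE qE rE hX).
- move=> B mB; rewrite /distribution /pushforward N2 PE//.
  by rewrite [X in (X * _)%E]probability_setT mul1e.
- move=> A B mA mB; rewrite V1 N2.
  have -> : (ones_limit a X @^-1` A `*` setT) `&` (setT `*` B) =
      (ones_limit a X @^-1` A) `*` B.
    by apply/seteqP; split => -[w y] /=; [case=> -[? ?] [? ?]|case].
  rewrite !PE//; try exact: mlim.
  by rewrite !probability_setT mule1 mul1e.
- exact: (critical_mixture a01 pE qE rE hs hX).
Qed.
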